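(* Let $d \ge 1$ be an integer, $0 \le s \le 1$, $1 < \gamma < +\infty$, $1 \le p, q < +\infty$, $0 < \alpha < d$, and $0 < \beta_1, \beta_2 < +\infty$. Assume that $$\beta_1 p + 2\beta_2 q = 1, \qquad (d-sp)\beta_1 + (d+\alpha)\beta_2 = \frac{d}{\gamma},$$ and $$\beta_1\gamma + \beta_2\gamma \ge 1.$$ Then there exists a constant $C>0$, independent of $g$, such that for every $g \in L^1(\mathbb{R}^d)$ with compact support, $$\|g\|_{L^\gamma(\mathbb{R}^d)} \le C\, \|g\|_{\dot W^{s,p}(\mathbb{R}^d)}^{\beta_1 p} \left( \int_{\mathbb{R}^d}\int_{\mathbb{R}^d} \frac{|g(x)|^q |g(y)|^q}{|x-y|^{d-\alpha}}\, dx\, dy \right)^{\beta_2}.$$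
   Context: For an open set $\Omega \subset \mathbb{R}^d$, $1\le p<+\infty$ and $0\le s\le 1$, $$\|g\|_{\dot W^{s,p}(\Omega)} = \begin{cases} \left( \int_\Omega\int_\Omega \frac{|g(x)-g(y)|^p}{|x-y|^{d+sp}}\,dx\,dy\right)^{1/p} & \text{for } 0<s<1,\\[4pt] \left(\int_\Omega |\nabla g(x)|^p\,dx\right)^{1/p} & \text{for } s=1,\\[4pt] \left(\int_\Omega |g(x)|^p\,dx\right)^{1/p} & \text{for } s=0.\end{cases}$$ For $s=1$, $\nabla g$ is the weak gradient, and the quantity is $+\infty$ if $g$ has no locally integrable weak gradient. The quantities in the inequality may take the value $+\infty$, with the convention $+\infty \le +\infty$. *)

(* Defs.v *)
From HB Require Import structures.
From mathcomp Require Import all_boot all_order all_algebra.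
From mathcomp Require Import all_classical all_reals all_analysis.

Set Implicit Arguments.
Unset Strict Implicit.
Unset Printing Implicit Defensive.
Import Order.TTheory GRing.Theory Num.Theory.
Import numFieldNormedType.Exports.

Local Open Scope classical_set_scope.
Local Open Scope ring_scope.

(** The sigma-algebra on [R^n = 'rV[R]_n] is generated by the coordinates, as
    the library does for tuples; [measurable_rVE] shows that it is the Borel
    one. *)
Definition rV_display : measure_display. Proof. exact: default_measure_display. Qed.

Section measurable_rV.
Context {R : realType} {n : nat}.

Definition rV_coord (i : 'I_n) (x : 'rV[R]_n) : measurableTypeR R := x ord0 i.

Let rV_set0 : g_sigma_preimage rV_coord set0.
Proof. exact: sigma_algebra0. Qed.

Let rV_setC A : g_sigma_preimage rV_coord A -> g_sigma_preimage rV_coord (~` A).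
Proof. exact: sigma_algebraC. Qed.

Let rV_bigcup (F : (set 'rV[R]_n)^nat) :
  (forall i, g_sigma_preimage rV_coord (F i)) ->
  g_sigma_preimage rV_coord (\bigcup_i (F i)).
Proof. exact: sigma_algebra_bigcup. Qed.

HB.instance Definition _ := @isMeasurable.Build rV_display
  'rV[R]_n (g_sigma_preimage rV_coord) rV_set0 rV_setC rV_bigcup.

Lemma measurable_rV_coord i : measurable_fun [set: 'rV[R]_n] (rV_coord i).
Proof.
move=> _ Y mY; rewrite setTI; apply: sub_sigma_algebra => /=.
rewrite -bigcup_seq/=; exists i => /=; first by rewrite mem_index_enum.
by exists Y => //; rewrite setTI.
Qed.

Lemma measurable_fun_rVP d (T : measurableType d) (f : T -> 'rV[R]_n) :
  (forall i, measurable_fun [set: T] (rV_coord i \o f)) ->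
  measurable_fun [set: T] f.
Proof.
move=> mf _ Y mY; rewrite setTI.
move: Y mY; apply: smallest_sub.
  split => [|A|A mA]; first by rewrite preimage_set0.
  - by rewrite setTD preimage_setC; exact: measurableC.
  - by rewrite preimage_bigcup; exact: bigcupT_measurable.
rewrite -bigcup_seq; apply: bigcup_sub => i _ A [B mB <-].
by rewrite setTI -comp_preimage -[X in measurable X]setTI; exact: mf.
Qed.

Lemma measurable_rVE :
  (measurable : set (set 'rV[R]_n)) = <<s (open : set (set 'rV[R]_n)) >>.
Proof.
apply/seteqP; split; apply: smallest_sub.
- exact: smallest_sigma_algebra.
- rewrite -bigcup_seq; apply: bigcup_sub => i _ _ [B mB <-]; rewrite setTI.
  move: B mB; apply: smallest_sub.
    split => [|A|A mA]; first by rewrite preimage_set0; exact: sigma_algebra0.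
    + by rewrite setTD preimage_setC; exact: sigma_algebraC.
    + by rewrite preimage_bigcup; exact: sigma_algebra_bigcup.
  move=> _ /ocitvP[->|[[a b] /= _ ->]].
    by rewrite preimage_set0; exact: sigma_algebra0.
  have mray c : <<s open >> (rV_coord i @^-1` `]c, +oo[).
    apply: sub_sigma_algebra; apply: open_comp; last exact: interval_open.
    by move=> x _; exact: coord_continuous.
  rewrite set_itv_splitD setDE preimage_setI preimage_setC -setDE.
  exact: (@measurableD _ (g_sigma_algebraType (@open 'rV[R]_n)) _ _
    (mray a) (mray b)).
- exact: sigma_algebra_measurable.
- move=> U oU.
  pose box (p : 'rV[rat]_n * 'rV[rat]_n) := [set x : 'rV[R]_n | forall i,
    `](ratr (p.1 ord0 i) : R), ratr (p.2 ord0 i)[%classic (x ord0 i)].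
  have mbox p : measurable (box p).
    rewrite (_ : box p = \bigcap_(i in [set: 'I_n])
        (rV_coord i @^-1` `](ratr (p.1 ord0 i)), (ratr (p.2 ord0 i))[)).
      apply: fin_bigcap_measurable => // i _.
      by rewrite -[X in measurable X]setTI; exact: measurable_rV_coord.
    by apply/seteqP; split => [x px i _|x px i]; [exact: px|exact: (px i I)].
  rewrite (_ : U = \bigcup_p (if `[< box p `<=` U >] then box p else set0)).
    apply: countable_bigcupT_measurable => // p.
    by case: ifP => // _; exact: measurable0.
  apply/seteqP; split => [x Ux|x [p _]]; last first.
    by case: asboolP => // pU; exact: pU.
  have /nbhs_ballP[e /= e0 xeU] := open_nbhs_nbhs (conj oU Ux).
  have /choice[a ax] : forall i, exists q : rat,
      (ratr q : R) \in `](x ord0 i - e), (x ord0 i)[.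
    move=> i; have /rat_in_itvoo[q qx] : x ord0 i - e < x ord0 i.
      by rewrite ltrBlDr ltrDl.
    by exists q.
  have /choice[b bx] : forall i, exists q : rat,
      (ratr q : R) \in `](x ord0 i), (x ord0 i + e)[.
    move=> i; have /rat_in_itvoo[q qx] : x ord0 i < x ord0 i + e.
      by rewrite ltrDl.
    by exists q.
  exists (\row_i a i, \row_i b i) => //=.
  case: asboolP => [_ i|[]] /=.
    by rewrite !mxE in_itv/= (itvP (ax i)) (itvP (bx i)).
  move=> y /= yab; apply: xeU; split => // i j; rewrite ord1.
  have := yab j; rewrite /= !mxE in_itv/= => /andP[ay yb].
  rewrite /ball/= distrC ltr_distl (lt_trans _ ay) ?(lt_trans yb)//.
  + by rewrite (itvP (bx j)).
  + by rewrite (itvP (ax j)).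
Qed.

End measurable_rV.

Section lebesgue_rV.
Context {R : realType}.

Definition rV_cons n (p : measurableTypeR R * 'rV[R]_n) : 'rV[R]_n.+1 :=
  \row_i oapp (p.2 ord0) p.1 (unlift ord0 i).

Definition rV_uncons n (x : 'rV[R]_n.+1) : measurableTypeR R * 'rV[R]_n :=
  (x ord0 ord0, \row_i x ord0 (lift ord0 i)).

Lemma rV_consK n : cancel (@rV_cons n) (@rV_uncons n).
Proof.
move=> [a x]; congr pair => /=; first by rewrite mxE unlift_none.
by apply/rowP => i; rewrite !mxE liftK.
Qed.

Lemma measurable_rV_cons n : measurable_fun setT (@rV_cons n).
Proof.
apply: measurable_fun_rVP => i; rewrite /comp /rV_coord.
under eq_fun do rewrite mxE.
case: unliftP => [j _|_] /=; last exact: measurable_fst.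
apply: (@measurableT_comp _ _ _ _ _ _ (rV_coord j)) => //.
exact: measurable_rV_coord.
Qed.

Lemma measurable_rV_uncons n : measurable_fun setT (@rV_uncons n).
Proof.
apply/measurable_fun_pairP; split; first exact: measurable_rV_coord.
apply: measurable_fun_rVP => i; rewrite /comp /rV_coord.
under eq_fun do rewrite mxE.
exact: measurable_rV_coord.
Qed.

Section step.
Variables (n : nat) (mu : {sigma_finite_measure set 'rV[R]_n -> \bar R}).
Local Open Scope ereal_scope.

Definition lebesgue_rV_step : set 'rV[R]_n.+1 -> \bar R :=
  pushforward (@lebesgue_measure R \x mu) (@rV_cons n).

Let step0 : lebesgue_rV_step set0 = 0.
Proof. by rewrite /lebesgue_rV_step /pushforward preimage_set0 measure0. Qed.

Let step_ge0 A : 0 <= lebesgue_rV_step A.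
Proof. by rewrite /lebesgue_rV_step /pushforward measure_ge0. Qed.

Let step_sigma_additive : semi_sigma_additive lebesgue_rV_step.
Proof.
move=> F mF tF mUF.
have mE A : measurable A -> measurable (@rV_cons n @^-1` A).
  by move=> mA; rewrite -[X in measurable X]setTI; exact: measurable_rV_cons.
rewrite /lebesgue_rV_step /pushforward preimage_bigcup.
apply: measure_semi_sigma_additive => [k||]; first exact: mE.
- apply/trivIsetP => i j _ _ ij; rewrite -preimage_setI.
  by move/trivIsetP : tF => /(_ _ _ _ _ ij) ->//; rewrite preimage_set0.
- by rewrite -preimage_bigcup; exact: mE.
Qed.

HB.instance Definition _ := isMeasure.Build _ _ _ lebesgue_rV_step
  step0 step_ge0 step_sigma_additive.

Let step_sigma_finite : sigma_finite setT lebesgue_rV_step.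
Proof.
have /sigma_finiteP[F [TF ndF Foo]] := sigma_finiteT (@lebesgue_measure R).
have /sigma_finiteP[G [TG ndG Goo]] := sigma_finiteT mu.
exists (fun k => @rV_uncons n @^-1` (F k `*` G k)).
  rewrite -preimage_bigcup (_ : \bigcup_k _ = setT) ?preimage_setT//.
  apply/seteqP; split => // -[x y] _.
  have : [set: measurableTypeR R] x by [].
  rewrite TF => -[k _ Fkx].
  have : [set: 'rV[R]_n] y by [].
  rewrite TG => -[l _ Gly]; exists (maxn k l) => //; split => /=.
    by move: x Fkx; exact/subsetPset/ndF/leq_maxl.
  by move: y Gly; exact/subsetPset/ndG/leq_maxr.
move=> k; have [mF Fk] := Foo k; have [mG Gk] := Goo k; split.
  rewrite -[X in measurable X]setTI; apply: measurable_rV_uncons => //.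
  exact: measurableX.
rewrite /lebesgue_rV_step /pushforward -comp_preimage.
rewrite (_ : _ \o _ = id) ?preimage_id; last by apply/funext; exact: rV_consK.
by rewrite product_measure1E// lte_mul_pinfty// ge0_fin_numE.
Qed.

HB.instance Definition _ := Measure_isSigmaFinite.Build _ _ _ lebesgue_rV_step
  step_sigma_finite.

End step.

(** The product of [n] copies of the Lebesgue measure of [R] (for [n = 0], the
    unit mass on the only point). *)
Fixpoint lebesgue_rV n : {sigma_finite_measure set 'rV[R]_n -> \bar R} :=
  match n with
  | 0 => \d_(0 : 'rV[R]_0)
  | n'.+1 => lebesgue_rV_step (lebesgue_rV n')
  end.

Lemma lebesgue_rV_box n (A : 'I_n -> set (measurableTypeR R)) :
  (forall i, measurable (A i)) ->
  lebesgue_rV n [set x | forall i, A i (x ord0 i)] =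
  (\prod_(i < n) lebesgue_measure (A i))%E.
Proof.
elim: n A => [|n IHn] A mA.
  by rewrite big_ord0 /= diracE mem_set//= => -[].
have mB : measurable [set x : 'rV[R]_n | forall i, A (lift ord0 i) (x ord0 i)].
  rewrite (_ : mkset _ = \bigcap_(i in [set: 'I_n])
      (rV_coord i @^-1` A (lift ord0 i))).
    apply: fin_bigcap_measurable => // i _.
    by rewrite -[X in measurable X]setTI; exact: measurable_rV_coord.
  by apply/seteqP; split => [x Ax i _|x Ax i]; [exact: Ax|exact: (Ax i I)].
rewrite big_ord_recl -IHn// -[RHS]product_measure1E//=.
rewrite /lebesgue_rV_step /pushforward.
congr ((_ \x _)%E _); apply/seteqP; split => [[a x] /= Ax|[a x] /= [Aa Ax] i].
- split; first by have := Ax ord0; rewrite mxE unlift_none.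
  by move=> i; have := Ax (lift ord0 i); rewrite mxE liftK.
- by rewrite mxE; case: unliftP => [j ->|->] /=.
Qed.

End lebesgue_rV.

Section sobolev.
Context {R : realType} {d : nat}.
Implicit Types (Omega : set 'rV[R]_d) (f g phi : 'rV[R]_d -> R).
Local Notation mu := (@lebesgue_rV R d).

(** Euclidean norm; the library's [`|x|] on matrices is the maximum norm. *)
Definition enorm (x : 'rV[R]_d) : R := Num.sqrt (\sum_i x ord0 i ^+ 2).

(** Support of the class of [g] modulo almost-everywhere equality: the
    complement of the largest open set on which [g] vanishes almost
    everywhere. *)
Definition ess_supp g : set 'rV[R]_d :=
  ~` \bigcup_(U in [set U | open U /\ {ae mu, forall x, U x -> g x = 0}]) U.

Definition basis_vec (i : 'I_d) : 'rV[R]_d := delta_mx ord0 i.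

Definition partial (i : 'I_d) f : 'rV[R]_d -> R := 'D_(basis_vec i) f.

Definition smooth f := forall s : seq 'I_d,
  continuous (foldr partial f s) /\
  forall x i, derivable (foldr partial f s) x (basis_vec i).

Definition test_function Omega phi :=
  let supp := closure [set x | phi x != 0] in
  [/\ smooth phi, compact supp & supp `<=` Omega].

Definition loc_integrable Omega f :=
  forall K, compact K -> K `<=` Omega -> mu.-integrable K (EFin \o f).

Definition is_weak_gradient Omega g (G : 'rV[R]_d -> 'rV[R]_d) :=
  [/\ loc_integrable Omega g,
      forall i, loc_integrable Omega (fun x => G x ord0 i) &
      forall i phi, test_function Omega phi ->
        (\int[mu]_(x in Omega) (g x * partial i phi x)%:E =
         - \int[mu]_(x in Omega) (G x ord0 i * phi x)%:E)%E].

Definition has_weak_gradient Omega g := exists G, is_weak_gradient Omega g G.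

Definition weak_gradient Omega g : 'rV[R]_d -> 'rV[R]_d :=
  get (is_weak_gradient Omega g).

Local Open Scope ereal_scope.

(** The integrands of the two double integrals below vanish on the diagonal,
    since [0^-1 = 0]; for [0 < d] the diagonal is negligible. *)
Definition sobolev_seminorm Omega (s p : R) g : \bar R :=
  if s == 0%R then
    (\int[mu]_(x in Omega) (`|g x| `^ p)%:E) `^ p^-1
  else if s == 1%R then
    if `[< has_weak_gradient Omega g >] then
      (\int[mu]_(x in Omega) (enorm (weak_gradient Omega g x) `^ p)%:E) `^ p^-1
    else +oo
  else
    (\int[mu]_(y in Omega) \int[mu]_(x in Omega)
      (`|g x - g y| `^ p / enorm (x - y) `^ (d%:R + s * p))%:E) `^ p^-1.

Definition coulomb_energy (alpha q : R) g : \bar R :=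
  \int[mu]_y \int[mu]_x
    (`|g x| `^ q * `|g y| `^ q / enorm (x - y) `^ (d%:R - alpha))%:E.

End sobolev.

(* Main.v *)
(** The hypotheses force [s > 0], and it suffices to find, for every level
    [t = 2^k], a bound on [t^gamma |{|g| >= 2t}|] that can be summed over [k].
    Let [h] be the part of [|g|] between [t] and [2t], and halve the space
    dyadically, one coordinate at a time. Almost every point of
    [{|g| >= 2t}] has a cell filled mostly by this set. Climb from there to the
    first ancestor of which [{|g| > t}] covers at most half: along the way the
    mean of [h] drops by a fixed part of [t], so at one step it drops by more
    than the corresponding term of a geometric series. At that cell [Q] the drop
    bounds the share [nu Q] of the Sobolev energy of [h] from below, and the
    size of [{|g| > t}] in the ancestors bounds the share [eps Q] of the Coulomb
    energy at level [t] from below; for a suitable ratio of the series,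
    [t^gamma |Q| <= C nu(Q)^A eps(Q)^B] with [A = beta1 gamma],
    [B = beta2 gamma]. As [A + B >= 1], this is linear in [nu Q] and [eps Q]
    after normalisation, and one sums over the maximal such cells, then over
    the levels.

    The Sobolev energy enters only through a bound of the difference of the two
    half-cell means of [h]. For [s < 1] it is Jensen's inequality. For [s = 1]
    the weak formula, tested on products of one-variable bumps, shows that [g]
    is absolutely continuous along almost every line, and the increment of
    [h] is then controlled by the gradient on [{t < |g| < 2t}]. *)
Require Import Defs.
From HB Require Import structures.
From mathcomp Require Import all_boot all_order all_algebra.
From mathcomp Require Import all_classical all_reals all_analysis.
From mathcomp Require Import measurable_realfun ring lra zify.
Import Order.TTheory GRing.Theory Num.Theory.
Import numFieldNormedType.Exports.
Set Implicit Arguments.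
Unset Strict Implicit.
Unset Printing Implicit Defensive.
Local Open Scope classical_set_scope.
Local Open Scope ring_scope.

(** * Dyadic cells *)

(** The obstacle is that the drop of the means is spread over an unknown number of scales: at the
    step that is found, [j] levels below the sparse ancestor, only a part [lam^j] of [t] is
    guaranteed. The Coulomb energy repays this loss. Seen from a point of the small cell, the part
    of [{|g| > t}] in the ancestor, whose volume is [2^j] times larger, bounds the potential from
    below by [2^(alpha j/d)] times what the small cell alone would give. The choice
    [lam^(p A) = 2^(- alpha B/d)] balances the two exactly, and [alpha > 0] makes [lam < 1].

    Maximal cells exist only if volumes are bounded; the bound comes from the estimate itself, as
    finite energies control [t^gamma |Q|].

    One principle stands in for covering and differentiation theorems: since cells are nested, an
    inequality between two measures on cells passes to unions of cells, then by regularity to all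
    measurable sets. It yields density, translation invariance and the vanishing of functions with
    zero integral on cells.

    For [s = 1] no chain rule is applied to the truncation: its increment along a line is compared
    with that of the function over a subinterval on which the function stays in the band. *)

Section dyadic_cells.
Context {R : realType} {d : nat}.
Local Notation V := 'rV[R]_d.
Local Notation mu := (@lebesgue_rV R d).
Local Notation index := {ffun 'I_d -> int}.
Implicit Types (n : int) (z : index) (x y : V).

(** Going from level [n] to [n + 1] halves the cells in the single direction
    [n mod d], so that cells of level [n] have volume [2^-n] and bounded
    eccentricity. *)
Definition dexp n (i : 'I_d) : int := ((n + d%:Z - 1 - i%:Z) %/ d%:Z)%Z.

Definition split_dir n (i : 'I_d) : bool := (n %% d%:Z)%Z == i%:Z.

Definition cell_index n x : index := [ffun i => Num.floor ((2 : R) ^ dexp n i * x ord0 i)].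

Definition cell n z : set V := [set x | cell_index n x = z].

(** [dexp n i] is the ceiling of [(n - i) / d], the signed number of levels congruent to [i] between
    [0] and [n]; it increases exactly when [n] is such a level. *)
Lemma dexpS n i : dexp (n + 1) i = dexp n i + (split_dir n i)%:Z.
Proof.
rewrite /dexp /split_dir; have := ltn_ord i; move: (i : nat) => {}i id.
have d0 : d%:Z != 0 by lia.
have e1 := divz_eq n d%:Z.
set a := (n %/ d%:Z)%Z in e1; set r := (n %% d%:Z)%Z in e1 *.
have r0 : 0 <= r by apply: modz_ge0.
have rd : r < d%:Z by apply: ltz_pmod; lia.
have [E|E|E] := ltgtP r i%:Z => /=.
- have -> : n + d%:Z - 1 - i%:Z = a * d%:Z + (r + d%:Z - 1 - i%:Z) by lia.
  have -> : n + 1 + d%:Z - 1 - i%:Z = a * d%:Z + (r + d%:Z - i%:Z) by lia.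
  by rewrite !divzMDl// !divz_small//; lia.
- have -> : n + d%:Z - 1 - i%:Z = (a + 1) * d%:Z + (r - 1 - i%:Z) by lia.
  have -> : n + 1 + d%:Z - 1 - i%:Z = (a + 1) * d%:Z + (r - i%:Z) by lia.
  by rewrite !divzMDl// !divz_small//; lia.
- have -> : n + d%:Z - 1 - i%:Z = a * d%:Z + (r + d%:Z - 1 - i%:Z) by lia.
  have -> : n + 1 + d%:Z - 1 - i%:Z = (a + 1) * d%:Z + (r - i%:Z) by lia.
  by rewrite !divzMDl// !divz_small//; lia.
Qed.

Lemma split_dir_ord (hd : (0 < d)%N) n : exists i0 : 'I_d, forall i, split_dir n i = (i == i0).
Proof.
have r0 : 0 <= (n %% d%:Z)%Z by apply: modz_ge0; lia.
have rd : (n %% d%:Z)%Z < d%:Z by apply: ltz_pmod; lia.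
have h : (`|(n %% d%:Z)%Z|%N < d)%N by lia.
exists (Ordinal h) => i; rewrite /split_dir -val_eqE /=; lia.
Qed.

(** Each step halves one direction, so the sum grows by one; this gives all cells of level [n] the
    volume [2^-n]. Negative levels run the same recurrence backwards. *)
Lemma dexp_sum (hd : (0 < d)%N) n : \sum_i dexp n i = n.
Proof.
have S m : \sum_i dexp (m + 1) i = \sum_i dexp m i + 1.
  under eq_bigr do rewrite dexpS.
  rewrite big_split /=; congr (_ + _).
  have [i0 Hi] := split_dir_ord hd m.
  rewrite (bigD1 i0) //= Hi eqxx big1 ?addr0 // => i ii0.
  by rewrite Hi (negbTE ii0).
elim/int_rec: n => [|n IH|n IH].
- rewrite big1 // => i _; rewrite /dexp add0r; apply: divz_small.
  by have := ltn_ord i; lia.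
- by rewrite intS addrC S IH addrC.
- have := S (- n.+1%:Z).
  have -> : - n.+1%:Z + 1 = - n%:Z by lia.
  rewrite IH => /esym h; rewrite -[LHS](addrK 1) h; lia.
Qed.

(** The remainder and the index are both at most [d - 1]. For cells it means that no side exceeds
    [2 * 2^(-n/d)], the source of all diameter bounds. *)
Lemma le_dexp n i : n <= d%:Z * dexp n i + d%:Z - 1.
Proof.
rewrite /dexp; have := ltn_ord i; move: (i : nat) => {}i id.
have d0 : 0 < d%:Z by lia.
have := divz_eq (n + d%:Z - 1 - i%:Z) d%:Z.
have := ltz_pmod (n + d%:Z - 1 - i%:Z) d0.
have : 0 <= ((n + d%:Z - 1 - i%:Z) %% d%:Z)%Z by apply: modz_ge0; lia.
move: ((n + d%:Z - 1 - i%:Z) %% d%:Z)%Z ((n + d%:Z - 1 - i%:Z) %/ d%:Z)%Z => r a.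
lia.
Qed.

Lemma exp2z_gt0 (e : int) : 0 < (2 : R) ^ e.
Proof. by rewrite exprz_gt0. Qed.

Lemma cellP n z x : cell n z x <-> forall i,
  (z i)%:~R * 2 ^ (- dexp n i) <= x ord0 i < (z i + 1)%:~R * 2 ^ (- dexp n i).
Proof.
have E i : (Num.floor ((2 : R) ^ dexp n i * x ord0 i) == z i) =
   ((z i)%:~R * 2 ^ (- dexp n i) <= x ord0 i < (z i + 1)%:~R * 2 ^ (- dexp n i)).
  rewrite floor_eq -!invr_expz ler_pdivrMr ?exp2z_gt0// ltr_pdivlMr ?exp2z_gt0//.
  by rewrite mulrC.
split=> [h i|H]; first by rewrite -E -[z]h ffunE eqxx.
by apply/ffunP => i; rewrite ffunE; apply/eqP; rewrite E.
Qed.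

Lemma mem_cell_index n x : cell n (cell_index n x) x.
Proof. by []. Qed.

Lemma floor2 (a : R) : (Num.floor (2 * a) %/ 2)%Z = Num.floor a.
Proof.
apply/esym/eqP; rewrite floor_eq.
have /andP[h1 h2] := floor_itv (2 * a).
have := divz_eq (Num.floor (2 * a)) 2.
have : (Num.floor (2 * a) %% 2)%Z < 2 by apply: ltz_pmod.
have : 0 <= (Num.floor (2 * a) %% 2)%Z by apply: modz_ge0.
move: (_ %/ _)%Z (_ %% _)%Z => b r r0 r2 e1; have r1 : r <= 1 by lia.
have r0' : (0 : R) <= r%:~R by rewrite ler0z.
have r1' : r%:~R <= (1 : R) by rewrite lerz1.
move: h1 h2; rewrite e1 !intrD !intrM (_ : 2%:~R = 2 :> R)//.
move=> h1 h2; apply/andP; split; lra.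
Qed.

Definition parent n z : index :=
  [ffun i => if split_dir n i then (z i %/ 2)%Z else z i].

Lemma cell_index_parent n x : cell_index n x = parent n (cell_index (n + 1) x).
Proof.
apply/ffunP => i; rewrite !ffunE dexpS.
case: (split_dir n i); last by rewrite addr0.
rewrite expfzDr// -floor2; congr (Num.floor _ %/ _)%Z.
by rewrite expr1z; ring.
Qed.

Lemma cell_index_coarse n (k : nat) x y :
  cell_index (n + k%:Z) x = cell_index (n + k%:Z) y -> cell_index n x = cell_index n y.
Proof.
elim: k => [|k IH]; first by rewrite addr0.
move=> h; apply: IH; rewrite !(cell_index_parent (n + k)).
have -> : n + k%:Z + 1 = n + k.+1%:Z by lia.
by rewrite h.
Qed.

Lemma measurable_cell n z : measurable (cell n z).
Proof.
have -> : cell n z = \bigcap_(i in [set: 'I_d]) (rV_coord i @^-1`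
   `[(z i)%:~R * 2 ^ (- dexp n i), (z i + 1)%:~R * 2 ^ (- dexp n i)[%classic).
  apply/seteqP; split => [x /cellP xz i _|x xz].
    by rewrite /= in_itv /= /rV_coord xz.
  by apply/cellP => i; have := xz i I; rewrite /= in_itv.
apply: fin_bigcap_measurable => // i _.
rewrite -[X in measurable X]setTI.
by apply: measurable_rV_coord => //; exact: measurable_itv.
Qed.
Hint Resolve measurable_cell : core.

Definition vol n : R := 2 ^ (- n).

Lemma vol_gt0 n : 0 < vol n. Proof. exact: exp2z_gt0. Qed.

Lemma volS n : vol n = 2 * vol (n + 1).
Proof. by rewrite /vol opprD expfzDr// -!invr_expz expr1z; field; rewrite ?pnatr_eq0 ?gt_eqF ?exp2z_gt0. Qed.

Lemma cell_volume (hd : (0 < d)%N) n z : mu (cell n z) = (vol n)%:E.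
Proof.
have -> : cell n z = [set x | forall i,
   `[(z i)%:~R * 2 ^ (- dexp n i), (z i + 1)%:~R * 2 ^ (- dexp n i)[%classic (x ord0 i)].
  apply/seteqP; split => [x /cellP xz i|x xz].
    by rewrite /= in_itv /= xz.
  by apply/cellP => i; have := xz i; rewrite /= in_itv.
rewrite (@lebesgue_rV_box R d (fun i => `[(z i)%:~R * 2 ^ (- dexp n i), (z i + 1)%:~R * 2 ^ (- dexp n i)[%classic)); last by move=> i; exact: measurable_itv.
under eq_bigr => i _.
  rewrite lebesgue_measure_itv /= lte_fin ltr_pM2r ?exp2z_gt0// ltr_int ltrDl ltr01.
  rewrite -EFinB -mulrBl intrD addrAC subrr add0r mul1r.
  over.
rewrite prodEFin /vol; congr EFin.
rewrite -[in RHS](dexp_sum hd n) -sumrN.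
elim/big_rec2 : _ => [//|i a b _ ->]; by rewrite -expfzDr.
Qed.

End dyadic_cells.
#[global] Hint Extern 0 (measurable (cell _ _)) => solve [apply: measurable_cell] : core.

(** * Comparison of measures through their values on cells *)

Section cell_measures.
Context {R : realType} {d : nat}.
Local Notation V := 'rV[R]_d.
Local Notation mu := (@lebesgue_rV R d).
Local Notation index := {ffun 'I_d -> int}.
Implicit Types (n : int) (z : index) (x y : V).

(* Keep the cells not contained in a coarser cell of the family: they are
   pairwise disjoint and still cover. *)
Lemma le_measure_cells (n : int) (good : nat -> index -> Prop)
    (m1 m2 : {measure set V -> \bar R}) :
  (forall k z, good k z ->
    (m1 (cell (n + k%:Z) z) <= m2 (cell (n + k%:Z) z))%E) ->
  let U := [set x | exists k, good k (cell_index (n + k%:Z) x)] in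
  measurable U /\ (m1 U <= m2 U)%E.
Proof.
move=> m12 U.
pose first k z := good k z /\
  forall x, cell (n + k%:Z) z x -> forall j, (j < k)%N -> ~ good j (cell_index (n + j%:Z) x).
(* Cells are listed by their codes. [pickle_inv] returns a pair at its own code only, which makes
   [F] disjoint. *)
pose F (j : nat) : set V := match pickle_inv j with
  | Some (k, z) => if `[< first k z >] then cell (n + k%:Z) z else set0
  | None => set0 end.
have mF j : measurable (F j).
  rewrite /F; case: pickle_inv => [[k z]|]; last exact: measurable0.
  by case: ifP => // _; exact: measurable0.
have Fx j x : F j x -> exists k, pickle_inv j = Some (k, cell_index (n + k%:Z) x)
    /\ first k (cell_index (n + k%:Z) x).
  rewrite /F; case: pickle_inv => [[k z]|//]; case: asboolP => // fkz xz.
  by exists k; rewrite (xz : cell_index _ x = z).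
have UE : U = \bigcup_j F j.
  apply/seteqP; split => [x|x [j _ /Fx[k [_ [gk _]]]]]; last by exists k.
  move=> /= exU.
  have exU' : exists k, `[< good k (cell_index (n + k%:Z) x) >].
    by case: exU => k gk; exists k; apply/asboolP.
  have [k /asboolP gk kmin] := ex_minnP exU'.
  exists (pickle (k, cell_index (n + k%:Z) x)) => //.
  rewrite /F pickleK_inv; case: asboolP => // -[]; split=> // y yx j jk gj.
  have : (k <= j)%N.
    apply: kmin; apply/asboolP.
    rewrite (@cell_index_coarse _ _ (n + j%:Z) (k - j) x y)//.
    by rewrite -addrA -PoszD subnKC ?yx// ltnW.
  by rewrite leqNgt jk.
have tF : trivIset setT F.
  move=> i j _ _ [x [/Fx[k [ik [gk fk]]] /Fx[l [jl [gl fl]]]]].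
  have kl : k = l.
    have [kl|kl|//] := ltngtP k l.
    - by case: (fl x (mem_cell_index _ _) _ kl).
    - by case: (fk x (mem_cell_index _ _) _ kl).
  have := @pickle_invK (nat * index)%type i; have := @pickle_invK (nat * index)%type j.
  by rewrite ik jl kl /= => -> ->.
rewrite UE; split; first exact: bigcupT_measurable.
rewrite !measure_semi_bigcup//; last exact: bigcupT_measurable.
  2: exact: bigcupT_measurable.
apply: lee_nneseries => // j _; rewrite /F.
case: pickle_inv => [[k z]|]; last by rewrite !measure0.
by case: asboolP => [[gk _]|_]; [exact: m12|rewrite !measure0].
Qed.

Definition child n z (b : bool) : index :=
  [ffun i => if split_dir n i then 2 * z i + b%:Z else z i].

Lemma parent_child n z b : parent n (child n z b) = z.
Proof.
apply/ffunP => i; rewrite !ffunE; case: (split_dir n i) => //.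
by rewrite mulrC divzMDl// divz_small ?addr0//; case: b.
Qed.

Lemma cell_child (hd : (0 < d)%N) n z : cell n z =
  cell (n + 1) (child n z false) `|` cell (n + 1) (child n z true) :> set V.
Proof.
have par b x : cell (n + 1) (child n z b) x -> cell n z x.
  by move=> h; rewrite /cell /= cell_index_parent (h : cell_index _ x = _) parent_child.
apply/seteqP; split => [x xz|x [|]]; [|exact: par|exact: par].
have [i0 Hi] := split_dir_ord hd n.
pose w := cell_index (n + 1) x.
have wz : parent n w = z by rewrite -cell_index_parent.
have wE (b : bool) : (w i0 %% 2)%Z = b%:Z -> cell (n + 1) (child n z b) x.
  move=> wb; rewrite /cell /= -/w -wz; move: (w) wb => u wb.
  apply/ffunP => i; rewrite !ffunE Hi.
  have [->|//] := eqVneq i i0.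
  by rewrite {1}(divz_eq (u i0) 2) wb mulrC.
have w0 : 0 <= (w i0 %% 2)%Z by apply: modz_ge0.
have w2 : (w i0 %% 2)%Z < 2 by apply: ltz_pmod.
have [w1|w1] : (w i0 %% 2)%Z = 0 \/ (w i0 %% 2)%Z = 1 by lia.
- by left; apply: wE.
- by right; apply: wE.
Qed.

Lemma child_disjoint (hd : (0 < d)%N) n z :
  cell (n + 1) (child n z false) `&` cell (n + 1) (child n z true) = set0 :> set V.
Proof.
apply/seteqP; split => // x [h1 h2].
have [i0 Hi] := split_dir_ord hd n.
have := (etrans (esym h1) h2).
by move=> /ffunP/(_ i0); rewrite !ffunE Hi eqxx; lia.
Qed.

(** Open sets of the topology generated by the cells of nonnegative level. It refines the Euclidean
    topology, and its open sets have the shape treated by [le_measure_cells]. *)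
Definition cell_open (U : set V) := forall x, U x ->
  exists k : nat, cell k%:Z (cell_index k%:Z x) `<=` U.

Lemma cell_openE U : cell_open U ->
  U = [set x | exists k : nat, cell (0 + k%:Z) (cell_index (0 + k%:Z) x) `<=` U].
Proof.
move=> oU; apply/seteqP; split => [x /oU[k kU]|x /= [k kU]].
  by exists k; rewrite add0r.
exact: kU.
Qed.

Lemma measurable_cell_open U : cell_open U -> measurable U.
Proof.
move=> /cell_openE ->.
(* Comparing [mu] with itself leaves only the measurability of the union. *)
by have [] := @le_measure_cells 0 (fun k z => cell (0 + k%:Z) z `<=` U) mu mu (fun _ _ _ => lexx _).
Qed.

Lemma cell_openI U W : cell_open U -> cell_open W -> cell_open (U `&` W).
Proof.
have mono (k l : nat) x (A : set V) : (k <= l)%N -> cell k%:Z (cell_index k%:Z x) `<=` A ->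
    cell l%:Z (cell_index l%:Z x) `<=` A.
  move=> kl kA y yx; apply: kA; apply: (@cell_index_coarse _ _ _ (l - k)).
  by rewrite -PoszD subnKC.
move=> oU oW x [/oU[k kU] /oW[l lW]]; exists (maxn k l); rewrite subsetI; split.
  by apply: mono kU; exact: leq_maxl.
by apply: mono lW; exact: leq_maxr.
Qed.

Lemma cell_open_bigcup I (U : I -> set V) : (forall i, cell_open (U i)) ->
  cell_open (\bigcup_i U i).
Proof.
by move=> oU x [i _ /oU[k kU]]; exists k; apply: subset_trans kU _; exact: bigcup_sup.
Qed.

Lemma exprz_le_of_nat (e : int) (K : nat) : K%:Z <= e -> (2 : R) ^ (- e) <= (2 ^+ K)^-1.
Proof.
move=> Ke; rewrite -invr_expz lef_pV2 ?posrE ?exp2z_gt0 ?exprn_gt0//.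
by rewrite (ler_eXz2l (ltr1n _ 2) K%:Z).
Qed.

Lemma open_cell_open U : open U -> cell_open U.
Proof.
move=> oU x Ux.
have /nbhs_ballP[e /= e0 xeU] := open_nbhs_nbhs (conj oU Ux).
have [K Ke] : exists K : nat, (2 ^+ K)^-1 < e.
  have [K _ HK] := near_infty_natSinv_lt (PosNum e0).
  exists K; apply: le_lt_trans (HK K (leqnn _)) => /=.
  rewrite lef_pV2 ?posrE ?exprn_gt0 ?ltr0n// -natrX ler_nat.
  exact: ltn_expl.
(* At this level each direction has been halved more than [K] times, so all sides are shorter than
   [e]. *)
exists (d * K.+1)%N => y /cellP yx; apply: xeU; split => // i j; rewrite ord1.
have hd : (0 < d)%N by apply: leq_trans (ltn_ord j).
have /cellP/(_ j) := mem_cell_index (d * K.+1)%N%:Z x; have := yx j.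
have : (2 : R) ^ (- dexp (d * K.+1)%N%:Z j) < e.
  apply: le_lt_trans Ke; apply: exprz_le_of_nat.
  have := le_dexp (d * K.+1)%N%:Z j.
  nia.
move: (2 ^ _) => r re; rewrite intrD mulrDl mul1r.
move: (_%:~R * r) => u /andP[a1 a2] /andP[a3 a4].
by rewrite /ball/= ltr_norml; apply/andP; split; lra.
Qed.

(** Outer regularity of [A] and of its complement at once: the overlap contains [U] minus [A], and
    passing to the complement merely swaps [U] and [W]. *)
Definition cell_regular (m : set V -> \bar R) (A : set V) :=
  forall e : R, 0 < e -> exists U W,
  [/\ cell_open U, cell_open W, A `<=` U, ~` A `<=` W & (m (U `&` W) <= e%:E)%E].

(** The regular sets form a sigma-algebra containing the open sets. Finiteness of [m] gives
    continuity along decreasing sequences, used both for open sets and for countable unions. *)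
Lemma measurable_cell_regular (m : {measure set V -> \bar R}) A :
  (m setT < +oo)%E -> measurable A -> cell_regular m A.
Proof.
move=> moo; move: A.
have mfin B : measurable B -> (m B < +oo)%E.
  by move=> mB; apply: le_lt_trans moo; apply: le_measure; rewrite ?inE//; exact: measurableT.
have small (F : (set V)^nat) (e : R) : (forall i, measurable (F i)) ->
    nonincreasing_seq F -> (m (\bigcap_n F n) < e%:E)%E -> exists n : nat, (m (F n) <= e%:E)%E.
  move=> mF dF Fe.
  have := nonincreasing_cvg_mu (mfin _ (mF 0%N)) mF (bigcapT_measurable mF) dF.
  move=> cF.
  have : \forall n \near \oo%nat, (m (F n) < e%:E)%E.
    exact: (cF _ (open_ereal_lt' Fe)).
  by case=> n _ /(_ n (leqnn n)) h; exists n; exact: ltW.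
rewrite measurable_rVE; apply: smallest_sub; last first.
  move=> O /open_cell_open oO e e0.
  (* The cells of level [k] not inside [O] cover its complement; as [O] is cell-open, their traces
     on [O] decrease to the empty set. *)
  pose W (k : nat) := [set x : V | ~ cell k%:Z (cell_index k%:Z x) `<=` O].
  have oW k : cell_open (W k).
    move=> x Wx; exists k => y yx; rewrite /W /=.
    by rewrite (yx : cell_index _ _ = _).
  have dW : nonincreasing_seq (fun k => O `&` W k).
    move=> k l kl; apply/subsetPset => x [Ox Wx]; split=> // kO; apply: Wx.
    move=> y yx; apply: kO; apply: (@cell_index_coarse _ _ _ (l - k)).
    by rewrite -PoszD subnKC.
  have mW k : measurable (O `&` W k) by apply: measurable_cell_open; exact: cell_openI.
  have [|k kW] := small (fun k => O `&` W k) e mW dW.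
  - rewrite (_ : \bigcap_n _ = set0) ?measure0 ?lte_fin//.
    apply/seteqP; split=> // x Hx; have [Ox _] := Hx 0%N I.
    by have [k kO] := oO x Ox; have [_] := Hx k I; apply.
  - exists O, (W k); split=> // x nOx kO; apply: nOx; exact: kO.
split.
- move=> e e0; exists set0, setT; split=> //.
  + by move=> x _; exists 0%N.
  + by rewrite set0I measure0 lee_fin ltW.
- move=> B rB e /rB[U [W [oU oW AU AW UW]]]; exists W, U.
  by rewrite setTD setCK setIC.
move=> B rB e e0.
have /choice[G GP] : forall i, exists UW : set V * set V,
    [/\ cell_open UW.1, cell_open UW.2, B i `<=` UW.1, ~` B i `<=` UW.2 &
     (m (UW.1 `&` UW.2) <= (e / 2 / (2 ^ i.+1)%:R)%:E)%E].
  move=> i; have [|U [W UW]] := rB i (e / 2 / (2 ^ i.+1)%:R).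
    by rewrite !divr_gt0// ltr0n expn_gt0.
  by exists (U, W).
pose U := \bigcup_i (G i).1.
(* A countable intersection need not be cell-open, so the complement of the union is enclosed in
   finite intersections. The overlaps sum to at most [e / 2], which leaves room for stopping at a
   finite [n]. *)
pose W (n : nat) := \bigcap_(i < n) (G i).2.
have oU : cell_open U by apply: cell_open_bigcup => i; case: (GP i).
have oW (n : nat) : cell_open (W n).
  elim: n => [|n IH].
    by rewrite /W bigcap_mkord big_ord0 => x _; exists 0%N.
  have -> : W n.+1 = W n `&` (G n).2 by rewrite /W !bigcap_mkord big_ord_recr.
  apply: cell_openI => //.
  by case: (GP n).
have mG i : measurable ((G i).1 `&` (G i).2).
  by have [? ? _ _ _] := GP i; apply: measurable_cell_open; exact: cell_openI.
have mUW (n : nat) : measurable (U `&` W n) by apply: measurable_cell_open; exact: cell_openI.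
have dW : nonincreasing_seq (fun n : nat => U `&` W n).
  move=> k l kl; apply/subsetPset => x [Ux Wx]; split=> // i /= ik; apply: Wx => /=.
  exact: leq_trans ik kl.
have [|n nW] := small (fun n : nat => U `&` W n) e mUW dW.
- apply: (@le_lt_trans _ _ (m (\bigcup_i ((G i).1 `&` (G i).2)))).
    apply: le_measure; rewrite ?inE.
    + exact: bigcapT_measurable.
    + exact: bigcupT_measurable.
    + move=> x Hx; have [[i _ Ux] _] := Hx 0%N I; exists i => //; split=> //.
      by have [_ /(_ i)] := Hx i.+1 I; apply => /=.
  apply: (@le_lt_trans _ _ (\sum_(i <oo) m ((G i).1 `&` (G i).2))%E).
    by apply: measure_sigma_subadditive => //; exact: bigcupT_measurable.
  apply: (@le_lt_trans _ _ (\sum_(i <oo) (e / 2 / (2 ^ i.+1)%:R)%:E)%E).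
    by apply: lee_nneseries => // i _; case: (GP i).
  apply: le_lt_trans (epsilon_trick0 xpredT _) _; first by rewrite divr_ge0// ltW.
  by rewrite lte_fin; lra.
- exists U, (W n); split=> //.
  + by move=> x [i _ Ax]; exists i => //; case: (GP i) => _ _ + _ _; apply.
  + move=> x nAx i _; case: (GP i) => _ _ _ + _; apply => Ax; apply: nAx.
    by exists i.
Qed.

(* Regularity: [A] is approximated from outside, for [m2], by a union of cells,
   on which [le_measure_cells] compares the measures. *)
Lemma le_measure_of_cells_fin (m1 m2 : {measure set V -> \bar R}) :
  (m2 setT < +oo)%E ->
  (forall (k : nat) z, (m1 (cell k%:Z z) <= m2 (cell k%:Z z))%E) ->
  forall A, measurable A -> (m1 A <= m2 A)%E.
Proof.
move=> m2oo m12 A mA; apply/lee_addgt0Pr => e e0.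
have [U [W [oU oW AU AW UWe]]] := measurable_cell_regular m2oo mA e0.
have mU := measurable_cell_open oU; have mW := measurable_cell_open oW.
apply: (@le_trans _ _ (m1 U)); first by apply: le_measure; rewrite ?inE.
apply: (@le_trans _ _ (m2 U)).
  have [] := @le_measure_cells 0 (fun k z => cell (0 + k%:Z) z `<=` U) m1 m2.
    by move=> k z _; rewrite add0r.
  by rewrite -cell_openE.
apply: (@le_trans _ _ (m2 (A `|` (U `&` W)))).
  apply: le_measure; rewrite ?inE//.
    by apply: measurableU => //; exact: measurableI.
  move=> x Ux; have [Ax|/AW Wx] := pselect (A x); by [left|right].
have mUW : measurable (U `&` W) by exact: measurableI.
apply: le_trans (measureU2 _ _ _) _ => //.
by apply: leeD.
Qed.

(** Restricting both measures to one cell of level [0] reduces to the finite case; the pieces are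
    then glued by [le_measure_cells] for the measures restricted to [A], with the cells of level [0]
    as the family. *)
Lemma le_measure_of_cells (m1 m2 : {measure set V -> \bar R}) :
  (forall z, (m2 (cell 0 z) < +oo)%E) ->
  (forall (k : nat) z, (m1 (cell k%:Z z) <= m2 (cell k%:Z z))%E) ->
  forall A, measurable A -> (m1 A <= m2 A)%E.
Proof.
move=> m2oo m12 A mA.
have H z : (m1 (A `&` cell 0%:Z z) <= m2 (A `&` cell 0%:Z z))%E.
  have mC : measurable (cell 0%:Z z : set V) by [].
  apply: (@le_measure_of_cells_fin (mrestr m1 mC) (mrestr m2 mC)) => //.
    by have := m2oo z; rewrite -[X in m2 X]setTI; exact.
  move=> k w; change (m1 (cell k%:Z w `&` cell 0%:Z z) <= m2 (cell k%:Z w `&` cell 0%:Z z))%E.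
  have [->|] := eqVneq (cell k%:Z w `&` cell 0%:Z z) (set0 : set V); first by rewrite !measure0.
  move=> /set0P[x [xw xz]].
  have -> : cell k%:Z w `&` cell 0%:Z z = cell k%:Z w :> set V; last exact: m12.
  apply: setIidl => y yw; rewrite /cell /= -(xz : cell_index _ _ = _).
  apply: (@cell_index_coarse _ _ _ k).
  by rewrite add0r (yw : cell_index _ _ = _) (xw : cell_index _ _ = _).
have [k z ->|_] := @le_measure_cells 0 (fun k z => k = 0%N) (mrestr m1 mA) (mrestr m2 mA).
  rewrite addr0; change (m1 (cell 0 z `&` A) <= m2 (cell 0 z `&` A))%E.
  by rewrite setIC.
rewrite (_ : [set x | _] = setT); last by apply/seteqP; split=> // x _; exists 0%N.
change (m1 (setT `&` A) <= m2 (setT `&` A) -> m1 A <= m2 A)%E.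
by rewrite setTI.
Qed.

End cell_measures.

(** * Density points *)

Section lebesgue_density.
Context {R : realType} {d : nat}.
Hypothesis hd : (0 < d)%N.
Local Notation V := 'rV[R]_d.
Local Notation mu := (@lebesgue_rV R d).
Local Notation index := {ffun 'I_d -> int}.
Implicit Types (n : int) (z : index) (x y : V).

(** Let [Z] be the set of points of [E] without such a cell. A cell meeting [Z] is filled by [E] to
    less than [3/4], so on every cell the restriction of [mu] to [Z] is at most [3/4] of [mu]. The
    comparison extends to measurable sets; applied to [Z] inside a unit cell it gives a finite
    number at most [3/4] of itself, hence zero. *)
Lemma ae_dense_cell (E : set V) : measurable E ->
  {ae mu, forall x, E x -> exists k : nat,
    ((3 / 4 * vol k%:Z)%:E <= mu (E `&` cell k%:Z (cell_index k%:Z x)))%E}.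
Proof.
move=> mE.
pose good k z := ((3 / 4 * vol k%:Z)%:E <= mu (E `&` cell (0 + k%:Z) z))%E.
pose U := [set x : V | exists k, good k (cell_index (0 + k%:Z) x)].
have [mU _] : measurable U /\ (mu U <= mu U)%E by exact: (@le_measure_cells _ _ 0 good).
have mZ : measurable (E `\` U) by exact: measurableD.
exists (E `\` U); split=> //; last first.
  move=> x /= /not_implyP[Ex nk]; split; first exact: Ex.
  move=> -[k]; rewrite /good add0r => gk.
  by apply: nk; exists k.
have p34 : (0 : R) <= 3 / 4 by lra.
have E0 z : mu ((E `\` U) `&` cell 0%:Z z) = 0%E.
  have := @le_measure_of_cells R d (mrestr mu mZ) (mscale (NngNum p34) mu) _ _ ((E `\` U) `&` cell 0%:Z z) _.
  rewrite /= => H.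
  have {H} : (mu ((E `\` U) `&` cell 0%:Z z `&` (E `\` U)) <= (3 / 4)%:E * mu ((E `\` U) `&` cell 0%:Z z))%E.
    apply: H.
    - by move=> w; rewrite /mscale /= (cell_volume hd) -EFinM ltry.
    - move=> k w; change (mu (cell k%:Z w `&` (E `\` U)) <= (3 / 4)%:E * mu (cell k%:Z w))%E.
      have [->|/set0P[x [xw [Ex nUx]]]] := eqVneq (cell k%:Z w `&` (E `\` U)) set0.
        by rewrite measure0 mule_ge0// lee_fin.
      rewrite (cell_volume hd) -EFinM ltW//.
      apply: le_lt_trans (_ : (mu (E `&` cell k%:Z w) < _)%E).
        apply: le_measure; rewrite ?inE.
        + by apply: measurableI => //; exact: measurable_cell.
        + by apply: measurableI => //; exact: measurable_cell.
        + by move=> y [yw [Ey _]].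
      rewrite ltNge; apply/negP => h; apply: nUx; exists k; rewrite /good add0r.
      by rewrite (xw : cell_index _ _ = _).
    - exact: measurableI.
  rewrite setIAC setIid.
  have : (mu ((E `\` U) `&` cell 0%:Z z) < +oo)%E.
    apply: le_lt_trans (_ : (mu (cell 0%:Z z) < _)%E).
      by apply: le_measure; rewrite ?inE//; exact: measurableI.
    by rewrite (cell_volume hd) ltry.
  have : (0 <= mu ((E `\` U) `&` cell 0%:Z z))%E by exact: measure_ge0.
  case: (mu _) => [r| |] //.
  rewrite -EFinM !lee_fin => r0 _ h; congr EFin; lra.
have [k z ->|_] := @le_measure_cells R d 0 (fun k z => k = 0%N) (mrestr mu mZ) mzero.
  rewrite addr0; change (mu (cell 0 z `&` (E `\` U)) <= 0)%E.
  by rewrite setIC E0.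
rewrite (_ : [set x | _] = setT); last by apply/seteqP; split=> // x _; exists 0%N.
change (mu (setT `&` (E `\` U)) <= 0 -> mu (E `\` U) = 0)%E.
by rewrite setTI measure_le0 => /eqP.
Qed.

Lemma measurable_rV_set1 x : measurable [set x].
Proof.
rewrite (_ : [set x] = \bigcap_(i in [set: 'I_d]) (rV_coord i @^-1` [set x ord0 i])).
  apply: fin_bigcap_measurable => // i _.
  rewrite -[X in measurable X]setTI.
  by apply: measurable_rV_coord => //; exact: measurable_set1.
apply/seteqP; split => [_ -> i _ //|y yx]; apply/rowP => i.
exact: (yx i I).
Qed.

Lemma lebesgue_rV_set1 x : mu [set x] = 0%E.
Proof.
rewrite (_ : [set x] = [set y | forall i, [set x ord0 i] (y ord0 i)]).
  rewrite (@lebesgue_rV_box R d (fun i => [set x ord0 i])) ; last by move=> i; exact: measurable_set1.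
  by rewrite (bigD1 (Ordinal hd)) //= lebesgue_measure_set1 mul0e.
by apply/seteqP; split => [_ -> //|y yx]; apply/rowP => i; exact: yx.
Qed.

End lebesgue_density.

(** * Translation invariance *)

Section translation.
Context {R : realType} {d : nat}.
Local Notation V := 'rV[R]_d.
Local Notation mu := (@lebesgue_rV R d).
Implicit Types (v x y : V).

Lemma measurable_fun_addr v : measurable_fun setT (fun x : V => x + v).
Proof.
apply: measurable_fun_rVP => i.
rewrite (_ : _ \o _ = (fun x => rV_coord i x + v ord0 i)); last first.
  by apply/funext => x; rewrite /rV_coord /= mxE.
by apply: measurable_funD => //; exact: measurable_rV_coord.
Qed.

(** A translated cell is a box with the same sides, so the translated measure agrees with [mu] on
    cells, and comparison in both directions gives equality. In dimension [0] a translation is the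
    identity. *)
Lemma lebesgue_rV_translation v A : measurable A ->
  mu ((fun x => x + v) @^-1` A) = mu A.
Proof.
move=> mA; have [d0|hd] := leqP d 0.
  by rewrite (_ : _ @^-1` A = A)//; apply/seteqP; split => x /=;
    (rewrite (_ : x + v = x)//; apply/rowP => i; have := ltn_ord i; rewrite ltnNge (leq_trans d0)).
pose m0 := [the {measure set V -> \bar R} of pushforward mu (fun x => x + v)].
pose m := m0 (measurable_fun_addr v).
have mcell n z : m (cell n z) = mu (cell n z).
  rewrite (cell_volume hd) /m /m0 /= /pushforward.
  pose I i := `[(z i)%:~R * 2 ^ (- dexp n i) - v ord0 i, (z i + 1)%:~R * 2 ^ (- dexp n i) - v ord0 i[%classic : set R.
  have -> : (fun x => x + v) @^-1` cell n z = [set x | forall i, I i (x ord0 i)].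
    apply/seteqP; split => [x /= /cellP H i|x /= H].
      by have := H i; rewrite /I /= in_itv /= mxE lerBlDr ltrBrDr.
    by apply/cellP => i; have := H i; rewrite /I /= in_itv /= mxE lerBlDr ltrBrDr.
  rewrite (@lebesgue_rV_box R d I); last by move=> i; exact: measurable_itv.
  transitivity (\prod_(i < d) ((2 : R) ^ (- dexp n i))%:E)%E.
    apply: eq_bigr => i _.
    rewrite lebesgue_measure_itv /= lte_fin ltrD2r ltr_pM2r ?exp2z_gt0// ltr_int ltrDl ltr01.
    by rewrite -EFinB; congr EFin; rewrite intrD; ring.
  rewrite prodEFin /vol; congr EFin.
  rewrite -[in RHS](dexp_sum hd n) -sumrN.
  by elim/big_rec2 : _ => [//|i a b _ ->]; rewrite -expfzDr.
apply/eqP; rewrite eq_le; apply/andP; split.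
- apply: (@le_measure_of_cells R d m mu) => // [z|k z]; last by rewrite mcell.
  by change (mu (cell 0 z) < +oo)%E; rewrite (cell_volume hd) ltry.
- apply: (@le_measure_of_cells R d mu m) => // [z|k z]; last by rewrite mcell.
  by rewrite mcell (cell_volume hd) ltry.
Qed.

Lemma ge0_integral_translation v (D : set V) (f : V -> \bar R) :
  measurable D -> measurable_fun setT f -> (forall x, (0 <= f x)%E) ->
  (\int[mu]_(x in (fun x => x + v)%R @^-1` D) f (x + v)%R = \int[mu]_(x in D) f x)%E.
Proof.
move=> mD mf f0.
have := @ge0_integral_pushforward _ _ _ _ R _ (measurable_fun_addr v) mu D f mD.
rewrite /comp => <- //; last exact: measurable_funTS.
apply: eq_measure_integral => [|mv A mA _]; first exact: measurable_fun_addr.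
exact: lebesgue_rV_translation.
Qed.

Lemma integral_translation v (f : V -> \bar R) : measurable_fun setT f ->
  (\int[mu]_x f (x + v)%R = \int[mu]_x f x)%E.
Proof.
move=> mf; rewrite [RHS]integralE [LHS]integralE.
rewrite (funepos_comp f (fun x => x + v)%R) (funeneg_comp f (fun x => x + v)%R).
congr (_ - _)%E.
- have := @ge0_integral_translation v setT (f^\+)%E measurableT (measurable_funepos mf) (funepos_ge0 _).
  by rewrite preimage_setT => <-.
- have := @ge0_integral_translation v setT (f^\-)%E measurableT (measurable_funeneg mf) (funeneg_ge0 _).
  by rewrite preimage_setT => <-.
Qed.

End translation.

(** * Means over cells *)

Section density_measure.
Context {disp} {T : measurableType disp} {R : realType} (mu : {measure set T -> \bar R}).
Variable f : T -> \bar R.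
Hypothesis mf : measurable_fun setT f.
Hypothesis f0 : forall x, (0 <= f x)%E.

(** The two proofs are arguments of the function so that the measure structure declared below, which
    depends on them, can be attached to it. *)
Definition density_measure (_ : measurable_fun setT f) (_ : forall x, (0 <= f x)%E) :
  set T -> \bar R := fun A => (\int[mu]_(x in A) f x)%E.
Local Notation m := (density_measure mf f0).

Let m0 : m set0 = 0%E.
Proof. by rewrite /density_measure integral_set0. Qed.

Let m_ge0 A : (0 <= m A)%E.
Proof. by apply: integral_ge0. Qed.

Let m_sigma_additive : semi_sigma_additive m.
Proof.
move=> F mF tF mUF; rewrite /density_measure ge0_integral_bigcup//; last exact: measurable_funTS.
by apply: is_cvg_ereal_nneg_natsum => n _; exact: integral_ge0.
Qed.

HB.instance Definition _ := isMeasure.Build _ _ _ m m0 m_ge0 m_sigma_additive.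

End density_measure.

Section cell_mean.
Context {R : realType} {d : nat}.
Hypothesis hd : (0 < d)%N.
Local Notation V := 'rV[R]_d.
Local Notation mu := (@lebesgue_rV R d).
Local Notation index := {ffun 'I_d -> int}.
Implicit Types (n : int) (z : index) (x y : V) (h : V -> R).

(** It is applied to functions with values in [[0, t]], whose integral over a cell is finite, so
    that [fine] loses nothing. *)
Definition mean h n z : R := fine (\int[mu]_(x in cell n z) (h x)%:E)%E / vol n.

Section bounded.
Variables (t : R) (h : V -> R).
Hypotheses (mh : measurable_fun setT h) (h0 : forall x, 0 <= h x) (ht : forall x, h x <= t).

Lemma int_cell_le n z : (\int[mu]_(x in cell n z) (h x)%:E <= (t * vol n)%:E)%E.
Proof.
apply: (@le_trans _ _ (\int[mu]_(x in cell n z) (cst t%:E) x)%E).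
  apply: ge0_le_integral => //.
  - by move=> x _; rewrite lee_fin.
  - by apply/measurable_EFinP; exact: measurable_funTS.
  - by move=> x _; rewrite lee_fin.
by rewrite integral_cst// EFinM -(cell_volume hd n z).
Qed.

Lemma int_cell_ge0 n z : (0 <= \int[mu]_(x in cell n z) (h x)%:E)%E.
Proof. by apply: integral_ge0 => x _; rewrite lee_fin. Qed.

Lemma int_cell_fin n z : (\int[mu]_(x in cell n z) (h x)%:E)%E \is a fin_num.
Proof.
by rewrite ge0_fin_numE ?int_cell_ge0//; exact: le_lt_trans (int_cell_le n z) (ltry _).
Qed.

Lemma meanK n z : (mean h n z * vol n)%:E = (\int[mu]_(x in cell n z) (h x)%:E)%E.
Proof. by rewrite /mean divfK ?gt_eqF ?vol_gt0// fineK// int_cell_fin. Qed.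

Lemma mean_children n z :
  mean h n z = (mean h (n + 1) (child n z false) + mean h (n + 1) (child n z true)) / 2.
Proof.
have v0 := vol_gt0 (R := R) (n + 1).
suff : mean h n z * vol n = mean h (n + 1) (child n z false) * vol (n + 1) +
       mean h (n + 1) (child n z true) * vol (n + 1).
  rewrite (volS n) -mulrDl => /(congr1 (fun a => a / (2 * vol (n + 1)))).
  rewrite mulfK ?mulf_neq0 ?gt_eqF// => ->.
  by field; rewrite gt_eqF.
apply: EFin_inj; rewrite EFinD !meanK (cell_child hd) ge0_integral_setU//.
- by apply/measurable_EFinP; exact: measurable_funTS.
- by move=> x _; rewrite lee_fin.
- by apply/disj_setPS; rewrite child_disjoint.
Qed.

Lemma mean_ge (E : set V) (c : R) n z : measurable E ->
  (forall x, E x -> t <= h x) -> 0 <= t ->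
  ((c * vol n)%:E <= mu (E `&` cell n z))%E -> c * t <= mean h n z.
Proof.
move=> mE Eh t0 H; have v0 := vol_gt0 (R := R) n.
rewrite -(ler_pM2r v0) -lee_fin meanK.
apply: (@le_trans _ _ (\int[mu]_(x in E `&` cell n z) (cst t%:E) x)%E).
  rewrite integral_cst//; last exact: measurableI.
  by rewrite (mulrC c) -mulrA EFinM; apply: lee_wpmul2l; rewrite ?lee_fin.
apply: (@le_trans _ _ (\int[mu]_(x in E `&` cell n z) (h x)%:E)%E).
  apply: ge0_le_integral => //.
  - exact: measurableI.
  - by apply/measurable_EFinP; exact: measurable_funTS.
  - by move=> x [Ex _]; rewrite lee_fin Eh.
apply: ge0_subset_integral => //.
- exact: measurableI.
- by apply/measurable_EFinP; exact: measurable_funTS.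
- by move=> x _; rewrite lee_fin.
Qed.

Lemma mean_le (F : set V) (c : R) n z : measurable F ->
  (forall x, ~ F x -> h x = 0) -> 0 <= t ->
  (mu (F `&` cell n z) <= (c * vol n)%:E)%E -> mean h n z <= c * t.
Proof.
move=> mF Fh t0 H; have v0 := vol_gt0 (R := R) n.
rewrite -(ler_pM2r v0) -lee_fin meanK.
apply: (@le_trans _ _ (\int[mu]_(x in F `&` cell n z) (cst t%:E) x)%E); last first.
  rewrite integral_cst//; last exact: measurableI.
  by rewrite (mulrC c) -mulrA EFinM; apply: lee_wpmul2l; rewrite ?lee_fin.
apply: (@le_trans _ _ (\int[mu]_(x in F `&` cell n z) (h x)%:E)%E); last first.
  apply: ge0_le_integral => //.
  - exact: measurableI.
  - by move=> x _; rewrite lee_fin.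
  - by apply/measurable_EFinP; exact: measurable_funTS.
  - by move=> x [Ex _]; rewrite lee_fin.
rewrite [leLHS]integral_mkcond [leRHS]integral_mkcond.
apply: ge0_le_integral => //.
- by move=> x _; rewrite patchE; case: ifP => // _; rewrite lee_fin.
- apply/(measurable_restrictT (fun x => (h x)%:E)) => //.
  exact/measurable_funTS/measurable_EFinP.
- apply/(measurable_restrictT (fun x => (h x)%:E)); first exact: measurableI.
  exact/measurable_funTS/measurable_EFinP.
- move=> x _; rewrite !patchE in_setI.
  case: (boolP (x \in cell n z)) => _; rewrite ?andbF// andbT.
  by case: (boolP (x \in F)) => // /negP xF; rewrite Fh// => /mem_set.
Qed.

End bounded.

(* Climb from a cell where [h] is mostly [t] to the first ancestor half of
   which lies outside [F]; the means drop by [t / 4] on the way, so one step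
   beats a geometric series of ratio [lam]. *)
Lemma chain_jump (t lam : R) (h : V -> R) (E F : set V) (k0 : int) x :
  0 < t -> 0 < lam < 1 ->
  measurable_fun setT h -> (forall x, 0 <= h x) -> (forall x, h x <= t) ->
  measurable E -> measurable F -> E `<=` F -> (mu F < +oo)%E ->
  (forall x, E x -> t <= h x) -> (forall x, ~ F x -> h x = 0) ->
  ((3 / 4 * vol k0)%:E <= mu (E `&` cell k0 (cell_index k0 x)))%E ->
  exists (m : int) (j : nat), let n := m + j%:Z in
  [/\ ((1 - lam) / 4 * t * lam ^+ j <=
        mean h (n + 1) (cell_index (n + 1) x) - mean h n (cell_index n x)),
     ((4^-1 * vol n)%:E <= mu (F `&` cell n (cell_index n x)))%E &
     ((4^-1 * vol m)%:E <= mu (F `&` cell m (cell_index m x)))%E].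
Proof.
move=> t0 /andP[lam0 lam1] mh h0 ht mE mF EF Foo Eh Fh start.
have mQ n : measurable (F `&` cell n (cell_index n x)) by exact: measurableI.
(* Volumes of ancestors are unbounded and [F] has finite measure, so a sparse ancestor exists; the
   starting cell is not sparse because [E] lies in [F], so the first one is a strict ancestor. *)
pose sparse (J : nat) := (mu (F `&` cell (k0 - J%:Z) (cell_index (k0 - J%:Z) x)) <=
    (2^-1 * vol (k0 - J%:Z))%:E)%E.
have exJ : exists J, sparse J.
  have [M FM] : exists M : R, mu F = M%:E.
    by exists (fine (mu F)); rewrite fineK// ge0_fin_numE.
  have [K MK] : exists K : nat, M <= K%:R.
    exists (Num.truncn M).+1; apply: ltW; exact: truncnS_gt.
  exists (K + 1 + `|k0|)%N; apply: (@le_trans _ _ (mu F)).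
    by apply: le_measure; rewrite ?inE.
  rewrite FM lee_fin; apply: (le_trans MK).
  rewrite /vol; have -> : - (k0 - (K + 1 + `|k0|)%N%:Z) = (K%:Z + (`|k0|%N%:Z - k0)) + 1 by lia.
  rewrite expfzDr// expr1z mulrCA mulVf// mulr1 expfzDr//.
  have -> : `|k0|%N%:Z - k0 = `| `|k0|%N%:Z - k0|%N by lia.
  apply: (@le_trans _ _ (2 ^+ K * 1)).
    by rewrite mulr1 -natrX ler_nat; exact/ltnW/ltn_expl.
  by apply: ler_pM => //; rewrite ?exprn_ge0// -exprnP exprn_ege1// ler1n.
pose J := ex_minn exJ.
have [sJ minJ] : sparse J /\ forall j, (j < J)%N -> ~~ sparse j.
  rewrite /J; case: ex_minnP => j sj jmin; split=> // i ij; apply/negP => /jmin.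
  by rewrite leqNgt ij.
have J0 : (0 < J)%N.
  rewrite lt0n; apply/eqP => J0; move: sJ; rewrite J0 /sparse subr0.
  apply/negP; rewrite -ltNge; apply: lt_le_trans (_ : ((3 / 4 * vol k0)%:E <= _)%E).
    by rewrite lte_fin ltr_pM2r ?vol_gt0//; lra.
  apply: le_trans start _; apply: le_measure; rewrite ?inE//; first exact: measurableI.
  by apply: setSI.
pose m := k0 - J%:Z.
have dense j : (0 < j <= J)%N ->
    ((2^-1 * vol (m + j%:Z))%:E < mu (F `&` cell (m + j%:Z) (cell_index (m + j%:Z) x)))%E.
  move=> /andP[j0 jJ]; have := minJ (J - j)%N _; rewrite /sparse -ltNge.
  have -> : k0 - (J - j)%N%:Z = m + j%:Z by rewrite /m; lia.
  by apply; lia.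
(* A cell with a child more than half filled is itself more than a quarter filled. This covers
   [j = 0], the sparse ancestor, from which the Coulomb potential will be estimated. *)
have dense4 j : (j < J)%N ->
    ((4^-1 * vol (m + j%:Z))%:E <= mu (F `&` cell (m + j%:Z) (cell_index (m + j%:Z) x)))%E.
  move=> jJ; apply: ltW; apply: (@lt_le_trans _ _ (mu (F `&` cell (m + j.+1%:Z) (cell_index (m + j.+1%:Z) x)))).
    apply: le_lt_trans (dense j.+1 _) => //.
    have -> : m + j.+1%:Z = m + j%:Z + 1 by lia.
    by rewrite lee_fin (volS (m + j%:Z)) le_eqVlt; apply/orP; left; apply/eqP; field.
  apply: le_measure; rewrite ?inE// => y [Fy yc]; split=> //.
  apply: (@cell_index_coarse _ _ _ 1).
  by have -> : m + j%:Z + 1 = m + j.+1%:Z by lia.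
pose a (j : nat) := mean h (m + j%:Z) (cell_index (m + j%:Z) x).
(* Here [j] counts levels downwards from the sparse ancestor. If all steps stayed below the series,
   the total rise would be at most [t / 4 * (1 - lam ^+ J)], less than [t / 4], while the mean goes
   from at most [t / 2] to at least [3 / 4 * t]. *)
have [j [jJ aj]] : exists j, (j < J)%N /\ (1 - lam) / 4 * t * lam ^+ j <= a j.+1 - a j.
  apply: contrapT => /forallNP H.
  have H' j : (j < J)%N -> a j.+1 - a j <= (1 - lam) / 4 * t * lam ^+ j.
    by move=> jJ; have /not_andP[//|/negP] := H j; rewrite -ltNge => /ltW.
  have sumj i : (i <= J)%N -> a i - a 0%N <= t / 4 * (1 - lam ^+ i).
    elim: i => [|i IH] iJ; first by rewrite expr0 !subrr mulr0.
    have := lerD (IH (ltnW iJ)) (H' i iJ); rewrite exprS.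
    by congr (_ <= _); field.
  have aJ : 3 / 4 * t <= a J.
    rewrite /a (_ : m + J%:Z = k0) ?subrK//.
    exact: (mean_ge mh h0 ht mE Eh (ltW t0)).
  have a0 : a 0%N <= 2^-1 * t.
    by rewrite /a addr0; apply: (mean_le mh h0 ht mF Fh (ltW t0)).
  have := sumj J (leqnn _); have : 0 < t * lam ^+ J by rewrite mulr_gt0// exprn_gt0.
  by move: aJ a0; move: (lam ^+ J) (a J) (a 0%N) => l u v; nra.
exists m, j; split.
- by apply: le_trans aj _; rewrite /a (_ : m + j.+1%:Z = m + j%:Z + 1)//; lia.
- exact: dense4.
- by have := dense4 0%N J0; rewrite addr0.
Qed.

End cell_mean.

(** * Good cells *)

Section kernel.
Context {R : realType} {d : nat}.
Local Notation V := 'rV[R]_d.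
Local Notation mu := (@lebesgue_rV R d).
Implicit Types (x y : V) (f w : V -> R).

Lemma enorm_ge0 x : 0 <= enorm x.
Proof. exact: sqrtr_ge0. Qed.

Lemma enorm_le (M : R) x : 0 <= M -> (forall i, `|x ord0 i| <= M) -> enorm x <= d%:R * M.
Proof.
move=> M0 xM; have dM : 0 <= d%:R * M by rewrite mulr_ge0.
rewrite /enorm -(ger0_norm dM) -sqrtr_sqr ler_wsqrtr//.
apply: (@le_trans _ _ (\sum_(i < d) M ^+ 2)).
  by apply: ler_sum => i _; rewrite -real_normK ?num_real// lerXn2r ?nnegrE.
rewrite sumr_const card_ord -[leLHS]mulr_natl exprMn ler_wpM2r ?sqr_ge0//.
by rewrite -natrX ler_nat; case: d => // k; rewrite expnS expn1 leq_pmulr.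
Qed.

Lemma measurable_enorm : measurable_fun setT (@enorm R d).
Proof.
rewrite (_ : @enorm R d = (fun x => (\sum_i rV_coord i x ^+ 2) `^ (2^-1))); last first.
  by apply/funext => x; rewrite powR12_sqrt// sumr_ge0// => i _; rewrite sqr_ge0.
apply: (measurableT_comp (measurable_powR _)).
under eq_fun do rewrite -big_enum /=.
apply: measurable_sum => i.
apply: measurable_funX.
exact: measurable_rV_coord.
Qed.

Lemma measurable_enormB : measurable_fun setT (fun xy : V * V => enorm (xy.1 - xy.2)).
Proof.
apply: (measurableT_comp measurable_enorm).
apply: measurable_fun_rVP => i.
rewrite (_ : _ \o _ = (fun xy : V * V => rV_coord i xy.1 - rV_coord i xy.2)); last first.
  by apply/funext => x; rewrite /rV_coord /= !mxE.
by apply: measurable_funB; apply: measurableT_comp => //; exact: measurable_rV_coord.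
Qed.

Lemma measurable_kernel_ratio (a : R) (N : V * V -> R) : measurable_fun setT N ->
  measurable_fun setT (fun xy : V * V => (N xy / enorm (xy.1 - xy.2) `^ a)%:E).
Proof.
move=> mN; apply/measurable_EFinP; under eq_fun do rewrite -powRN.
apply: measurable_funM => //.
exact: (measurableT_comp (measurable_powR _) measurable_enormB).
Qed.

Definition riesz_energy_density (a : R) w y : \bar R :=
  (\int[mu]_x (w x * w y / enorm (x - y) `^ a)%:E)%E.

Lemma measurable_inner_integral (a : R) (N : V * V -> R) : measurable_fun setT N ->
  (forall xy, 0 <= N xy) ->
  measurable_fun setT (fun y => (\int[mu]_x (N (x, y) / enorm (x - y) `^ a)%:E)%E).
Proof.
move=> mN N0.
have := @measurable_fun_fubini_tonelli_G _ _ _ _ _ mu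
  (fun xy : V * V => (N xy / enorm (xy.1 - xy.2) `^ a)%:E) (measurable_kernel_ratio a mN).
by apply => xy; rewrite lee_fin divr_ge0 ?powR_ge0.
Qed.

End kernel.

Section cell_radius.
Context {R : realType} {d : nat}.
Hypothesis hd : (0 < d)%N.
Local Notation V := 'rV[R]_d.
Implicit Types (n : int) (x y : V).

(** The real [d]-th root of [vol n]. The actual sides depend on the residue of [n] modulo [d]; this
    substitute scales exactly, as the exponent identities require, and bounds the diameter up to a
    constant. *)
Definition rad n : R := 2 `^ (- (n%:~R / d%:R)).

Let d0 : (d%:R : R) != 0.
Proof. by rewrite pnatr_eq0 -lt0n. Qed.

Lemma rad_gt0 n : 0 < rad n. Proof. by rewrite powR_gt0. Qed.

Lemma ln_rad n : ln (rad n) = - (n%:~R / d%:R) * ln 2.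
Proof. exact: ln_powR. Qed.

Lemma ln_vol n : ln (vol n) = - n%:~R * ln 2 :> R.
Proof. by rewrite /vol -powR_intmul// ln_powR intrN. Qed.

Lemma cell_side n z x y i : cell n z x -> cell n z y -> `|(x - y) ord0 i| <= 2 * rad n.
Proof.
move=> /cellP/(_ i) hx /cellP/(_ i) hy.
have : (2 : R) ^ (- dexp n i) <= 2 * rad n.
  rewrite -powR_intmul// -[X in _ <= X * _]powRr1// -powRD; last by rewrite pnatr_eq0 implybT.
  rewrite ler_powR ?ler1n// intrN.
  have := le_dexp n i; rewrite -(ler_int R) => h.
  have dp : (0 : R) < d%:R by rewrite ltr0n.
  rewrite -(ler_pM2l dp) mulrDr mulr1 mulrN mulrN mulrCA divff// mulr1.
  move: h; rewrite !(intrD, intrM, intrN).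
  by rewrite -!pmulrn; lra.
move: hx hy; rewrite !mxE intrD !mulrDl mul1r.
move: (2 ^ _) => r; move: ((z i)%:~R * r) => u /andP[a1 a2] /andP[a3 a4] b.
by rewrite ler_norml; apply/andP; split; lra.
Qed.

Lemma cell_diam n z x y : cell n z x -> cell n z y ->
  enorm (x - y) <= 2 * d%:R * rad n.
Proof.
move=> xz yz; rewrite mulrAC mulrC; apply: enorm_le.
  by rewrite mulr_ge0// ltW// rad_gt0.
by move=> i; exact: cell_side xz yz.
Qed.

End cell_radius.
Arguments rad {R} d n.

Section good_cells.
Context {R : realType} {d : nat}.
Hypothesis hd : (0 < d)%N.
Local Notation V := 'rV[R]_d.
Local Notation mu := (@lebesgue_rV R d).
Local Notation index := {ffun 'I_d -> int}.
Implicit Types (n m : int) (z : index) (x y : V).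

(** Inside the cell the distance to [y] is at most the diameter and both weights are at least [c].
    The point [y] itself, where the kernel has a conventional value, is removed first; it is a null
    set. *)
Lemma riesz_density_ge (b c : R) (w : V -> R) (F : set V) m x y :
  0 <= b -> 0 <= c -> measurable_fun setT w -> (forall x, 0 <= w x) -> measurable F ->
  (forall x, F x -> c <= w x) -> F y -> cell m (cell_index m x) y ->
  ((4^-1 * vol m)%:E <= mu (F `&` cell m (cell_index m x)))%E ->
  ((c * c / (2 * d%:R * rad d m) `^ b * (4^-1 * vol m))%:E <= riesz_energy_density b w y)%E.
Proof.
move=> b0 c0 mw w0 mF Fc Fy yx FP.
pose P : set V := F `&` cell m (cell_index m x).
have mP : measurable P by exact: measurableI.
have mPy : measurable (P `\` [set y]) by apply: measurableD => //; exact: measurable_rV_set1.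
have k0 : 0 <= c * c / (2 * d%:R * rad d m) `^ b by rewrite divr_ge0 ?mulr_ge0 ?powR_ge0.
apply: (@le_trans _ _ (\int[mu]_(x in P `\` [set y]) cst (c * c / (2 * d%:R * rad d m) `^ b)%:E x)%E).
  rewrite integral_cst// EFinM; apply: lee_wpmul2l; rewrite ?lee_fin//.
  apply: (le_trans FP); rewrite -/P.
  apply: (@le_trans _ _ (mu ((P `\` [set y]) `|` [set y]))).
    apply: le_measure; rewrite ?inE//.
      by apply: measurableU => //; exact: measurable_rV_set1.
    by move=> u Pu; have [->|uy] := pselect (u = y); [right|left].
  have := measureU2 mu mPy (measurable_rV_set1 y).
  move=> /le_trans; apply.
  by rewrite -[leRHS]adde0; apply: leeD => //; change (mu [set y] <= 0)%E; rewrite (lebesgue_rV_set1 hd).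
have mK : measurable_fun setT (fun x => (w x * w y / enorm (x - y) `^ b)%:E).
  have mN : measurable_fun setT (fun xy : V * V => w xy.1 * w xy.2).
    by apply: measurable_funM; apply: measurableT_comp.
  exact: (measurable_fun_pair1 y (measurable_kernel_ratio b mN)).
apply: (@le_trans _ _ (\int[mu]_(x in P `\` [set y]) (w x * w y / enorm (x - y) `^ b)%:E)%E).
  apply: ge0_le_integral => //.
  - exact: measurable_funTS.
  - move=> u [[Fu um] uy]; rewrite lee_fin.
    have e0 : 0 < enorm (u - y).
      rewrite lt_neqAle enorm_ge0 andbT eq_sym; apply/eqP => e0; apply: uy.
      apply/rowP => i; apply/eqP; rewrite -subr_eq0.
      have : \sum_i (u - y) ord0 i ^+ 2 <= 0 by rewrite -sqrtr_eq0; apply/eqP.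
      move=> le0; have s0 : \sum_i (u - y) ord0 i ^+ 2 == 0.
        by rewrite eq_le le0 sumr_ge0// => j _; rewrite sqr_ge0.
      move: s0; rewrite psumr_eq0; last by move=> j _; rewrite sqr_ge0.
      by move=> /allP/(_ i (mem_index_enum _)); rewrite /= sqrf_eq0 !mxE.
    apply: ler_pM; rewrite ?mulr_ge0 ?invr_ge0 ?powR_ge0//.
      by apply: ler_pM => //; exact: Fc.
    rewrite lef_pV2 ?posrE ?powR_gt0//; last first.
      by rewrite !mulr_gt0 ?rad_gt0// ltr0n.
    rewrite ge0_ler_powR ?nnegrE ?enorm_ge0//; last exact: cell_diam um yx.
    by rewrite mulr_ge0// ltW// rad_gt0.
apply: ge0_subset_integral => //.
by move=> u _; rewrite lee_fin !mulr_ge0 ?invr_ge0 ?powR_ge0.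
Qed.

Variables (s p q alpha A B : R).
Hypotheses (p0 : 0 < p) (alpha_d : 0 < alpha < d%:R) (A0 : 0 < A) (B0 : 0 < B).
Hypothesis scaling : (d%:R - s * p) * A + (d%:R + alpha) * B = d%:R.

(** With [n = m + j], the jump contributes [lam ^+ j] to the power [p * A] and the Coulomb term
    [2^(alpha j/d)] to the power [B]; [lam] is chosen so that they cancel. The remaining powers of
    [2^n] match by [scaling], hence an equality with a constant free of [t], [m] and [j]. *)
Lemma good_cell_algebra (K : R) : 0 < K ->
  exists lam C, [/\ 0 < lam < 1, 0 < C & forall (t : R) m (j : nat), 0 < t ->
    let n := m + j%:Z in
    t `^ (p * A + 2 * q * B) * vol n = C *
     ((((1 - lam) / 4 * t * lam ^+ j) `^ p * vol n / (K * rad d n `^ (s * p))) `^ A *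
      (t `^ q * t `^ q / (2 * d%:R * rad d m) `^ (d%:R - alpha) * (4^-1 * vol m) *
         (4^-1 * vol n)) `^ B)].
Proof.
move=> K0; have /andP[a0 ad] := alpha_d.
have dp : (0 : R) < d%:R by rewrite ltr0n.
have l2 : 0 < ln (2 : R) by rewrite ln_gt0// ltr1n.
pose ell := alpha * B / (d%:R * p * A) * ln 2.
have ell0 : 0 < ell by rewrite !(mulr_gt0, invr_gt0).
pose lam := expR (- ell).
have lam0 : 0 < lam by exact: expR_gt0.
have lam1 : lam < 1 by rewrite -expR0 ltr_expR oppr_lt0.
have c0 : 0 < (1 - lam) / 4 by rewrite divr_gt0// subr_gt0.
pose lc := ln ((1 - lam) / 4); pose l4 := ln (4 : R); pose lD := ln (2 * d%:R : R).
have D0 : 0 < 2 * d%:R :> R by rewrite mulr_gt0.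
exists lam, (expR (- (A * (p * lc - ln K) + B * (- (d%:R - alpha) * lD - l4 - l4)))).
split; [by rewrite lam0|exact: expR_gt0|].
move=> t m j t0 n.
(* Every factor is written as an exponential, so that the claim becomes a linear identity between
   logarithms. *)
have pE (x e : R) : 0 < x -> x `^ e = expR (e * ln x) by move=> x0; rewrite /powR gt_eqF.
have E (x : R) : 0 < x -> x = expR (ln x) by move=> x0; rewrite lnK.
have rn := rad_gt0 (R := R) (d := d) n; have rm := rad_gt0 (R := R) (d := d) m.
have vn := vol_gt0 (R := R) n; have vm := vol_gt0 (R := R) m.
have -> : ((1 - lam) / 4 * t * lam ^+ j) `^ p * vol n / (K * rad d n `^ (s * p)) =
   expR (p * (lc + ln t - j%:R * ell) - n%:~R * ln 2 - (ln K + (s * p) * (- (n%:~R / d%:R) * ln 2))).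
  rewrite pE; last exact: mulr_gt0 (mulr_gt0 c0 t0) (exprn_gt0 _ lam0).
  have -> : ln ((1 - lam) / 4 * t * lam ^+ j) = lc + ln t - j%:R * ell.
    rewrite lnM ?posrE ?exprn_gt0//; last exact: mulr_gt0.
    by rewrite lnM ?posrE// lnXn// /lam expRK mulNrn -(mulr_natl ell).
  rewrite (pE (rad d n))// ln_rad [vol n]E// ln_vol mulNr -expRD.
  by rewrite [RHS]expRB (expRD (ln K)) (lnK (x := K)) ?posrE ?mulNr.
have -> : t `^ q * t `^ q / (2 * d%:R * rad d m) `^ (d%:R - alpha) * (4^-1 * vol m) * (4^-1 * vol n) =
  expR (q * ln t + q * ln t - (d%:R - alpha) * (lD - (m%:~R / d%:R) * ln 2) - l4 - m%:~R * ln 2 - l4 - n%:~R * ln 2).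
  rewrite !expRD !expRN !pE//; last by rewrite mulr_gt0.
  rewrite lnM ?posrE// ln_rad -/lD mulNr.
  rewrite (E (vol n))// (E (vol m))// !ln_vol !mulNr !expRN /l4 lnK ?posrE//.
  by rewrite !mulrA.
rewrite !(pE _ _ (expR_gt0 _)) !expRK pE// [vol n]E// ln_vol -!expRD; congr expR.
rewrite -/n in rn vn *.
have nE : n%:~R = m%:~R + j%:R :> R by rewrite /n intrD.
have -> : - n%:~R * ln 2 = - (n%:~R / d%:R) * ((d%:R - s * p) * A + (d%:R + alpha) * B) * ln 2 :> R.
  by rewrite scaling; field; rewrite gt_eqF.
rewrite nE /ell; field.
by rewrite !gt_eqF.
Qed.

End good_cells.

(** * The estimate at one level *)

Section level_estimate.
Context {R : realType} {d : nat}.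
Hypothesis hd : (0 < d)%N.
Local Notation V := 'rV[R]_d.
Local Notation mu := (@lebesgue_rV R d).
Local Notation index := {ffun 'I_d -> int}.
Implicit Types (n m : int) (z : index) (x y : V).

Lemma level_ge_of_vol_le n (M : nat) : vol n <= M%:R :> R -> - M%:Z <= n.
Proof.
move=> vM; rewrite leNgt; apply/negP => nM.
have [k nk] : exists k : nat, - n = k%:Z by exists `|- n|%N; lia.
move: vM; rewrite /vol nk -exprnP -natrX ler_nat leqNgt => /negP; apply.
by apply: (@leq_trans k); [lia|exact/ltnW/ltn_expl].
Qed.

Lemma level_offset n (M : nat) : - M%:Z <= n -> exists k : nat, n = - M%:Z + k%:Z.
Proof. by move=> nM; exists (absz (n + M%:Z)); lia. Qed.

(* [psi] is a density of the Sobolev energy at one level; the factor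
   [rad d n `^ (s * p)] is the power of the diameter of the cell. *)
Definition oscillation_bound (K s p : R) (h : V -> R) (psi : V -> \bar R) :=
  forall n z, ((`|mean h (n + 1) (child n z false) - mean h (n + 1) (child n z true)| `^ p * vol n)%:E <=
    (K * rad d n `^ (s * p))%:E * \int[mu]_(x in cell n z) psi x)%E.

Variables (s p q alpha A B : R).
Hypotheses (p0 : 0 < p) (alpha_d : 0 < alpha < d%:R) (A0 : 0 < A) (B0 : 0 < B).
Hypothesis scaling : (d%:R - s * p) * A + (d%:R + alpha) * B = d%:R.

(** [nu] and [eps] are positive real lower bounds for the two energy shares, not the shares
    themselves, because the integrals may be infinite. *)
Definition good_cell_at (C t : R) (psi rho : V -> \bar R) x := exists n (nu eps : R),
  [/\ 0 < nu, 0 < eps,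
    (nu%:E <= \int[mu]_(y in cell n (cell_index n x)) psi y)%E,
    (eps%:E <= \int[mu]_(y in cell n (cell_index n x)) rho y)%E &
    t `^ (p * A + 2 * q * B) * vol n <= C * (nu `^ A * eps `^ B)].

Lemma ae_good_cell (K : R) : 0 < K -> exists2 C, 0 < C &
  forall (t : R) (h w : V -> R) (E F : set V) (psi : V -> \bar R), 0 < t ->
  measurable_fun setT h -> (forall x, 0 <= h x) -> (forall x, h x <= t) ->
  measurable E -> measurable F -> E `<=` F -> (mu F < +oo)%E ->
  (forall x, E x -> t <= h x) -> (forall x, ~ F x -> h x = 0) ->
  measurable_fun setT w -> (forall x, 0 <= w x) -> (forall x, F x -> t `^ q <= w x) ->
  oscillation_bound K s p h psi ->
  {ae mu, forall x, E x ->
     good_cell_at C t psi (riesz_energy_density (d%:R - alpha) w) x}.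
Proof.
move=> K0; have [lam [C [/andP[lam0 lam1] C0 alg]]] := good_cell_algebra hd q p0 alpha_d A0 B0 scaling K0.
exists C => // t h w E F psi t0 mh h0 ht mE mF EF Foo Eh Fh mw w0 Fw osc.
have /andP[a0 ad] := alpha_d.
apply: filterS (ae_dense_cell hd mE) => x + Ex => /(_ Ex)[k0 start].
have [|m [j [jump FQ FP]]] := chain_jump hd t0 _ mh h0 ht mE mF EF Foo Eh Fh start (lam := lam).
  by rewrite lam0.
set n := m + j%:Z in jump FQ.
have vn := vol_gt0 (R := R) n; have vm := vol_gt0 (R := R) m.
have rn := rad_gt0 (R := R) (d := d) n; have rm := rad_gt0 (R := R) (d := d) m.
have c0 : 0 < (1 - lam) / 4 * t * lam ^+ j.
  by apply: mulr_gt0; rewrite ?exprn_gt0// mulr_gt0// divr_gt0// subr_gt0.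
exists n, (((1 - lam) / 4 * t * lam ^+ j) `^ p * vol n / (K * rad d n `^ (s * p))),
  (t `^ q * t `^ q / (2 * d%:R * rad d m) `^ (d%:R - alpha) * (4^-1 * vol m) * (4^-1 * vol n)).
split.
- by rewrite divr_gt0// ?mulr_gt0// powR_gt0.
- have : 0 < t `^ q by rewrite powR_gt0.
  have D0 : 0 < (2 * d%:R * rad d m) `^ (d%:R - alpha).
    by rewrite powR_gt0// !mulr_gt0// ltr0n.
  by move=> tq; rewrite !mulr_gt0// invr_gt0.
- have Kr : 0 < K * rad d n `^ (s * p) by rewrite mulr_gt0// powR_gt0.
  rewrite EFinM muleC lee_pdivrMl//.
  apply: le_trans (osc n (cell_index n x)); rewrite lee_fin ler_pM2r//.
  rewrite ge0_ler_powR ?nnegrE//; [exact: ltW|exact: ltW|].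
  (* The mean over a cell is the average of the means over its children, so a jump from the cell to
     either child is half the difference between the children, up to sign. *)
  have [b xb] : exists b, cell_index (n + 1) x = child n (cell_index n x) b.
    have := mem_cell_index n x; rewrite {1}(cell_child hd) => -[h'|h'].
      by exists false.
    by exists true.
  move: jump; rewrite (mean_children hd mh h0 ht n) xb.
  move: c0; set c := (_ * _ ^+ j); set u := mean _ _ (child _ _ false); set v := mean _ _ (child _ _ true).
  case: b xb => xb c0 jump.
    rewrite -/v in jump; rewrite distrC; apply: le_trans _ (ler_norm _).
    move: (c) (u) (v) c0 jump => {}c {}u {}v c0 jump; lra.
  rewrite -/u in jump; apply: le_trans _ (ler_norm _).
  move: (c) (u) (v) c0 jump => {}c {}u {}v c0 jump; lra.
- pose c := t `^ q * t `^ q / (2 * d%:R * rad d m) `^ (d%:R - alpha) * (4^-1 * vol m).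
  (* The outer integral runs over the small cell of level [n], the inner one over its ancestor of
     level [m], which contains the same [y]. *)
  have cR y : F y -> cell n (cell_index n x) y ->
      (c%:E <= riesz_energy_density (d%:R - alpha) w y)%E.
    move=> Fy yx; apply: (@riesz_density_ge _ _ hd _ _ w F m x y) => //.
    - by rewrite subr_ge0 ltW.
    - exact: powR_ge0.
    - exact: (@cell_index_coarse _ _ _ j).
  have mFQ : measurable (F `&` cell n (cell_index n x)) by exact: measurableI.
  have mrho : measurable_fun setT (riesz_energy_density (d%:R - alpha) w).
    apply: (@measurable_inner_integral R d (d%:R - alpha) (fun xy => w xy.1 * w xy.2)).
      by apply: measurable_funM; apply: measurableT_comp.
    by move=> xy; rewrite mulr_ge0.
  have rho0 y : (0 <= riesz_energy_density (d%:R - alpha) w y)%E.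
    by apply: integral_ge0 => u _; rewrite lee_fin !mulr_ge0 ?invr_ge0 ?powR_ge0.
  have c0' : 0 <= c.
    by rewrite !mulr_ge0 ?invr_ge0 ?powR_ge0// ltW.
  apply: (@le_trans _ _ (\int[mu]_(y in F `&` cell n (cell_index n x)) cst c%:E y)%E).
    by rewrite integral_cst// EFinM; apply: lee_wpmul2l; rewrite ?lee_fin.
  apply: (@le_trans _ _ (\int[mu]_(y in F `&` cell n (cell_index n x)) riesz_energy_density (d%:R - alpha) w y)%E).
    apply: ge0_le_integral => //; first exact: measurable_funTS.
    by move=> y [Fy yx]; exact: cR.
  by apply: ge0_subset_integral => //; exact: measurable_funTS.
- by rewrite (alg t m j t0).
Qed.

(** A good cell carries a positive share of both energies, so none exists when one of them
    vanishes. *)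
Lemma null_of_good_cells (C t : R) (psi rho : V -> \bar R) (E : set V) :
  measurable E ->
  measurable_fun setT psi -> (forall x, (0 <= psi x)%E) ->
  measurable_fun setT rho -> (forall x, (0 <= rho x)%E) ->
  {ae mu, forall x, E x -> good_cell_at C t psi rho x} ->
  (\int[mu]_x psi x = 0 \/ \int[mu]_x rho x = 0)%E -> mu E = 0%E.
Proof.
move=> mE mpsi psi0 mrho rho0 good int0.
suff : {ae mu, forall x, ~ E x}.
  move=> [Z [mZ Z0 EZ]]; apply/eqP; rewrite -measure_le0 -[leRHS]Z0.
  by apply: le_measure; rewrite ?inE// => x Ex; apply: EZ => /=; apply.
apply: filterS good => x gx Ex; have [n [nu [eps [nu0 eps0 hnu heps _]]]] := gx Ex.
case: int0 => int0.
- have : (nu%:E <= 0)%E.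
    by apply: le_trans hnu _; rewrite -int0; apply: ge0_subset_integral.
  by rewrite lee_fin leNgt nu0.
- have : (eps%:E <= 0)%E.
    by apply: le_trans heps _; rewrite -int0; apply: ge0_subset_integral.
  by rewrite lee_fin leNgt eps0.
Qed.

(* As [A + B >= 1], [u^A v^B <= max u v <= u + v] for [u, v] in [[0, 1]]. *)
Lemma powR_mul_le_add (N D u v : R) : 1 <= A + B -> 0 < N -> 0 < D ->
  0 < u <= N -> 0 < v <= D ->
  u `^ A * v `^ B <= N `^ A * D `^ B * (N^-1 * u + D^-1 * v).
Proof.
move=> AB N0 D0 /andP[u0 uN] /andP[v0 vD].
have a0 : 0 < N^-1 * u by rewrite mulr_gt0// invr_gt0.
have b0 : 0 < D^-1 * v by rewrite mulr_gt0// invr_gt0.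
have a1 : N^-1 * u <= 1 by rewrite mulrC ler_pdivrMr// mul1r.
have b1 : D^-1 * v <= 1 by rewrite mulrC ler_pdivrMr// mul1r.
have uE : u = N * (N^-1 * u) by rewrite mulVKf// gt_eqF.
have vE : v = D * (D^-1 * v) by rewrite mulVKf// gt_eqF.
move: (N^-1 * u) (D^-1 * v) a0 b0 a1 b1 uE vE => a b a0 b0 a1 b1 -> ->.
rewrite !powRM ?(ltW N0) ?(ltW D0) ?(ltW a0) ?(ltW b0)// mulrACA ler_pM2l ?mulr_gt0 ?powR_gt0//.
pose m := Num.max a b.
have am : a <= m by rewrite le_max lexx.
have bm : b <= m by rewrite le_max lexx orbT.
have m0 : 0 < m by exact: lt_le_trans am.
have m1 : m <= 1 by rewrite ge_max a1.
apply: (@le_trans _ _ (m `^ A * m `^ B)).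
  by apply: ler_pM; rewrite ?powR_ge0// ge0_ler_powR ?nnegrE// ?(ltW A0) ?(ltW B0) ?(ltW a0) ?(ltW b0) ?(ltW m0).
rewrite -powRD; last by rewrite (gt_eqF m0) implybT.
apply: (@le_trans _ _ m); first by apply: ge1r_powR; rewrite ?m0.
by rewrite ge_max lerDl lerDr !ltW.
Qed.

(** On a good cell, [powR_mul_le_add] turns the product into a sum, and the estimate becomes a
    comparison of two measures: a multiple of [mu] and the integral of a density. Since [nu] and
    [eps] are at most [N] and [D], good cells have bounded volume, so there is a coarsest level from
    which [le_measure_cells] can start. *)
Lemma le_level_of_good_cells (C t : R) (psi rho : V -> \bar R) (E : set V) (N D : R) :
  0 < C -> 0 < t -> 1 <= A + B -> measurable E ->
  measurable_fun setT psi -> (forall x, (0 <= psi x)%E) ->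
  measurable_fun setT rho -> (forall x, (0 <= rho x)%E) ->
  {ae mu, forall x, E x -> good_cell_at C t psi rho x} ->
  0 < N -> 0 < D -> (\int[mu]_x psi x <= N%:E)%E -> (\int[mu]_x rho x <= D%:E)%E ->
  ((t `^ (p * A + 2 * q * B))%:E * mu E <=
   (C * (N `^ A * D `^ B))%:E * \int[mu]_x (N^-1%:E * psi x + D^-1%:E * rho x))%E.
Proof.
move=> C0 t0 AB mE mpsi psi0 mrho rho0 good N0 D0 psiN rhoD.
have G0 : 0 < t `^ (p * A + 2 * q * B) by rewrite powR_gt0.
have M0 : 0 < C * (N `^ A * D `^ B) by rewrite !mulr_gt0// powR_gt0.
set G := t `^ _ in G0 *.
pose f x := ((C * (N `^ A * D `^ B))%:E * (N^-1%:E * psi x + D^-1%:E * rho x))%E.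
have mPR : measurable_fun setT (fun x => N^-1%:E * psi x + D^-1%:E * rho x)%E.
  by apply: emeasurable_funD; apply: measurable_funeM.
have N1 : (0 <= N^-1%:E)%E by rewrite lee_fin invr_ge0 ltW.
have D1 : (0 <= D^-1%:E)%E by rewrite lee_fin invr_ge0 ltW.
have PR0 x : (0 <= N^-1%:E * psi x + D^-1%:E * rho x)%E.
  by apply: adde_ge0; apply: mule_ge0.
have mf : measurable_fun setT f by apply: measurable_funeM.
have f0 x : (0 <= f x)%E by rewrite mule_ge0// lee_fin ltW.
have fE (S : set V) : measurable S -> (\int[mu]_(x in S) f x =
    (C * (N `^ A * D `^ B))%:E * (N^-1%:E * \int[mu]_(x in S) psi x + D^-1%:E * \int[mu]_(x in S) rho x))%E.
  move=> mS; rewrite ge0_integralZl//; [|exact: measurable_funTS|by rewrite lee_fin ltW].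
  rewrite ge0_integralD//.
  - by rewrite !ge0_integralZl//; exact: measurable_funTS.
  - by move=> x _; rewrite mule_ge0.
  - exact/measurable_funTS/measurable_funeM.
  - by move=> x _; rewrite mule_ge0.
  - exact/measurable_funTS/measurable_funeM.
rewrite -ge0_integralZl//; last by rewrite lee_fin ltW.
pose m1 := [the {measure set V -> \bar R} of mscale (NngNum (ltW G0)) mu].
pose m2 := [the {measure set V -> \bar R} of density_measure mu mf f0].
pose U (n0 : int) := [set x : V | exists k : nat,
  (m1 (cell (n0 + k%:Z) (cell_index (n0 + k%:Z) x)) <= m2 (cell (n0 + k%:Z) (cell_index (n0 + k%:Z) x)))%E].
have UE n0 : measurable (U n0) /\ (m1 (U n0) <= m2 (U n0))%E.
  exact: (@le_measure_cells R d n0 (fun k z => m1 (cell (n0 + k%:Z) z) <= m2 (cell (n0 + k%:Z) z))%E).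
(* The factor [2] bounds [N^-1 * nu + D^-1 * eps], both terms being at most [1]. *)
have [M MC] : exists M : nat, C * (N `^ A * D `^ B) * 2 / G <= M%:R.
  by exists (Num.truncn (C * (N `^ A * D `^ B) * 2 / G)).+1; apply/ltW/truncnS_gt.
have key x : E x -> good_cell_at C t psi rho x -> U (- M%:Z) x.
  move=> Ex [n [nu [eps [nu0 eps0 hnu heps hv]]]].
  have nuN : nu <= N.
    rewrite -lee_fin; apply: le_trans hnu (le_trans _ psiN).
    by apply: ge0_subset_integral.
  have epsD : eps <= D.
    rewrite -lee_fin; apply: le_trans heps (le_trans _ rhoD).
    by apply: ge0_subset_integral.
  have AEB := @powR_mul_le_add N D nu eps AB N0 D0.
  rewrite nu0 eps0 nuN epsD in AEB; have {}AEB := AEB isT isT.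
  have Gv : G * vol n <= C * (N `^ A * D `^ B) * (N^-1 * nu + D^-1 * eps).
    apply: (le_trans hv); rewrite -mulrA ler_pM2l//.
  have nM : - M%:Z <= n.
    apply: level_ge_of_vol_le; apply: le_trans MC.
    rewrite ler_pdivlMr// mulrC; apply: le_trans Gv _; rewrite ler_pM2l//.
    have : N^-1 * nu <= 1 by rewrite mulrC ler_pdivrMr// mul1r.
    have : D^-1 * eps <= 1 by rewrite mulrC ler_pdivrMr// mul1r.
    lra.
  have [k nk] := level_offset nM; exists k; rewrite -nk {k nk}.
  rewrite /m1 /m2 /= /mscale /density_measure fE//=.
  have := cell_volume (R := R) hd n (cell_index n x).
  rewrite /= => ->; rewrite -EFinM.
  apply: le_trans (_ : ((C * (N `^ A * D `^ B) * (N^-1 * nu + D^-1 * eps))%:E <= _)%E).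
    by rewrite lee_fin.
  rewrite EFinM; apply: lee_wpmul2l; first by rewrite lee_fin ltW.
  by rewrite EFinD !EFinM; apply: leeD; apply: lee_wpmul2l.
have EU : (mu E <= mu (U (- M%:Z)%R))%E.
  have [Z [mZ Z0 EZ]] := good.
  have [mU _] := UE (- M%:Z).
  apply: (@le_trans _ _ (mu (U (- M%:Z) `|` Z))).
    apply: le_measure; rewrite ?inE//; first exact: measurableU.
    move=> x Ex; have [Zx|nZx] := pselect (Z x); first by right.
    left; apply: key => //; apply: contrapT => ng; apply: nZx; apply: EZ => /= /(_ Ex).
    exact: ng.
  have /le_trans := measureU2 mu mU mZ; apply.
  by rewrite -[leRHS]adde0 -[in leRHS]Z0.
have [mU Ule] := UE (- M%:Z).
apply: (@le_trans _ _ (m1 (U (- M%:Z)))).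
  by apply: lee_wpmul2l => //; rewrite lee_fin ltW.
apply: (le_trans Ule); rewrite /m2 /= /density_measure.
by apply: ge0_subset_integral.
Qed.

End level_estimate.

(** * Summation over the levels *)

Section truncation.
Context {R : realType}.
Implicit Types (a b t : R).

Definition trunc t a : R := Num.min a (2 * t) - Num.min a t.

Lemma trunc_ge0 t a : 0 <= t -> 0 <= trunc t a.
Proof. by move=> t0; rewrite /trunc subr_ge0 le_min !ge_min lexx /= (_ : t <= 2 * t) ?orbT//; lra. Qed.

Lemma trunc_le t a : 0 <= t -> trunc t a <= t.
Proof.
by move=> t0; rewrite /trunc; case: (leP a (2 * t)) => h1; case: (leP a t) => h2; lra.
Qed.

Lemma trunc_eq0 t a : 0 <= t -> a <= t -> trunc t a = 0.
Proof.
by move=> t0 at_; rewrite /trunc; case: (leP a (2 * t)) => h1; case: (leP a t) => h2; lra.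
Qed.

Lemma trunc_ge t a : 0 <= t -> 2 * t <= a -> t <= trunc t a.
Proof.
by move=> t0 at_; rewrite /trunc; case: (leP a (2 * t)) => h1; case: (leP a t) => h2; lra.
Qed.

Lemma le_trunc t a b : 0 <= t -> a <= b -> trunc t a <= trunc t b.
Proof.
move=> t0 ab; rewrite /trunc; case: (leP a (2 * t)) => h1; case: (leP a t) => h2;
case: (leP b (2 * t)) => h3; case: (leP b t) => h4; lra.
Qed.

Lemma measurable_trunc t : measurable_fun setT (trunc t).
Proof. by apply: measurable_funB; apply: measurable_minr. Qed.

(** Dyadic values indexed from [2^-M] upwards, so that sums over levels are finite; letting [M] grow
    reaches all positive values. *)
Definition level (M i : nat) : R := 2 ^ (i%:Z - M%:Z).

Lemma level_gt0 M i : 0 < level M i.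
Proof. exact: exp2z_gt0. Qed.

Lemma levelS M i : level M i.+1 = 2 * level M i.
Proof. by rewrite /level (_ : i.+1%:Z - M%:Z = 1 + (i%:Z - M%:Z)) ?expfzDr ?expr1z//; lia. Qed.

(** Each level is twice the preceding one, so the sum telescopes. *)
Lemma sum_trunc_diff M n a b : b <= a ->
  \sum_(i < n) (trunc (level M i) a - trunc (level M i) b) <= a - b.
Proof.
move=> ba.
have -> : \sum_(i < n) (trunc (level M i) a - trunc (level M i) b) =
   (Num.min a (level M n) - Num.min a (level M 0)) - (Num.min b (level M n) - Num.min b (level M 0)).
  elim: n => [|n IH]; first by rewrite big_ord0 !subrr.
  by rewrite big_ord_recr IH /trunc levelS /=; ring.
have : level M 0 <= level M n.
  elim: n => // n /le_trans; apply; rewrite levelS.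
  by have := level_gt0 M n; lra.
move: (level M n) (level M 0) => u v vu.
case: (leP a u) => h1; case: (leP a v) => h2; case: (leP b u) => h3; case: (leP b v) => h4; lra.
Qed.

(** Write [x^p] as [x * x^(p-1)] and bound the second factor by that of the whole sum. *)
Lemma sum_powR_le (n : nat) (p : R) (x : 'I_n -> R) : 1 <= p -> (forall i, 0 <= x i) ->
  \sum_i x i `^ p <= (\sum_i x i) `^ p.
Proof.
move=> p1 x0; have p0 : 0 < p by lra.
have S0 : 0 <= \sum_i x i by exact: sumr_ge0.
rewrite -(mulr_powRB1 S0 p0) mulr_suml; apply: ler_sum => i _.
rewrite -(mulr_powRB1 (x0 i) p0); apply: ler_wpM2l => //.
rewrite ge0_ler_powR ?nnegrE//; first lra.
by rewrite (bigD1 i) //= lerDl sumr_ge0.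
Qed.

Lemma sum_trunc_powR M n p a b : 1 <= p ->
  \sum_(i < n) `|trunc (level M i) a - trunc (level M i) b| `^ p <= `|a - b| `^ p.
Proof.
move=> p1; wlog ba : a b / b <= a.
  move=> H; have [ba|/ltW ab] := leP b a; first exact: H.
  by rewrite distrC; under eq_bigr do rewrite distrC; exact: H.
apply: (le_trans (sum_powR_le p1 _)); first by move=> i; exact: normr_ge0.
rewrite ge0_ler_powR ?nnegrE ?sumr_ge0//; first lra.
rewrite [leRHS]ger0_norm ?subr_ge0//; apply: le_trans (sum_trunc_diff M n ba).
apply: ler_sum => i _; rewrite ger0_norm// subr_ge0 le_trunc//.
exact/ltW/level_gt0.
Qed.

(** Only levels below both [a] and [b] contribute, and their terms [t^(2q)] grow at least fourfold
    from one to the next, so the last one dominates. The induction carries along the bound by the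
    next term. *)
Lemma sum_level_square M n (q a b : R) : 1 <= q -> 0 <= a -> 0 <= b ->
  \sum_(i < n) ((level M i `^ q * (level M i < a)%R%:R) * (level M i `^ q * (level M i < b)%R%:R))
  <= 2 * (a `^ q * b `^ q).
Proof.
move=> q1 a0 b0.
have pw t : 0 <= t -> 2 * t `^ q <= (2 * t) `^ q.
  move=> t0; rewrite powRM//; apply: ler_wpM2r; first exact: powR_ge0.
  by rewrite -[leLHS]powRr1// ler_powR// ler1n.
suff [] : \sum_(i < n) ((level M i `^ q * (level M i < a)%R%:R) * (level M i `^ q * (level M i < b)%R%:R))
  <= level M n `^ q * level M n `^ q /\
  \sum_(i < n) ((level M i `^ q * (level M i < a)%R%:R) * (level M i `^ q * (level M i < b)%R%:R))
  <= 2 * (a `^ q * b `^ q) by [].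
elim: n => [|n [IH1 IH2]].
  by rewrite big_ord0; split; rewrite ?mulr_ge0 ?powR_ge0.
rewrite big_ord_recr /= levelS.
have := pw _ (ltW (level_gt0 M n)); have := powR_ge0 (level M n) q.
move: IH1 IH2; set S := (\sum_(i < n) _).
case: (ltP (level M n) a) => ta; case: (ltP (level M n) b) => tb; rewrite ?mulr1 ?mulr0 ?mul0r ?addr0;
move=> IH1 IH2 t0 t1; split => //; try by nra.
have qa : level M n `^ q <= a `^ q.
  by rewrite ge0_ler_powR ?nnegrE ?(ltW (level_gt0 _ _)) ?(ltW ta)//; lra.
have qb : level M n `^ q <= b `^ q.
  by rewrite ge0_ler_powR ?nnegrE ?(ltW (level_gt0 _ _)) ?(ltW tb)//; lra.
have : level M n `^ q * level M n `^ q <= a `^ q * b `^ q by apply: ler_pM.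
lra.
Qed.

(** A single term suffices: for the last level with [2 * level M i <= a] one has
    [a < 4 * level M i]. *)
Lemma powR_le_sum_levels M n (gamma a : R) : 0 <= gamma ->
  2 * level M 0 <= a < 2 * level M n ->
  a `^ gamma <= 4 `^ gamma * \sum_(i < n) level M i `^ gamma * (2 * level M i <= a)%R%:R.
Proof.
move=> g0 /andP[]; elim: n => [|n IH] h1 h2; first by have := le_lt_trans h1 h2; rewrite ltxx.
have t0 := level_gt0 M n.
rewrite big_ord_recr /= mulrDr; have [h|h] := ltP a (2 * level M n).
  by apply: le_trans (IH h1 h) _; rewrite lerDl !mulr_ge0 ?powR_ge0.
rewrite mulr1 -powRM// ?(ltW t0)//; apply: (@le_trans _ _ ((4 * level M n) `^ gamma)).
  rewrite ge0_ler_powR ?nnegrE//.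
  - by apply: le_trans h1; rewrite mulr_ge0// ltW// level_gt0.
  - by rewrite mulr_ge0// ltW.
  - by move: h2; rewrite levelS; lra.
rewrite lerDr mulr_ge0 ?powR_ge0// sumr_ge0// => i _.
by rewrite mulr_ge0 ?powR_ge0.
Qed.

End truncation.

Section summation.
Context {R : realType} {d : nat}.
Local Notation V := 'rV[R]_d.
Local Notation mu := (@lebesgue_rV R d).
Implicit Types (x y : V).

Lemma measurable_superlevel (g : V -> R) (t : R) : measurable_fun setT g ->
  measurable [set x | t <= `|g x|].
Proof.
move=> mg; rewrite -[X in measurable X]setTI.
have mn : measurable_fun setT (fun x => `|g x|) by apply: measurableT_comp.
have := mn measurableT `[t, +oo[%classic (measurable_itv _).
congr (measurable (_ `&` _)); apply/seteqP.
by split => x /=; rewrite in_itv /= andbT.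
Qed.

Lemma measurable_strict_superlevel (g : V -> R) (t : R) : measurable_fun setT g ->
  measurable [set x | t < `|g x|].
Proof.
move=> mg; rewrite -[X in measurable X]setTI.
have mn : measurable_fun setT (fun x => `|g x|) by apply: measurableT_comp.
have := mn measurableT `]t, +oo[%classic (measurable_itv _).
congr (measurable (_ `&` _)); apply/seteqP.
by split => x /=; rewrite in_itv /= andbT.
Qed.

Lemma superlevel_lty (g : V -> R) (t : R) : 0 < t ->
  mu.-integrable setT (EFin \o g) -> (mu [set x | (t < `|g x|)%R] < +oo)%E.
Proof.
move=> t0 ig; have mg : measurable_fun setT g by move/integrableP : ig => [/measurable_EFinP].
have mF := measurable_strict_superlevel t mg.
have : (t%:E * mu [set x | (t < `|g x|)%R] < +oo)%E.
  move/integrableP : ig => [_]; apply: le_lt_trans.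
  rewrite -(integral_cst mu mF).
  apply: (@le_trans _ _ (\int[mu]_(x in [set x | (t < `|g x|)%R]) `|(EFin \o g) x|)%E).
    apply: ge0_le_integral => //.
    - by move=> x _; rewrite lee_fin ltW.
    - apply: measurableT_comp => //; apply/measurable_funTS/measurable_EFinP => //.
    - by move=> x /= h; rewrite lee_fin ltW.
  apply: ge0_subset_integral => //.
  by apply: measurableT_comp => //; apply/measurable_EFinP.
have : (0 <= mu [set x | (t < `|g x|)%R])%E by exact: measure_ge0.
case: (mu _) => [r _ _| |//]; first exact: ltry.
by rewrite gt0_muley ?lte_fin.
Qed.

Definition level_weight (q t : R) (g : V -> R) x : R := t `^ q * (t < `|g x|)%R%:R.

Lemma level_weight_ge0 q t g x : 0 <= level_weight q t g x.
Proof. by rewrite mulr_ge0 ?powR_ge0. Qed.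

Lemma measurable_level_weight q t g : measurable_fun setT g ->
  measurable_fun setT (level_weight q t g).
Proof.
move=> mg; apply: measurable_funM => //.
rewrite (_ : (fun _ => _) = \1_[set x | t < `|g x|]).
  by apply: measurable_indic; exact: measurable_strict_superlevel.
apply/funext => x; rewrite indicE; congr (_%:R); congr nat_of_bool; apply/esym.
by apply/idP/idP => [/set_mem|/mem_set].
Qed.

Lemma sum_riesz_level (q a : R) (g : V -> R) M n : 1 <= q -> measurable_fun setT g ->
  (\sum_(i < n) \int[mu]_y riesz_energy_density a
      (level_weight q (level M i) g) y <=
   2%:E * \int[mu]_y \int[mu]_x (`|g x| `^ q * `|g y| `^ q / enorm (x - y) `^ a)%:E)%E.
Proof.
move=> q1 mg.
have mn : measurable_fun setT (fun x => `|g x|) by apply: measurableT_comp.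
have mw i : measurable_fun setT (level_weight q (level M i) g) by exact: measurable_level_weight.
have w0 i x := level_weight_ge0 q (level M i) g x.
have mww (w : V -> R) : measurable_fun setT w -> measurable_fun setT (fun xy : V * V => w xy.1 * w xy.2).
  by move=> ?; apply: measurable_funM; apply: measurableT_comp.
have mq : measurable_fun setT (fun x => `|g x| `^ q).
  exact: (measurableT_comp (measurable_powR _)).
rewrite -ge0_integral_sum//; last 2 first.
- move=> i; apply: (@measurable_inner_integral R d a (fun xy => level_weight q (level M i) g xy.1 * level_weight q (level M i) g xy.2)).
    exact: mww.
  by move=> xy; rewrite mulr_ge0.
- by move=> i y _; apply: integral_ge0 => x _; rewrite lee_fin !mulr_ge0 ?invr_ge0 ?powR_ge0 ?level_weight_ge0.
rewrite -ge0_integralZl//; last 2 first.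
- apply: (@measurable_inner_integral R d a (fun xy => `|g xy.1| `^ q * `|g xy.2| `^ q)).
    exact: (mww (fun x => `|g x| `^ q)).
  by move=> xy; rewrite mulr_ge0 ?powR_ge0.
- by move=> y _; apply: integral_ge0 => x _; rewrite lee_fin !mulr_ge0 ?invr_ge0 ?powR_ge0 ?level_weight_ge0.
apply: ge0_le_integral => //.
- move=> y _; apply: sume_ge0 => i _; apply: integral_ge0 => x _.
  by rewrite lee_fin !mulr_ge0 ?invr_ge0 ?powR_ge0 ?level_weight_ge0.
- apply: emeasurable_sum => i.
  apply: (@measurable_inner_integral R d a (fun xy => level_weight q (level M i) g xy.1 * level_weight q (level M i) g xy.2)).
    exact: mww.
  by move=> xy; rewrite mulr_ge0.
- apply: measurable_funeM.
  apply: (@measurable_inner_integral R d a (fun xy => `|g xy.1| `^ q * `|g xy.2| `^ q)).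
    exact: (mww (fun x => `|g x| `^ q)).
  by move=> xy; rewrite mulr_ge0 ?powR_ge0.
move=> y _.
have mK (w : V -> R) : measurable_fun setT w -> measurable_fun setT (fun x => (w x * w y / enorm (x - y) `^ a)%:E).
  move=> mw'; exact: (measurable_fun_pair1 y (measurable_kernel_ratio a (mww w mw'))).
rewrite -ge0_integralZl//; last 2 first.
- exact: (mK (fun x => `|g x| `^ q)).
- by move=> x _; rewrite lee_fin !mulr_ge0 ?invr_ge0 ?powR_ge0 ?level_weight_ge0.
rewrite -ge0_integral_sum//; last 2 first.
- by move=> i; exact: mK.
- by move=> i x _; rewrite lee_fin !mulr_ge0 ?invr_ge0 ?powR_ge0 ?level_weight_ge0.
apply: ge0_le_integral => //.
- by move=> x _; apply: sume_ge0 => i _; rewrite lee_fin !mulr_ge0 ?invr_ge0 ?powR_ge0 ?level_weight_ge0.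
- by apply: emeasurable_sum => i; exact: mK.
- by apply: measurable_funeM; exact: (mK (fun x => `|g x| `^ q)).
- move=> x _; rewrite sumEFin lee_fin -mulr_suml mulrA.
  apply: ler_wpM2r; first by rewrite invr_ge0 powR_ge0.
  exact: sum_level_square.
Qed.

Lemma integral_powR_le_levels (g : V -> R) (gamma : R) M : 0 <= gamma ->
  measurable_fun setT g ->
  (\int[mu]_(x in [set x | (2 * level M 0 <= `|g x| < 2 * level M (2 * M))%R]) (`|g x| `^ gamma)%:E <=
   (4 `^ gamma)%:E * \sum_(i < 2 * M) (level M i `^ gamma)%:E * mu [set x | (2 * level M i <= `|g x|)%R])%E.
Proof.
move=> g0 mg.
have mE i : measurable [set x | (2 * level M i <= `|g x|)%R] by exact: measurable_superlevel.
pose f x : \bar R := ((4 `^ gamma)%:E * \sum_(i < 2 * M) (level M i `^ gamma)%:E * (\1_[set x | (2 * level M i <= `|g x|)%R] x)%:E)%E.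
have m1 i : measurable_fun setT (fun x => (\1_[set x | (2 * level M i <= `|g x|)%R] x)%:E : \bar R).
  by apply/measurable_EFinP; exact: measurable_indic.
have mS : measurable_fun setT (fun x => \sum_(i < 2 * M) (level M i `^ gamma)%:E * (\1_[set x | (2 * level M i <= `|g x|)%R] x)%:E)%E.
  by apply: emeasurable_sum => i; exact: measurable_funeM.
have mf : measurable_fun setT f by exact: measurable_funeM.
have i0 i x : (0 <= (level M i `^ gamma)%:E * (\1_[set x | (2 * level M i <= `|g x|)%R] x)%:E)%E.
  by rewrite mule_ge0// lee_fin ?powR_ge0.
have f0 x : (0 <= f x)%E by rewrite mule_ge0 ?lee_fin ?powR_ge0// sume_ge0.
have -> : ((4 `^ gamma)%:E * \sum_(i < 2 * M) (level M i `^ gamma)%:E * mu [set x | (2 * level M i <= `|g x|)%R] = \int[mu]_x f x)%E.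
  rewrite (ge0_integralZl _ measurableT mS); last 2 first.
  - by move=> x _; rewrite sume_ge0.
  - by rewrite lee_fin powR_ge0.
  congr (_ * _)%E; rewrite ge0_integral_sum//; last by move=> i; exact: measurable_funeM.
  apply: eq_bigr => i _; rewrite ge0_integralZl ?lee_fin ?powR_ge0//.
  by rewrite integral_indic// setIT.
have mA : measurable [set x | (2 * level M 0 <= `|g x| < 2 * level M (2 * M))%R].
  rewrite (_ : [set x | _] = [set x | (2 * level M 0 <= `|g x|)%R] `\` [set x | (2 * level M (2 * M) <= `|g x|)%R]).
    by apply: measurableD.
  apply/seteqP; split => x /=; rewrite ltNge; first by move=> /andP[-> /negP].
  by move=> [-> /negP].
apply: (@le_trans _ _ (\int[mu]_(x in [set x | (2 * level M 0 <= `|g x| < 2 * level M (2 * M))%R]) f x)%E); last first.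
  exact: ge0_subset_integral.
apply: ge0_le_integral => //.
- apply/measurable_funTS/measurable_EFinP/(measurableT_comp (measurable_powR _)).
  exact: measurableT_comp.
- exact: measurable_funTS.
move=> x /= gx; rewrite /f.
under eq_bigr => i _ do rewrite -EFinM.
rewrite sumEFin -EFinM lee_fin.
apply: le_trans (powR_le_sum_levels g0 gx) _.
rewrite ler_wpM2l ?powR_ge0//; apply: ler_sum => i _.
rewrite ler_wpM2l ?powR_ge0// indicE.
by case: (boolP (2 * level M i <= `|g x|)) => // h; rewrite mem_set.
Qed.

(** The bands increase to the set where [g] is nonzero, and monotone convergence applies; zeros of
    [g] contribute nothing since [gamma] is positive. *)
Lemma integral_powR_le_of_bands (g : V -> R) (gamma : R) (X : \bar R) : 0 < gamma ->
  measurable_fun setT g ->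
  (forall M, (\int[mu]_(x in [set x | (2 * level M 0 <= `|g x| < 2 * level M (2 * M))%R]) (`|g x| `^ gamma)%:E <= X)%E) ->
  (\int[mu]_x (`|g x| `^ gamma)%:E <= X)%E.
Proof.
move=> g0 mg H.
pose Fb (M : nat) := [set x | (2 * level M 0 <= `|g x| < 2 * level M (2 * M))%R].
have lE1 M : level M 0 = (2 ^+ M)^-1 :> R.
  by rewrite /level sub0r -invr_expz.
have lE2 M : level M (2 * M) = 2 ^+ M :> R.
  by rewrite /level (_ : (2 * M)%N%:Z - M%:Z = M%:Z)//; lia.
have le2 (m n : nat) : (m <= n)%N -> 2 ^+ m <= 2 ^+ n :> R by move=> mn; rewrite ler_eXn2l// ltr1n.
have mF M : measurable (Fb M).
  rewrite (_ : Fb M = [set x | (2 * level M 0 <= `|g x|)%R] `\` [set x | (2 * level M (2 * M) <= `|g x|)%R]).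
    by apply: measurableD; exact: measurable_superlevel.
  apply/seteqP; split => x /=; rewrite /Fb /= ltNge; first by move=> /andP[-> /negP].
  by move=> [-> /negP].
have mf : measurable_fun setT (fun x => (`|g x| `^ gamma)%:E).
  apply/measurable_EFinP/(measurableT_comp (measurable_powR _)).
  exact: measurableT_comp.
have nF : nondecreasing_seq Fb.
  move=> m n mn; apply/subsetPset => x; rewrite /Fb /= !lE1 !lE2 => /andP[h1 h2]; apply/andP; split.
    apply: le_trans h1; rewrite ler_pM2l// lef_pV2 ?posrE ?exprn_gt0//; exact: le2.
  by apply: lt_le_trans h2 _; rewrite ler_pM2l//; exact: le2.
have cvgF := @ge0_nondecreasing_set_cvg_integral _ _ _ Fb (fun x => (`|g x| `^ gamma)%:E) mu nF mF
  (fun i => measurable_funTS mf) (fun i x _ => powR_ge0 _ _).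
have -> : (\int[mu]_x (`|g x| `^ gamma)%:E = \int[mu]_(x in \bigcup_i Fb i) (`|g x| `^ gamma)%:E)%E.
  rewrite [RHS]integral_mkcond; apply: eq_integral => x _; rewrite patchE.
  case: ifPn => // /negP nx; have [->|gx] := eqVneq (g x) 0.
    by rewrite normr0 powR0// gt_eqF.
  exfalso; apply: nx; apply/mem_set.
  have gx0 : 0 < `|g x| by rewrite normr_gt0.
  have [m1 hm1] : exists m : nat, `|g x| < 2 ^+ m.
    exists (Num.truncn `|g x|).+1; apply: lt_le_trans (truncnS_gt _) _.
    by rewrite -natrX ler_nat; exact/ltnW/ltn_expl.
  have [m2 hm2] : exists m : nat, 2 / `|g x| <= 2 ^+ m.
    exists (Num.truncn (2 / `|g x|)).+1; apply: le_trans (ltW (truncnS_gt _)) _.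
    by rewrite -natrX ler_nat; exact/ltnW/ltn_expl.
  exists (maxn m1 m2) => //; rewrite /Fb /= lE1 lE2; apply/andP; split.
    rewrite ler_pdivrMr ?exprn_gt0// mulrC -ler_pdivrMr//.
    by apply: le_trans hm2 _; apply: le2; exact: leq_maxr.
  apply: lt_le_trans hm1 _; apply: (@le_trans _ _ (2 ^+ maxn m1 m2)); first by apply: le2; exact: leq_maxl.
  by have : 0 < 2 ^+ maxn m1 m2 :> R by [rewrite exprn_gt0]; lra.
move/cvg_lim : (cvgF) => <- //.
apply: lime_le; last by near=> M; exact: H.
by apply/cvg_ex; eexists; exact: cvgF.
Unshelve. all: by end_near. Qed.

End summation.

(** * The inequality from an oscillation bound at each level *)

Section assembly.
Context {R : realType} {d : nat}.
Hypothesis hd : (0 < d)%N.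
Local Notation V := 'rV[R]_d.
Local Notation mu := (@lebesgue_rV R d).
Implicit Types (x y : V).

(** Isolates what does not depend on the form of the Sobolev seminorm: it enters through one density
    [psi t] per level with an oscillation bound, and through a bound [I] on the sum of their
    integrals. *)
Lemma coulomb_sobolev_of_levels (s p q alpha beta1 beta2 gamma K : R) :
  0 < gamma -> 1 <= p -> 1 <= q -> 0 < alpha < d%:R -> 0 < beta1 -> 0 < beta2 ->
  beta1 * p + 2 * beta2 * q = 1 ->
  (d%:R - s * p) * beta1 + (d%:R + alpha) * beta2 = d%:R / gamma ->
  1 <= beta1 * gamma + beta2 * gamma -> 0 < K ->
  exists2 C, 0 < C & forall (g : V -> R) (psi : R -> V -> \bar R) (I : \bar R),
  mu.-integrable setT (EFin \o g) ->
  (forall t, 0 < t -> measurable_fun setT (psi t)) -> (forall t x, (0 <= psi t x)%E) ->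
  (forall t, 0 < t -> oscillation_bound K s p (fun x => trunc t `|g x|) (psi t)) ->
  (forall M n, (\sum_(i < n) \int[mu]_x psi (level M i) x <= I)%E) ->
  ('N[mu]_(gamma%:E)[EFin \o g] <=
    C%:E * ((I `^ p^-1) `^ (beta1 * p)%R * coulomb_energy alpha q g `^ beta2))%E.
Proof.
move=> g0 p1 q1 alpha_d b10 b20 hs1 hs2 hge K0.
pose A := beta1 * gamma; pose B := beta2 * gamma.
have p0 : 0 < p by lra.
have A0 : 0 < A by rewrite mulr_gt0.
have B0 : 0 < B by rewrite mulr_gt0.
have scaling : (d%:R - s * p) * A + (d%:R + alpha) * B = d%:R.
  by rewrite !mulrA -mulrDl hs2 divfK// gt_eqF.
(* The first scaling relation times [gamma]: the power of [t] in [good_cell_at] is exactly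
   [t^gamma]. *)
have gE : p * A + 2 * q * B = gamma.
  transitivity ((beta1 * p + 2 * beta2 * q) * gamma); first by rewrite /A /B; ring.
  by rewrite hs1 mul1r.
have [C0 C00 good] := ae_good_cell hd q p0 alpha_d A0 B0 scaling K0.
(* The factors come from: the bands; the good cells; the level Coulomb energies, which sum to at
   most twice [D] and are raised to the power [B]; and the two normalised sums, each at most [1]. *)
pose C1 := 4 `^ gamma * C0 * 2 `^ B * 2.
have C10 : 0 < C1 by rewrite !mulr_gt0 ?powR_gt0.
exists (C1 `^ gamma^-1); first by rewrite powR_gt0.
move=> g psi I ig mpsi psi0 osc sumI.
have mg : measurable_fun setT g by move/integrableP : ig => [/measurable_EFinP].
set D := coulomb_energy alpha q g.
have I0 : (0 <= I)%E by have := sumI 0%N 0%N; rewrite big_ord0.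
have D0 : (0 <= D)%E.
  by apply: integral_ge0 => y _; apply: integral_ge0 => x _; rewrite lee_fin !mulr_ge0 ?invr_ge0 ?powR_ge0.
have NE : ('N[mu]_(gamma%:E)[EFin \o g] = (\int[mu]_x (`|g x| `^ gamma)%:E) `^ gamma^-1)%E.
  rewrite unlock; congr (_ `^ _)%E; apply: eq_integral.
have p10 : 0 < p^-1 by rewrite invr_gt0.
have bp0 : 0 < beta1 * p by rewrite mulr_gt0.
have IE : ((I `^ p^-1) `^ (beta1 * p)%R = I `^ beta1)%E.
  by rewrite -poweRrM mulrCA mulVf ?mulr1// gt_eqF.
rewrite NE IE.
pose rho t := riesz_energy_density (d%:R - alpha) (level_weight q t g).
have mrho t : measurable_fun setT (rho t).
  apply: (@measurable_inner_integral R d (d%:R - alpha) (fun xy => level_weight q t g xy.1 * level_weight q t g xy.2)).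
    by apply: measurable_funM; apply: measurableT_comp => //; exact: measurable_level_weight.
  by move=> xy; rewrite mulr_ge0 ?level_weight_ge0.
have rho0 t y : (0 <= rho t y)%E.
  by apply: integral_ge0 => u _; rewrite lee_fin !mulr_ge0 ?invr_ge0 ?powR_ge0 ?level_weight_ge0.
pose E t := [set x : V | 2 * t <= `|g x|].
have mE t : measurable (E t) by exact: measurable_superlevel.
have goodE t : 0 < t -> {ae mu, forall x, E t x -> good_cell_at p q A B C0 t (psi t) (rho t) x}.
  move=> t0; apply: (good t (fun x => trunc t `|g x|) (level_weight q t g) (E t) [set x | t < `|g x|] (psi t) t0) => //.
  - by apply: measurableT_comp; [exact: measurable_trunc|exact: measurableT_comp].
  - by move=> x; apply: trunc_ge0; exact: ltW.
  - by move=> x; apply: trunc_le; exact: ltW.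
  - exact: measurable_strict_superlevel.
  - by move=> x; rewrite /E /=; lra.
  - exact: superlevel_lty.
  - by move=> x h; apply: trunc_ge => //; exact: ltW.
  - by move=> x /= /negP; rewrite -leNgt => h; apply: trunc_eq0 => //; exact: ltW.
  - exact: measurable_level_weight.
  - by move=> x; exact: level_weight_ge0.
  - by move=> x /= h; rewrite /level_weight h mulr1.
  - exact: osc.
have psiI M i : (\int[mu]_x psi (level M i) x <= I)%E.
  apply: le_trans (sumI M i.+1); rewrite big_ord_recr /= leeDr//.
  by apply: sume_ge0 => j _; apply: integral_ge0.
have sumD M n : (\sum_(i < n) \int[mu]_x rho (level M i) x <= 2%:E * D)%E.
  exact: sum_riesz_level.
have rhoD M i : (\int[mu]_x rho (level M i) x <= 2%:E * D)%E.
  apply: le_trans (sumD M i.+1); rewrite big_ord_recr /= leeDr//.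
  by apply: sume_ge0 => j _; apply: integral_ge0.
(* If one energy is zero, the right-hand side vanishes even if the other is infinite, as
   [0 * +oo = 0]; so [g] must be shown to vanish almost everywhere. *)
have [deg|] := boolP ((I == 0) || (D == 0)).
  rewrite (_ : (\int[mu]_x (`|g x| `^ gamma)%:E)%E = 0%E).
    by rewrite poweR0r ?invr_eq0 ?gt_eqF// !mule_ge0 ?poweR_ge0// lee_fin powR_ge0.
  apply/eqP; rewrite eq_le integral_ge0 ?andbT; last by move=> x _; rewrite lee_fin powR_ge0.
  apply: (integral_powR_le_of_bands g0 mg) => M; apply: le_trans (integral_powR_le_levels _ (ltW g0) mg) _.
  rewrite big1 ?mule0// => i _.
  rewrite (_ : mu _ = 0%E) ?mule0//.
  have t0 := level_gt0 (R := R) M i.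
  apply: (null_of_good_cells (mE (level M i)) (mpsi _ t0) (psi0 _) (mrho _) (rho0 _) (goodE _ t0)).
  case/orP : deg => /eqP Z; [left|right]; apply/eqP; rewrite eq_le integral_ge0// andbT.
    by rewrite -Z.
  by apply: le_trans (rhoD M i) _; rewrite Z mule0.
rewrite negb_or => /andP[In0 Dn0].
have {}I0 : (0 < I)%E by rewrite lt_neqAle eq_sym In0.
have {}D0 : (0 < D)%E by rewrite lt_neqAle eq_sym Dn0.
have [Ioo|/eqP Ify] := eqVneq I +oo%E.
  rewrite Ioo poweRyr ?gt_eqF// gt0_mulye ?poweR_gt0// gt0_muley ?leey//.
  by rewrite lte_fin powR_gt0.
have [Doo|/eqP Dfy] := eqVneq D +oo%E.
  rewrite Doo poweRyr ?gt_eqF// gt0_muley ?poweR_gt0// gt0_muley ?leey//.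
  by rewrite lte_fin powR_gt0.
have [N IN] : exists N, I = N%:E by case: (I) I0 Ify => // r; exists r.
have [D1 DD1] : exists D1, D = D1%:E by case: (D) D0 Dfy => // r; exists r.
move: I0 D0; rewrite IN DD1 !lte_fin => N0 D10.
have ND : 0 < 2 * D1 by rewrite mulr_gt0.
(* The root of order [gamma] turns the exponents [A] and [B] into [beta1] and [beta2]. *)
suff H : (\int[mu]_x (`|g x| `^ gamma)%:E <= (C1 * (N `^ A * D1 `^ B))%:E)%E.
  have i0 : (0 <= \int[mu]_x (`|g x| `^ gamma)%:E)%E.
    by apply: integral_ge0 => x _; rewrite lee_fin powR_ge0.
  have c0 : 0 <= C1 * (N `^ A * D1 `^ B) by rewrite mulr_ge0 ?(ltW C10) ?mulr_ge0 ?powR_ge0.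
  apply: le_trans (gt0_ler_poweR (_ : 0 <= gamma^-1) _ _ H) _.
  - by rewrite invr_ge0 ltW.
  - by rewrite in_itv /= i0 leey.
  - by rewrite in_itv /= lee_fin c0 leey.
  rewrite !poweR_EFin -!EFinM lee_fin (powRM _ (ltW C10)); last by rewrite mulr_ge0 ?powR_ge0.
  rewrite (powRM _ (powR_ge0 _ _) (powR_ge0 _ _)).
  by rewrite -!powRrM /A /B !mulfK// gt_eqF.
apply: (integral_powR_le_of_bands g0 mg) => M; apply: le_trans (integral_powR_le_levels _ (ltW g0) mg) _.
have lev (i : 'I_(2 * M)) := le_level_of_good_cells hd A0 B0 C00 (level_gt0 (R := R) M i) hge (mE (level M i))
  (mpsi _ (level_gt0 (R := R) M i)) (psi0 _) (mrho _) (rho0 _) (goodE _ (level_gt0 (R := R) M i)) N0 ND.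
have {}lev (i : 'I_(2 * M)) : ((level M i `^ gamma)%:E * mu [set x | (2 * level M i <= `|g x|)%R] <=
    (C0 * (N `^ A * (2 * D1) `^ B))%:E * (N^-1%:E * \int[mu]_x psi (level M i) x +
       (2 * D1)^-1%:E * \int[mu]_x rho (level M i) x))%E.
  have mp := mpsi _ (level_gt0 (R := R) M i).
  have N1 : (0 <= N^-1%:E)%E by rewrite lee_fin invr_ge0 ltW.
  have D2 : (0 <= (2 * D1)^-1%:E)%E by rewrite lee_fin invr_ge0 ltW.
  rewrite -!ge0_integralZl// -ge0_integralD//.
  - rewrite -[X in level M i `^ X]gE; apply: lev.
      by rewrite -IN; exact: psiI.
    by rewrite EFinM -DD1; exact: rhoD.
  - by move=> x _; rewrite mule_ge0.
  - exact: measurable_funeM.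
  - by move=> x _; rewrite mule_ge0.
  - exact: measurable_funeM.
have c40 : (0 <= (4 `^ gamma)%:E)%E by rewrite lee_fin powR_ge0.
have cN0 : (0 <= (C0 * (N `^ A * (2 * D1) `^ B))%:E)%E.
  by rewrite lee_fin !mulr_ge0 ?powR_ge0// ltW.
have ip i : (0 <= \int[mu]_x psi (level M i) x)%E by exact: integral_ge0.
have ir i : (0 <= \int[mu]_x rho (level M i) x)%E by exact: integral_ge0.
have N1 : (0 <= N^-1%:E)%E by rewrite lee_fin invr_ge0 ltW.
have D2 : (0 <= (2 * D1)^-1%:E)%E by rewrite lee_fin invr_ge0 ltW.
apply: (@le_trans _ _ ((4 `^ gamma)%:E * ((C0 * (N `^ A * (2 * D1) `^ B))%:E * 2%:E))%E); last first.
  rewrite -!EFinM lee_fin powRM ?(ltW D10)// /C1 le_eqVlt; apply/orP; left; apply/eqP.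
  by ring.
apply: lee_wpmul2l => //.
apply: (le_trans (lee_sum _ (fun i _ => lev i))).
rewrite -ge0_sume_distrr; last by move=> i _; rewrite adde_ge0// mule_ge0.
apply: lee_wpmul2l => //.
rewrite big_split /= -!ge0_sume_distrr//.
rewrite (_ : 2%:E = N^-1%:E * N%:E + (2 * D1)^-1%:E * (2 * D1)%:E)%E.
  apply: leeD; apply: lee_wpmul2l => //.
    by rewrite -IN; exact: sumI.
  by rewrite EFinM -DD1; exact: sumD.
by rewrite -!EFinM -EFinD !mulVf ?gt_eqF.
Qed.

End assembly.

(** * Fractional seminorms *)

Section jensen.
Context {disp} {T : measurableType disp} {R : realType} (mu : {measure set T -> \bar R}).

(** The graph of the power lies above its tangent at [c]. This is Young's inequality for [u] and
    [c^(p-1)] with exponents [p] and [p / (p - 1)], which leaves [p = 1] apart. *)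
Lemma young_tangent (p c u : R) : 1 <= p -> 0 <= c -> 0 <= u ->
  p * c `^ (p - 1) * u <= u `^ p + (p - 1) * c `^ p.
Proof.
rewrite le_eqVlt => /orP[/eqP <-|p1] c0 u0.
  by rewrite subrr powRr0 powRr1// !mul1r mul0r addr0.
have p0 : 0 < p by lra.
have q0 : 0 < p / (p - 1) by rewrite divr_gt0// subr_gt0.
have pm : p - 1 != 0 by rewrite subr_eq0 gt_eqF.
have := @conjugate_powR R u (c `^ (p - 1)) p (p / (p - 1)) u0 (powR_ge0 _ _) p0 q0.
have E : (p - 1) * (p / (p - 1)) = p by rewrite mulrCA mulfV// mulr1.
rewrite invf_div -powRrM E.
have -> : p^-1 + (p - 1) / p = 1 by field; rewrite gt_eqF.
move=> /(_ erefl) h; rewrite -mulrA -(ler_pM2l (_ : 0 < p^-1)) ?invr_gt0//.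
rewrite mulKf ?gt_eqF// mulrC; apply: le_trans h _.
by rewrite le_eqVlt; apply/orP; left; apply/eqP; field; rewrite gt_eqF.
Qed.

(** Integrate the tangent inequality at [c]. The finite term is cancelled at the end, so the
    integral of the power is allowed to be infinite. *)
Lemma jensen_powR (S : set T) (f : T -> R) (p c v : R) : 1 <= p -> 0 <= c -> 0 <= v ->
  measurable S -> mu S = v%:E -> measurable_fun S f -> (forall x, 0 <= f x) ->
  ((c * v)%:E <= \int[mu]_(x in S) (f x)%:E)%E ->
  ((c `^ p * v)%:E <= \int[mu]_(x in S) (f x `^ p)%:E)%E.
Proof.
move=> p1 c0 v0 mS muS mf f0 H.
have p0 : 0 < p by lra.
have mfp : measurable_fun S (fun x => (f x `^ p)%:E).
  exact/measurable_EFinP/(measurableT_comp (measurable_powR _)).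
have k0 : 0 <= p * c `^ (p - 1) by rewrite mulr_ge0 ?powR_ge0// ltW.
have l0 : 0 <= (p - 1) * c `^ p by rewrite mulr_ge0 ?powR_ge0// subr_ge0.
have : ((p * c `^ (p - 1))%:E * \int[mu]_(x in S) (f x)%:E <=
    \int[mu]_(x in S) (f x `^ p)%:E + ((p - 1) * c `^ p * v)%:E)%E.
  rewrite [((p - 1) * c `^ p * v)%:E]EFinM -muS -(integral_cst mu mS) -ge0_integralZl//; last 2 first.
  - exact/measurable_EFinP.
  - by move=> x _; rewrite lee_fin.
  - rewrite -ge0_integralD//.
    + apply: ge0_le_integral => //.
      * by move=> x _; rewrite mule_ge0 ?lee_fin.
      * exact/measurable_funeM/measurable_EFinP.
      * by apply: emeasurable_funD => //; exact: measurable_cst.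
      * by move=> x _; rewrite /= -EFinM -EFinD lee_fin; exact: young_tangent.
    + by move=> x _; rewrite lee_fin powR_ge0.
have : ((p * c `^ (p - 1) * (c * v))%:E <= (p * c `^ (p - 1))%:E * \int[mu]_(x in S) (f x)%:E)%E.
  by rewrite EFinM; apply: lee_wpmul2l; rewrite ?lee_fin.
move=> /le_trans h /h {h}.
have -> : p * c `^ (p - 1) * (c * v) = c `^ p * v + (p - 1) * c `^ p * v.
  by rewrite -(mulr_powRB1 c0 p0); ring.
by rewrite EFinD leeD2rE.
Qed.

End jensen.

Section mean_deviation.
Context {R : realType} {d : nat}.
Hypothesis hd : (0 < d)%N.
Local Notation V := 'rV[R]_d.
Local Notation mu := (@lebesgue_rV R d).
Local Notation index := {ffun 'I_d -> int}.
Implicit Types (n : int) (z : index) (x y : V).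
Variables (t : R) (h : V -> R).
Hypotheses (mh : measurable_fun setT h) (h0 : forall x, 0 <= h x) (ht : forall x, h x <= t).

Lemma mean_ge0 n z : 0 <= mean h n z.
Proof.
rewrite /mean divr_ge0 ?(ltW (vol_gt0 _))// fine_ge0//.
by apply: integral_ge0 => x _; rewrite lee_fin.
Qed.

(** The triangle inequality is integrated in both directions as an inequality between sums, because
    extended integrals do not subtract freely. *)
Lemma mean_deviation (b : R) n z : 0 <= b ->
  ((`|mean h n z - b| * vol n)%:E <= \int[mu]_(x in cell n z) (`|h x - b|)%:E)%E.
Proof.
move=> b0.
have mD : measurable_fun (cell n z) (fun x => (`|h x - b|)%:E).
  apply/measurable_EFinP/measurableT_comp => //.
  by apply: measurable_funB => //; exact: measurable_funTS.
have mhc : measurable_fun (cell n z) (fun x => (h x)%:E).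
  exact/measurable_EFinP/measurable_funTS.
have cb : (\int[mu]_(x in cell n z) cst b%:E x = (b * vol n)%:E)%E.
  by rewrite integral_cst// EFinM -(cell_volume hd n z).
have D0 : (0 <= \int[mu]_(x in cell n z) (`|h x - b|)%:E)%E.
  by apply: integral_ge0.
have h1 : ((mean h n z * vol n)%:E <= \int[mu]_(x in cell n z) (`|h x - b|)%:E + (b * vol n)%:E)%E.
  rewrite (meanK hd mh h0 ht) -cb -ge0_integralD//.
  apply: ge0_le_integral => //.
  - by move=> x _; rewrite lee_fin.
  - by apply: emeasurable_funD => //; exact: measurable_cst.
  - by move=> x _; rewrite /= -EFinD lee_fin -lerBlDr ler_norm.
have h2 : ((b * vol n)%:E <= \int[mu]_(x in cell n z) (`|h x - b|)%:E + (mean h n z * vol n)%:E)%E.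
  rewrite (meanK hd mh h0 ht) -cb -ge0_integralD//; last by move=> x _; rewrite lee_fin.
  apply: ge0_le_integral => //.
  - by apply: emeasurable_funD.
  - by move=> x _; rewrite /= -EFinD lee_fin -lerBlDr distrC ler_norm.
have v0 := vol_gt0 (R := R) n.
move: D0 h1 h2; case: (integral _ _ _) => [r| |] //; last by move=> _ _ _; rewrite leey.
rewrite -!EFinD !lee_fin -[X in `|_| * X](gtr0_norm v0) -normrM mulrBl => r0 h1 h2.
by rewrite ler_norml; apply/andP; split; lra.
Qed.

Lemma mean_deviation_powR (p b : R) n z : 1 <= p -> 0 <= b ->
  ((`|mean h n z - b| `^ p * vol n)%:E <= \int[mu]_(x in cell n z) (`|h x - b| `^ p)%:E)%E.
Proof.
move=> p1 b0; apply: jensen_powR => //.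
- exact/ltW/vol_gt0.
- exact: cell_volume.
- apply: measurableT_comp => //.
  by apply: measurable_funB => //; exact: measurable_funTS.
- exact: mean_deviation.
Qed.

End mean_deviation.

Section gagliardo.
Context {R : realType} {d : nat}.
Hypothesis hd : (0 < d)%N.
Local Notation V := 'rV[R]_d.
Local Notation mu := (@lebesgue_rV R d).
Local Notation index := {ffun 'I_d -> int}.
Implicit Types (n : int) (z : index) (x y : V).
Variables (s p : R).
Hypotheses (p1 : 1 <= p) (s0 : 0 <= s).

Definition gagliardo_density (u : V -> R) y : \bar R :=
  (\int[mu]_x (`|u x - u y| `^ p / enorm (x - y) `^ (d%:R + s * p))%:E)%E.

Lemma measurable_diff_powR (u : V -> R) : measurable_fun setT u ->
  measurable_fun setT (fun xy : V * V => `|u xy.1 - u xy.2| `^ p).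
Proof.
move=> mu_; apply: (measurableT_comp (measurable_powR _)).
apply: measurableT_comp => //.
by apply: measurable_funB; apply: measurableT_comp.
Qed.

Lemma measurable_gagliardo_density (u : V -> R) : measurable_fun setT u ->
  measurable_fun setT (gagliardo_density u).
Proof.
move=> mu_; apply: (measurable_inner_integral _ (measurable_diff_powR mu_)).
by move=> xy; exact: powR_ge0.
Qed.

Lemma gagliardo_density_ge0 (u : V -> R) y : (0 <= gagliardo_density u y)%E.
Proof. by apply: integral_ge0 => x _; rewrite lee_fin mulr_ge0 ?invr_ge0 ?powR_ge0. Qed.

Lemma rad_vol n : rad d n `^ d%:R = vol n :> R.
Proof.
rewrite /rad -powRrM mulNr divfK ?pnatr_eq0 -?lt0n//.
by rewrite -[RHS]powR_intmul// intrN.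
Qed.

(** Jensen's inequality is applied twice: over the right child for fixed [y], then over the left
    child in [y], the kernel being bounded below through the diameter of the parent. The [4] is the
    square of the volume ratio of parent and child, and [rad^d = vol] absorbs one volume. *)
Lemma gagliardo_oscillation (t : R) (h : V -> R) : measurable_fun setT h ->
  (forall x, 0 <= h x) -> (forall x, h x <= t) ->
  oscillation_bound (4 * (2 * d%:R) `^ (d%:R + s * p)) s p h (gagliardo_density h).
Proof.
move=> mh h0 ht n z.
have p0 : 0 < p by exact: lt_le_trans ltr01 p1.
set L := child n z false; set Rr := child n z true.
have LQ : cell (n + 1) L `<=` (cell n z : set V) by rewrite (cell_child hd n z); exact: subsetUl.
have RQ : cell (n + 1) Rr `<=` (cell n z : set V) by rewrite (cell_child hd n z); exact: subsetUr.
pose M := (2 * d%:R * rad d n) `^ (d%:R + s * p) : R.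
have rn := rad_gt0 (R := R) (d := d) n.
have dp : (0 : R) < d%:R by rewrite ltr0n.
have e0 : 0 < d%:R + s * p by rewrite ltr_pwDl// mulr_ge0// ltW.
have M0 : 0 < M by rewrite powR_gt0// !mulr_gt0.
have inner y : cell (n + 1) L y ->
  ((`|mean h (n + 1) Rr - h y| `^ p * vol (n + 1))%:E <= M%:E * gagliardo_density h y)%E.
  move=> yL; apply: le_trans (mean_deviation_powR hd mh h0 ht _ _ p1 (h0 y)) _.
  rewrite /gagliardo_density -ge0_integralZl//; last 3 first.
  - exact: (measurable_fun_pair1 y (measurable_kernel_ratio _ (measurable_diff_powR mh))).
  - by move=> x _; rewrite lee_fin mulr_ge0 ?invr_ge0 ?powR_ge0.
  - by rewrite lee_fin ltW.
  apply: (@le_trans _ _ (\int[mu]_(x in cell (n + 1) Rr) (M%:E * (`|h x - h y| `^ p / enorm (x - y) `^ (d%:R + s * p))%:E))%E).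
    apply: ge0_le_integral => //.
    - apply/measurable_funTS/measurable_EFinP.
      exact: (measurable_fun_pair1 y (measurable_diff_powR mh)).
    - apply/measurable_funTS/measurable_funeM.
      exact: (measurable_fun_pair1 y (measurable_kernel_ratio _ (measurable_diff_powR mh))).
    - move=> x xR; rewrite -EFinM lee_fin.
      have [xy|xy] := eqVneq (enorm (x - y)) 0.
        have -> : x = y.
          apply/rowP => i; apply/eqP; rewrite -subr_eq0.
          have s0' : \sum_i (x - y) ord0 i ^+ 2 == 0.
            rewrite eq_le sumr_ge0 ?andbT; last by move=> j _; rewrite sqr_ge0.
            by rewrite -sqrtr_eq0; apply/eqP.
          move: s0'; rewrite psumr_eq0; last by move=> j _; rewrite sqr_ge0.
          by move=> /allP/(_ i (mem_index_enum _)); rewrite /= sqrf_eq0 !mxE.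
        by rewrite subrr normr0 powR0 ?gt_eqF// mul0r mulr0.
      have xy0 : 0 < enorm (x - y) by rewrite lt_neqAle eq_sym xy enorm_ge0.
      rewrite mulrCA ler_peMr ?powR_ge0// ler_pdivlMr ?powR_gt0// mul1r.
      rewrite ge0_ler_powR ?nnegrE ?(ltW e0) ?enorm_ge0//.
        by rewrite mulr_ge0// ltW.
      by apply: (cell_diam hd (RQ _ xR) (LQ _ yL)).
  apply: ge0_subset_integral => //.
    apply: measurable_funeM.
    exact: (measurable_fun_pair1 y (measurable_kernel_ratio _ (measurable_diff_powR mh))).
  by move=> x _; rewrite mule_ge0 ?lee_fin ?(ltW M0)// mulr_ge0 ?invr_ge0 ?powR_ge0.
have v1 := vol_gt0 (R := R) (n + 1).
have mg := measurable_gagliardo_density mh.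
have g0 := gagliardo_density_ge0 h.
have outer : ((`|mean h (n + 1) L - mean h (n + 1) Rr| `^ p * vol (n + 1) * vol (n + 1))%:E <=
    M%:E * \int[mu]_(y in cell n z) gagliardo_density h y)%E.
  apply: (@le_trans _ _ ((vol (n + 1))%:E * \int[mu]_(y in cell (n + 1) L) (`|h y - mean h (n + 1) Rr| `^ p)%:E)%E).
    rewrite mulrC EFinM; apply: lee_wpmul2l; first by rewrite lee_fin ltW.
    apply: (mean_deviation_powR hd mh h0 ht) => //; exact: mean_ge0.
  have mdev : measurable_fun setT (fun y => (`|h y - mean h (n + 1) Rr| `^ p)%:E).
    apply/measurable_EFinP/(measurableT_comp (measurable_powR _)).
    by apply: measurableT_comp => //; apply: measurable_funB.
  rewrite -ge0_integralZl//; last 2 first.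
  - exact: measurable_funTS.
  - by rewrite lee_fin ltW.
  apply: (@le_trans _ _ (\int[mu]_(y in cell (n + 1) L) (M%:E * gagliardo_density h y))%E).
    apply: ge0_le_integral => //.
    - by move=> x _; rewrite mule_ge0 ?lee_fin ?powR_ge0// ltW.
    - exact/measurable_funeM/measurable_funTS.
    - exact/measurable_funeM/measurable_funTS.
    - move=> y yL; rewrite -EFinM mulrC distrC; exact: inner.
  rewrite -[leRHS]ge0_integralZl//; last 2 first.
  - exact: measurable_funTS.
  - by rewrite lee_fin ltW.
  apply: ge0_subset_integral => //.
    exact/measurable_funeM/measurable_funTS.
  by move=> x _; rewrite mule_ge0// lee_fin ltW.
have vn := vol_gt0 (R := R) n.
have -> : ((`|mean h (n + 1) L - mean h (n + 1) Rr| `^ p * vol n)%:E =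
   (4 / vol n)%:E * (`|mean h (n + 1) L - mean h (n + 1) Rr| `^ p * vol (n + 1) * vol (n + 1))%:E)%E.
  by rewrite -EFinM (volS n); congr EFin; field; rewrite gt_eqF.
have -> : 4 * (2 * d%:R) `^ (d%:R + s * p) * rad d n `^ (s * p) = 4 / vol n * M.
  rewrite /M (powRM (d%:R + s * p) _ (ltW rn)) ?mulr_ge0//.
  rewrite (powRD (x := rad d n)) ?(gt_eqF rn) ?implybT// rad_vol.
  by field; rewrite gt_eqF.
rewrite (EFinM (4 / vol n) M) -muleA; apply: lee_wpmul2l => //.
by rewrite lee_fin divr_ge0// ltW.
Qed.

Lemma sum_gagliardo_trunc (g : V -> R) (M n : nat) : measurable_fun setT g ->
  (\sum_(i < n) \int[mu]_y gagliardo_density (fun x => trunc (level M i) `|g x|) y <=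
   \int[mu]_y gagliardo_density g y)%E.
Proof.
move=> mg.
have mT i : measurable_fun setT (fun x => trunc (level M i) `|g x|).
  by apply: measurableT_comp; [exact: measurable_trunc|exact: measurableT_comp].
have mK (u : V -> R) y : measurable_fun setT u ->
    measurable_fun setT (fun x => (`|u x - u y| `^ p / enorm (x - y) `^ (d%:R + s * p))%:E).
  by move=> mu_; exact: (measurable_fun_pair1 y (measurable_kernel_ratio _ (measurable_diff_powR mu_))).
rewrite -ge0_integral_sum//; last 2 first.
- by move=> i; exact: measurable_gagliardo_density.
- by move=> i y _; exact: gagliardo_density_ge0.
apply: ge0_le_integral => //.
- by move=> y _; apply: sume_ge0 => i _; exact: gagliardo_density_ge0.
- by apply: emeasurable_sum => i; exact: measurable_gagliardo_density.
- exact: measurable_gagliardo_density.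
move=> y _; rewrite /gagliardo_density -ge0_integral_sum//; last 2 first.
- by move=> i; exact: (mK (fun x => trunc (level M i) `|g x|)).
- by move=> i x _; rewrite lee_fin mulr_ge0 ?invr_ge0 ?powR_ge0.
apply: ge0_le_integral => //.
- by move=> x _; apply: sume_ge0 => i _; rewrite lee_fin mulr_ge0 ?invr_ge0 ?powR_ge0.
- by apply: emeasurable_sum => i; exact: (mK (fun x => trunc (level M i) `|g x|)).
- exact: mK.
move=> x _; rewrite sumEFin lee_fin -mulr_suml.
apply: ler_wpM2r; first by rewrite invr_ge0 powR_ge0.
apply: le_trans (sum_trunc_powR M n _ _ p1) _.
rewrite ge0_ler_powR ?nnegrE//; first exact: le_trans ler01 p1.
exact: ler_dist_dist.
Qed.

End gagliardo.

(** * Weak derivatives and increments along lines *)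

Section smooth_line.
Context {R : realType}.
Implicit Types (f g : R -> R) (x y : R).

(** Finite order of differentiability by recursion on an existing derivative, so that closure under
    sums, products and affine changes of variable is a plain induction. *)
Fixpoint ndiff (n : nat) f : Prop := match n with
  | 0%N => True
  | n'.+1 => exists2 f', (forall x, is_derive x 1 f (f' x)) & ndiff n' f'
  end.

Definition smooth1 f := forall n, ndiff n f.

Lemma ndiff_le n m f : (m <= n)%N -> ndiff n f -> ndiff m f.
Proof.
elim: n m f => [|n IH] [|m] f //= mn [f' ff' nf'].
by exists f' => //; exact: IH nf'.
Qed.

Lemma ndiffD n f g : ndiff n f -> ndiff n g -> ndiff n (f \+ g).
Proof.
elim: n f g => [//|n IH] f g /= [f' ff' nf'] [g' gg' ng'].
exists (f' \+ g'); last exact: IH.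
by move=> x; have := ff' x; have := gg' x => ? ?; exact: is_deriveD.
Qed.

Lemma ndiffZ n (k : R) f : ndiff n f -> ndiff n (fun x => k * f x).
Proof.
elim: n f => [//|n IH] f /= [f' ff' nf'].
exists (fun x => k * f' x); last exact: IH.
by move=> x; have := ff' x => ?; exact: is_deriveZ.
Qed.

Lemma ndiffM n f g : ndiff n f -> ndiff n g -> ndiff n (f \* g).
Proof.
elim: n f g => [//|n IH] f g nf ng.
have fn : ndiff n f by exact: ndiff_le nf.
have gn : ndiff n g by exact: ndiff_le ng.
move: nf ng => /= [f' ff' nf'] [g' gg' ng'].
exists ((f \* g') \+ (g \* f')); last by apply: ndiffD; exact: IH.
by move=> x; have := ff' x; have := gg' x => ? ?; exact: is_deriveM.
Qed.

Lemma ndiff_affine n (a b : R) f : ndiff n f -> ndiff n (fun x => f (a * x + b)).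
Proof.
elim: n f => [//|n IH] f /= [f' ff' nf'].
exists (fun x => a * f' (a * x + b)); last by apply: ndiffZ; exact: IH.
move=> x; have := ff' (a * x + b) => df.
have da : is_derive x 1 (fun x => a * x + b) a.
  have d1 : is_derive x 1 (fun x => a * x) a.
    have := @is_deriveZ R R R id a x 1 1 (is_derive_id x 1).
    by rewrite /GRing.scale /= mulr1.
  have := @is_deriveD R R R (fun x => a * x) (cst b) x 1 a 0 d1 (is_derive_cst b x 1).
  by rewrite addr0.
have := @is_derive1_comp R f (fun x => a * x + b) x _ _ df da.
by rewrite mulrC; apply.
Qed.

(* The factors [x^-k] make the family closed under derivation. *)
Definition flat_exp (k : nat) x : R := if 0 < x then x^-1 ^+ k * expR (- x^-1) else 0.

Lemma flat_exp_ge0 k x : 0 <= flat_exp k x.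
Proof. by rewrite /flat_exp; case: ltP => // x0; rewrite mulr_ge0 ?expR_ge0// exprn_ge0// invr_ge0 ltW. Qed.

(** With [y = x^-1], this is [y^(k+1) <= (k+1)! * exp y]. It provides the derivative at [0], where
    the difference quotient of [flat_exp k] is [flat_exp k.+1]. *)
Lemma flat_exp_le k x : 0 < x -> flat_exp k x <= (k.+1)`!%:R * x.
Proof.
move=> x0; rewrite /flat_exp x0 expRN.
have y0 : 0 < x^-1 by rewrite invr_gt0.
rewrite ler_pdivrMr ?expR_gt0// -mulrA -ler_pdivrMl ?ltr0n ?fact_gt0//.
rewrite -(ler_pM2l y0) [leRHS]mulKf ?gt_eqF// mulrCA -exprS mulrC.
by apply: le_trans (expR_ge1Dxn k (ltW y0)); rewrite lerDr.
Qed.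

Lemma is_derive_flat_exp k x :
  is_derive x 1 (flat_exp k) (- k%:R * flat_exp k.+1 x + flat_exp k.+2 x).
Proof.
have [x0|x0|->] := ltgtP x 0.
- have -> : - k%:R * flat_exp k.+1 x + flat_exp k.+2 x = 0.
    by rewrite /flat_exp ltNge (ltW x0) /= mulr0 addr0.
  apply: (@near_eq_is_derive _ _ _ (cst 0)).
  near=> y; rewrite /flat_exp ltNge (_ : y <= 0)//.
  by apply: ltW; near: y; exact: lt_nbhsl.
- have -> : - k%:R * flat_exp k.+1 x + flat_exp k.+2 x =
    x^-1 ^+ k * (expR (- x^-1) * (x^-2)) + expR (- x^-1) * (k%:R * x^-1 ^+ k.-1 * (- x^-2)).
    rewrite /flat_exp x0; case: k => [|k]; rewrite !(exprS, expr0, expr2); field; by rewrite gt_eqF.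
  apply: (@near_eq_is_derive _ _ _ ((fun y => y^-1 ^+ k) \* (fun y => expR (- y^-1)))).
    near=> y; rewrite /flat_exp (_ : 0 < y)//.
    by near: y; exact: lt_nbhsr.
  have d1 : is_derive x 1 (fun y : R => y^-1) (- x^-2).
    by apply: is_derive_eq; [apply: is_deriveV; rewrite gt_eqF|rewrite /GRing.scale /= mulr1].
  have d2 : is_derive x 1 (fun y : R => y^-1 ^+ k) (k%:R * x^-1 ^+ k.-1 * (- x^-2)).
    have := @is_deriveX R R (fun y => y^-1) k x 1 _ d1.
    by rewrite exprfctE.
  have d3 : is_derive x 1 (fun y : R => expR (- y^-1)) (expR (- x^-1) * x^-2).
    have dn : is_derive x 1 (fun y : R => - y^-1) (x^-2).
      have := @is_deriveN R R R (fun y => y^-1) x 1 _ d1.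
      by rewrite opprK.
    exact: (@is_derive1_comp R expR (fun y => - y^-1)).
  exact: is_deriveM.
- have -> : - k%:R * flat_exp k.+1 0 + flat_exp k.+2 0 = 0.
    by rewrite /flat_exp ltxx mulr0 addr0.
  have cv : (fun h => h^-1 *: ((flat_exp k \o shift 0) (h *: 1) - flat_exp k 0)) @ 0^' --> (0 : R).
    apply/cvgrPdist_le => e e0; near=> h.
    have h0 : h != 0 by near: h; exact: nbhs_dnbhs_neq.
    rewrite sub0r normrN /GRing.scale /= addr0 mulr1 {2}/flat_exp ltxx subr0.
    have [hp|hn] := ltP 0 h; last first.
      by rewrite /flat_exp ltNge hn /= mulr0 normr0 ltW.
    have -> : h^-1 * flat_exp k h = flat_exp k.+1 h.
      by rewrite /flat_exp hp mulrA -exprS.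
    rewrite ger0_norm ?flat_exp_ge0//; apply: le_trans (flat_exp_le _ hp) _.
    rewrite -ler_pdivlMl ?ltr0n ?fact_gt0// -[h]gtr0_norm//.
    near: h; apply: dnbhs0_le; rewrite mulr_gt0 ?invr_gt0 ?ltr0n ?fact_gt0//.
  by apply: DeriveDef; [apply/cvg_ex; exists 0|exact: cvg_lim cv].
Unshelve. all: by end_near. Qed.

Lemma smooth_flat_exp k : smooth1 (flat_exp k).
Proof.
move=> n; elim: n k => [//|n IH] k /=.
exists (fun x => - k%:R * flat_exp k.+1 x + flat_exp k.+2 x).
  by move=> x; exact: is_derive_flat_exp.
by apply: ndiffD => //; exact: ndiffZ.
Qed.

Lemma smooth1_derive f f' : smooth1 f -> (forall x, is_derive x 1 f (f' x)) -> smooth1 f'.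
Proof.
move=> sf ff' n; have [g fg ng] := sf n.+1.
suff -> : f' = g by [].
by apply/funext => x; have [_ <-] := ff' x; have [_ <-] := fg x.
Qed.

Lemma smooth1_continuous f : smooth1 f -> continuous f.
Proof.
move=> sf x; have [f' ff' _] := sf 1%N.
by have [df _] := ff' x; apply: differentiable_continuous; apply/derivable1_diffP.
Qed.

Lemma smooth1_antiderivative f g : smooth1 f -> (forall x, is_derive x 1 g (f x)) -> smooth1 g.
Proof. by move=> sf gf [|n] //=; exists f. Qed.

(** With [N = n.+1], the left factor starts at [a - 1/N] and has argument [N] at [a], while the
    right one vanishes from [b] on. Hence the pointwise limit is the indicator of the half-open
    interval [[a, b)], exactly as for cells, and all supports lie in [[a - 1, b]]. *)
Definition bump (a b : R) (n : nat) x : R :=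
  flat_exp 0 (n.+1%:R ^+ 2 * (x - a) + n.+1%:R) * flat_exp 0 (n.+1%:R * (b - x)).

Lemma smooth_bump a b n : smooth1 (bump a b n).
Proof.
move=> m; apply: ndiffM.
- have -> : (fun x => flat_exp 0 (n.+1%:R ^+ 2 * (x - a) + n.+1%:R)) =
    (fun x => flat_exp 0 (n.+1%:R ^+ 2 * x + (n.+1%:R - n.+1%:R ^+ 2 * a))).
    by apply/funext => x; congr flat_exp; ring.
  by apply: ndiff_affine; exact: smooth_flat_exp.
- have -> : (fun x => flat_exp 0 (n.+1%:R * (b - x))) =
    (fun x => flat_exp 0 (- n.+1%:R * x + n.+1%:R * b)).
    by apply/funext => x; congr flat_exp; ring.
  by apply: ndiff_affine; exact: smooth_flat_exp.
Qed.

Lemma flat_exp0_le1 x : flat_exp 0 x <= 1.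
Proof.
rewrite /flat_exp; case: ltP => // x0; rewrite expr0 mul1r -expR0 ler_expR.
by rewrite oppr_le0 invr_ge0 ltW.
Qed.

Lemma bump_ge0 a b n x : 0 <= bump a b n x.
Proof. by rewrite mulr_ge0 ?flat_exp_ge0. Qed.

Lemma bump_le1 a b n x : bump a b n x <= 1.
Proof. by rewrite mulr_ile1 ?flat_exp_ge0 ?flat_exp0_le1. Qed.

Lemma bump_eq0 a b n x : (x <= a - 1) || (b <= x) -> bump a b n x = 0.
Proof.
have n1 : 1 <= n.+1%:R :> R by rewrite ler1n.
rewrite /bump /flat_exp => /orP[xa|bx].
  rewrite ltNge (_ : _ <= 0) ?mul0r//; nra.
by rewrite [X in _ * (if X then _ else _)]ltNge (_ : _ <= 0) ?mulr0//; nra.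
Qed.

Lemma flat_exp0_ge x : 0 < x -> 1 - x^-1 <= flat_exp 0 x.
Proof. by move=> x0; rewrite /flat_exp x0 expr0 mul1r; exact: expR_ge1Dx. Qed.

Lemma bump_cvg a b x : bump a b n x @[n --> \oo] --> ((a <= x < b)%R%:R : R).
Proof.
have [bx|xb] := leP b x.
  rewrite andbF; under eq_fun do rewrite bump_eq0 ?bx ?orbT//.
  exact: cvg_cst.
have [ax|xa] := leP a x.
  have bx0 : 0 < b - x by rewrite subr_gt0.
  have k0 : 0 < 1 + (b - x)^-1 by rewrite addr_gt0// invr_gt0.
  apply/cvgrPdist_le => e e0; near=> n.
  have n0 : 0 < n.+1%:R :> R by [].
  have hn : n.+1%:R^-1 < e / (1 + (b - x)^-1).
    by near: n; exact: (near_infty_natSinv_lt (PosNum (divr_gt0 e0 k0))).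
  rewrite ltr_pdivlMr// in hn.
  rewrite /= ger0_norm ?subr_ge0 ?bump_le1//.
  have u0 : 0 < n.+1%:R ^+ 2 * (x - a) + n.+1%:R.
    by rewrite ltr_wpDl// mulr_ge0 ?exprn_ge0 ?subr_ge0.
  have v0 : 0 < n.+1%:R * (b - x) by rewrite mulr_gt0.
  have h1 := flat_exp0_ge u0; have h2 := flat_exp0_ge v0.
  have hu : (n.+1%:R ^+ 2 * (x - a) + n.+1%:R)^-1 <= n.+1%:R^-1.
    by rewrite lef_pV2 ?posrE// lerDr mulr_ge0 ?exprn_ge0 ?subr_ge0.
  rewrite invfM in h2.
  have g1 := flat_exp0_le1 (n.+1%:R ^+ 2 * (x - a) + n.+1%:R).
  have g2 := flat_exp0_le1 (n.+1%:R * (b - x)).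
  rewrite /bump.
  move: (flat_exp 0 (n.+1%:R ^+ 2 * (x - a) + n.+1%:R)) h1 g1 => U h1 g1.
  move: (flat_exp 0 (n.+1%:R * (b - x))) h2 g2 => W h2 g2.
  have : (1 - U) * (1 - W) >= 0 by rewrite mulr_ge0 ?subr_ge0.
  have w0 : 0 <= (1 - U) by rewrite subr_ge0.
  move: hn hu h1 h2; rewrite mulrDr mulr1 => hn hu h1 h2 h3.
  have E : 1 - U * W = (1 - U) + (1 - W) - (1 - U) * (1 - W) by ring.
  apply: le_trans (ltW hn); rewrite E.
  move: hu h1 h2 h3 {hn E}.
  move: (n.+1%:R^-1 / (b - x)) (n.+1%:R ^+ 2 * (x - a) + n.+1%:R)^-1 (n.+1%:R^-1) => A1 A2 A3; lra.
have ax0 : 0 < a - x by rewrite subr_gt0.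
apply/cvgrPdist_le => e e0; near=> n.
have n0 : 0 < n.+1%:R :> R by [].
have hn : n.+1%:R^-1 < a - x.
  by near: n; exact: (near_infty_natSinv_lt (PosNum ax0)).
suff -> : bump a b n x = 0 by rewrite subrr normr0 ltW.
rewrite /bump {1}/flat_exp ltNge (_ : _ <= 0) ?mul0r//.
rewrite -[X in X < _]mul1r ltr_pdivrMr// in hn.
nra.
Unshelve. all: by end_near. Qed.

End smooth_line.

(** * Test functions that are products of functions of one variable *)

Section product_test_functions.
Context {R : realType} {d : nat}.
Local Notation V := 'rV[R]_d.
Implicit Types (f : 'I_d -> R -> R) (z : V).

Definition prodfun f z : R := \prod_j f j (z ord0 j).

Definition upd f (i : 'I_d) (g : R -> R) (j : 'I_d) := if j == i then g else f j.

Lemma prodfun_upd f i g z :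
  prodfun (upd f i g) z = g (z ord0 i) * \prod_(j | j != i) f j (z ord0 j).
Proof.
rewrite /prodfun (bigD1 i) //= /upd eqxx; congr (_ * _).
by apply: eq_bigr => j ji; rewrite (negbTE ji).
Qed.

Lemma prodfunD1 f i z :
  prodfun f z = f i (z ord0 i) * \prod_(j | j != i) f j (z ord0 j).
Proof. by rewrite /prodfun (bigD1 i). Qed.

Lemma is_derive_prodfun f (i : 'I_d) (g : R -> R) z : (forall x : R, is_derive x 1 (f i) (g x)) ->
  is_derive z (basis_vec i) (prodfun f) (prodfun (upd f i g) z).
Proof.
move=> dg; have [dfi dgi] := dg (z ord0 i).
pose C := \prod_(j | j != i) f j (z ord0 j).
have cv : (fun h => h^-1 *: ((prodfun f \o shift z) (h *: basis_vec i) - prodfun f z)) @ 0^'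
    --> prodfun (upd f i g) z.
  have -> : (fun h => h^-1 *: ((prodfun f \o shift z) (h *: basis_vec i) - prodfun f z)) =
    (fun h => (h^-1 *: ((f i \o shift (z ord0 i)) (h *: 1) - f i (z ord0 i))) * C).
    apply/funext => h; rewrite /= !(prodfunD1 f i) !mxE !eqxx /=.
    have -> : \prod_(j | j != i) f j ((h *: basis_vec i + z) ord0 j) = C.
      apply: eq_bigr => j ji; rewrite !mxE eqxx /= (negbTE ji).
      by rewrite /GRing.scale /= mulr0 add0r.
    by rewrite -/C -mulrBl scalerAl.
  rewrite prodfun_upd -/C -dgi; apply: cvgMl; exact: dfi.
by apply: DeriveDef; [apply/cvg_ex; exists (prodfun (upd f i g) z)|exact: cvg_lim cv].
Qed.

Lemma continuous_prodfun f : (forall j, smooth1 (f j)) -> continuous (prodfun f).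
Proof.
move=> sf; rewrite /prodfun.
have : forall s : seq 'I_d, continuous (fun z : V => \prod_(j <- s) f j (z ord0 j)).
  elim=> [|j s IH] z.
    rewrite (_ : (fun _ => _) = cst 1); first exact: cst_continuous.
    by apply/funext => y; rewrite big_nil.
  rewrite (_ : (fun _ => _) = (fun y : V => f j (y ord0 j)) \* (fun y : V => \prod_(j <- s) f j (y ord0 j))); last first.
    by apply/funext => y; rewrite big_cons.
  apply: continuousM; last exact: IH.
  apply: (@continuous_comp _ _ _ (fun z : V => z ord0 j) (f j)).
    exact: coord_continuous.
  exact: smooth1_continuous.
by apply.
Qed.

(** A partial derivative replaces one factor by its derivative, so iterated partial derivatives
    remain products of smooth factors. *)
Lemma smooth_prodfun f : (forall j, smooth1 (f j)) -> smooth (prodfun f).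
Proof.
move=> sf s.
suff [f' [sf' ->]] : exists f', (forall j, smooth1 (f' j)) /\ foldr (@partial R d) (prodfun f) s = prodfun f'.
  split; first exact: continuous_prodfun.
  move=> z i; have [g dg _] := sf' i 1%N.
  by have [] := is_derive_prodfun z dg.
elim: s => [|i s [f' [sf' IH]]] /=; first by exists f.
have [g dg _] := sf' i 1%N.
exists (upd f' i g); split.
  move=> j; rewrite /upd; case: eqP => // _.
  exact: smooth1_derive (sf' i) dg.
rewrite IH; apply/funext => z; rewrite /partial.
by have [_ ->] := is_derive_prodfun z dg.
Qed.

Lemma prodfun_test f (a b : 'I_d -> R) : (forall j, smooth1 (f j)) ->
  (forall j x, ~~ (a j <= x <= b j) -> f j x = 0) ->
  test_function [set: V] (prodfun f) /\
  closure [set z | prodfun f z != 0] `<=` [set z : V | forall j, `[a j, b j]%classic (z ord0 j)].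
Proof.
move=> sf f0.
have cK : compact [set z : V | forall j, `[a j, b j]%classic (z ord0 j)].
  apply: (@rV_compact R d (fun j => `[a j, b j]%classic)) => j; exact: segment_compact.
have sub : closure [set z | prodfun f z != 0] `<=` [set z : V | forall j, `[a j, b j]%classic (z ord0 j)].
  have clK : closed [set z : V | forall j, `[a j, b j]%classic (z ord0 j)].
    have -> : [set z : V | forall j, `[a j, b j]%classic (z ord0 j)] =
       \bigcap_(j in [set: 'I_d]) ((fun z : V => z ord0 j) @^-1` `[a j, b j]%classic).
      by apply/seteqP; split => [z zj j _|z zj j]; [exact: zj|exact: (zj j I)].
    apply: closed_bigI => j _; apply: closed_comp; last exact: interval_closed.
    by move=> z _; exact: coord_continuous.
  have := (closure_id _).1 clK => ->; apply: closureS => z /= nz j.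
  rewrite in_itv /=; apply/negPn/negP => h; move/negP: nz; apply.
  by rewrite (prodfunD1 f j) f0// mul0r.
split=> //; split=> //; first exact: smooth_prodfun.
by apply: subclosed_compact sub => //; exact: closed_closure.
Qed.

End product_test_functions.

Section antiderivative.
Context {R : realType}.

Lemma smooth1_primitive (f : R -> R) (a : R) : smooth1 f -> (forall x, x <= a -> f x = 0) ->
  exists X, forall x : R, is_derive x 1 X (f x).
Proof.
move=> sf fa; have cf := smooth1_continuous sf.
pose X y := (\int[lebesgue_measure]_(t in [set` `[a - 1, y]]) f t)%R.
exists X => x; have [xa|ax] := ltP x a.
  rewrite fa ?ltW//; apply: (@near_eq_is_derive _ _ _ (cst 0)).
  near=> y; rewrite /X /Rintegral /= integral0_eq// => t; rewrite /= in_itv /= => /andP[_ ty].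
  by rewrite fa// (le_trans ty)// ltW//; near: y; exact: lt_nbhsl.
have x1 : x < x + 1 by rewrite ltrDl.
have ix : lebesgue_measure.-integrable `[a - 1, x + 1] (EFin \o f).
  apply: continuous_compact_integrable; first exact: segment_compact.
  exact: continuous_subspaceT.
have a1 : a - 1 < x by rewrite ltrBlDr (le_lt_trans ax)// ltrDl.
have [dX XE] := continuous_FTC1_closed x1 ix a1 (cf x).
apply: DeriveDef; first exact: dX.
by rewrite -derive1E; exact: XE.
Unshelve. all: by end_near. Qed.

End antiderivative.

Section integrable_bounded_product.
Context {disp} {T : measurableType disp} {R : realType} (mu : {measure set T -> \bar R}).

Lemma integrable_bounded_mul (D : set T) (f g : T -> R) (M : R) : measurable D ->
  measurable_fun D f -> (forall x, `|f x| <= M) ->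
  mu.-integrable D (EFin \o g) -> mu.-integrable D (fun x => (f x * g x)%:E).
Proof.
move=> mD mf fM ig; have mg : measurable_fun D g by move/integrableP : ig => [/measurable_EFinP].
apply: (@le_integrable _ _ _ mu D mD _ (fun x => M%:E * (EFin \o g) x)%E).
- by apply/measurable_EFinP; exact: measurable_funM.
- move=> x _; rewrite /= normrM lee_fin normrM; apply: ler_wpM2r => //.
  exact: le_trans (fM x) (ler_norm _).
- exact: integrableZl.
Qed.

End integrable_bounded_product.

(** * Integrals along segments in a coordinate direction *)

Section directional_integral.
Context {R : realType} {d : nat}.
Local Notation V := 'rV[R]_d.
Local Notation mu := (@lebesgue_rV R d).
Local Notation leb := (@lebesgue_measure R).
Variable i : 'I_d.
Local Notation e := (basis_vec i : V).

Lemma measurable_move : measurable_fun setT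
  (fun xr : V * measurableTypeR R => xr.1 + xr.2 *: e).
Proof.
apply: measurable_fun_rVP => j.
rewrite (_ : _ \o _ = (fun xr : V * measurableTypeR R => rV_coord j xr.1 + xr.2 * e ord0 j)).
  apply: measurable_funD; first exact: (measurableT_comp (measurable_rV_coord j)).
  by apply: measurable_funM.
by apply/funext => xr; rewrite /rV_coord /= !mxE.
Qed.

Definition swept (tau : R) (G : V -> R) (xr : V * measurableTypeR R) : R :=
  G (xr.1 + xr.2 *: e) * \1_(`[0, tau]) xr.2.

(** The integral of [G] over the segment from [x] to [x + tau e]. [fine] gives a real value
    everywhere; for integrable [G] it is the true one for almost every [x]. *)
Definition dir_integral (tau : R) (G : V -> R) (x : V) : R :=
  fine (\int[leb]_r (swept tau G (x, r))%:E).

Lemma measurable_swept tau G : measurable_fun setT G -> measurable_fun setT (swept tau G).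
Proof.
move=> mG; apply: measurable_funM; first exact: (measurableT_comp mG measurable_move).
by apply: (measurableT_comp (measurable_indic _)).
Qed.

Lemma integral_norm_swept (tau : R) (G : V -> R) : 0 <= tau -> measurable_fun setT G ->
  (\int[leb]_r \int[mu]_x `|(swept tau G (x, r))%:E| = tau%:E * \int[mu]_x `|(G x)%:E|)%E.
Proof.
move=> t0 mG.
have mn : measurable_fun setT (fun x => `|(G x)%:E|%E) by apply/measurableT_comp/measurable_EFinP.
under eq_integral => r _.
  have -> : (\int[mu]_x `|(swept tau G (x, r))%:E| = (\1_(`[0, tau]) r)%:E * \int[mu]_x `|(G x)%:E|)%E.
    rewrite -(integral_translation (r *: e) mn) -ge0_integralZl//.
    - by apply: eq_integral => x _; rewrite /swept /= normrM (ger0_norm (x := \1_ _ _))// mulrC.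
    - exact: (measurableT_comp mn (measurable_fun_addr _)).
  over.
rewrite ge0_integralZr//.
- by rewrite integral_indic// setIT /= lebesgue_measure_itv /= lte_fin; case: ltgtP t0 => // [t0|<-] _; rewrite ?oppr0 ?adde0 ?sube0.
- exact/measurable_EFinP/measurable_indic.
- by apply: integral_ge0.
Qed.

Lemma integrable_swept (tau : R) (G : V -> R) : 0 <= tau ->
  mu.-integrable setT (EFin \o G) -> (mu \x leb)%E.-integrable setT (EFin \o swept tau G).
Proof.
move=> t0 iG; have [mG Goo] := integrableP _ _ _ iG.
have {}mG : measurable_fun setT G by exact/measurable_EFinP.
have mS : measurable_fun setT (EFin \o swept tau G).
  by apply/measurable_EFinP; exact: measurable_swept.
apply/(integrable21ltyP _ _ mS).
rewrite integral_norm_swept//.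
by rewrite lte_mul_pinfty// lee_fin.
Qed.

Lemma dir_integralE (tau : R) (G : V -> R) : 0 <= tau ->
  mu.-integrable setT (EFin \o G) ->
  {ae mu, forall x, (dir_integral tau G x)%:E = (\int[leb]_r (swept tau G (x, r))%:E)%E}.
Proof.
move=> t0 iG; have := integrable_fubini_F (integrable_swept t0 iG) => iF.
apply: filterS (integrable_ae measurableT iF) => x /(_ I) xf.
by rewrite /dir_integral fineK.
Qed.

Lemma integrable_dir_integral (tau : R) (G : V -> R) : 0 <= tau ->
  mu.-integrable setT (EFin \o G) -> mu.-integrable setT (EFin \o dir_integral tau G).
Proof.
move=> t0 iG; have := integrable_fubini_F (integrable_swept t0 iG) => iF.
have mF := measurable_int _ iF.
apply: (le_integrable measurableT _ _ iF).
- apply/measurable_EFinP; apply: (measurableT_comp (fine_measurable measurableT)); exact: mF.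
- move=> x _; rewrite /= /dir_integral /fubini_F.
  by case: (integral _ _ _) => [r| |] //=; rewrite leey.
Qed.

(* Fubini and translation move the averaging over the segment from [G] to the
   weight. *)
Lemma integral_dir_integral (tau M : R) (G Phi w : V -> R) : 0 <= tau ->
  mu.-integrable setT (EFin \o G) -> measurable_fun setT Phi -> (forall x, `|Phi x| <= M) ->
  (forall z, (w z)%:E = \int[leb]_(r in `[0%R, tau]) (Phi (z - r *: e)%R)%:E)%E ->
  (\int[mu]_x (Phi x * dir_integral tau G x)%:E = \int[mu]_x (G x * w x)%:E)%E.
Proof.
move=> t0 iG mPhi PhiM wE.
have mG : measurable_fun setT G by move/integrableP : iG => [/measurable_EFinP].
have iS := integrable_swept t0 iG.
have mS := measurable_swept tau mG.
pose H1 (xr : V * measurableTypeR R) : R := Phi xr.1 * swept tau G xr.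
pose H2 (xr : V * measurableTypeR R) : R := (Phi (xr.1 - xr.2 *: e) * \1_(`[0, tau]) xr.2) * G xr.1.
have mPhi1 : measurable_fun setT (fun xr : V * measurableTypeR R => Phi xr.1) by apply: measurableT_comp.
have iH1 : (mu \x leb)%E.-integrable setT (EFin \o H1).
  by apply: (integrable_bounded_mul (M := M)).
have mind : measurable_fun setT (fun xr : V * measurableTypeR R => \1_(`[0, tau]) xr.2 : R).
  by apply: (measurableT_comp (measurable_indic _)).
have mPhi2 : measurable_fun setT (fun xr : V * measurableTypeR R => Phi (xr.1 - xr.2 *: e)).
  have : measurable_fun setT (fun xr : V * measurableTypeR R => xr.1 - xr.2 *: e).
    apply: measurable_fun_rVP => j.
    rewrite (_ : _ \o _ = (fun xr : V * measurableTypeR R => rV_coord j xr.1 - xr.2 * e ord0 j)).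
      apply: measurable_funB; first exact: (measurableT_comp (measurable_rV_coord j)).
      by apply: measurable_funM.
    by apply/funext => xr; rewrite /rV_coord /= !mxE.
  by move=> h; exact: (measurableT_comp mPhi h).
have M0 : 0 <= M by apply: le_trans (PhiM 0).
have iH2 : (mu \x leb)%E.-integrable setT (EFin \o H2).
  pose Q (xr : V * measurableTypeR R) : R := G xr.1 * \1_(`[0, tau]) xr.2.
  have : (mu \x leb)%E.-integrable setT (fun xr => (Phi (xr.1 - xr.2 *: e) * Q xr)%:E).
    apply: (integrable_bounded_mul (M := M)) => //.
    have mg : measurable_fun setT Q.
      by apply: measurable_funM => //; apply: measurableT_comp.
    have mg' : measurable_fun setT (EFin \o Q) by exact/measurable_EFinP.
    apply/(integrable21ltyP _ _ mg').
    have [_ Goo] := integrableP _ _ _ iG.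
    have -> : (\int[leb]_r \int[mu]_x `|(EFin \o Q) (x, r)| = tau%:E * \int[mu]_x `|(G x)%:E|)%E.
      rewrite -(integral_norm_swept t0 mG); apply: eq_integral => r _.
      have mn : measurable_fun setT (fun x => `|(EFin \o Q) (x, r)|%E).
        by apply: measurableT_comp => //; exact: (measurable_fun_pair1 r mg').
      by rewrite -(integral_translation (r *: e) mn).
    by rewrite lte_mul_pinfty// lee_fin.
  apply: eq_integrable => // xr _; rewrite /H2 /Q /=; congr EFin; ring.
transitivity (\int[mu]_x \int[leb]_r (H1 (x, r))%:E)%E.
  apply: ae_eq_integral => //.
  - apply/measurable_EFinP/measurable_funM => //.
    have := integrable_dir_integral t0 iG => /measurable_int /measurable_EFinP; exact.
  - exact: (measurable_int _ (integrable_fubini_F iH1)).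
  - apply: filterS2 (dir_integralE t0 iG) (ae_integrable1 iS) => x Ex ix _.
    by rewrite EFinM Ex -integralZl.
rewrite (Fubini iH1).
transitivity (\int[leb]_r \int[mu]_x (H2 (x, r))%:E)%E.
  apply: eq_integral => r _.
  have mH2 : measurable_fun setT (fun x => (H2 (x, r))%:E).
    exact: (measurable_fun_pair1 r (measurable_int _ iH2)).
  rewrite -(integral_translation (r *: e) mH2); apply: eq_integral => x _.
  by rewrite /H1 /H2 /swept /= addrK; congr EFin; ring.
rewrite -(Fubini iH2); apply: eq_integral => z _.
have mz : measurable_fun setT (fun r : measurableTypeR R => Phi (z - r *: e)).
  exact: (measurable_fun_pair2 z mPhi2).
have iz : leb.-integrable `[0, tau] (fun r => (Phi (z - r *: e))%:E).
  have : leb.-integrable `[0, tau] (fun r => (Phi (z - r *: e) * cst 1 r)%:E).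
    apply: (integrable_bounded_mul (M := M)) => //; first exact: measurable_funTS.
    apply: (@continuous_compact_integrable R (cst 1)); first exact: segment_compact.
    by apply: continuous_subspaceT => r; exact: cst_continuous.
  by apply: eq_integrable => // r _; rewrite mulr1.
rewrite [LHS](_ : _ = \int[leb]_(r in `[0%R, tau]) ((G z)%:E * (Phi (z - r *: e)%R)%:E))%E; last first.
  rewrite [RHS]integral_mkcond; apply: eq_integral => r _.
  rewrite patchE /H2 /= indicE; case: ifPn => _; last by rewrite mulr0 mul0r.
  by rewrite mulr1 mulrC EFinM.
by rewrite integralZl// -wE.
Qed.

End directional_integral.

Section weak_directional_derivative.
Context {R : realType} {d : nat}.
Hypothesis hd : (0 < d)%N.
Local Notation V := 'rV[R]_d.
Local Notation mu := (@lebesgue_rV R d).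
Local Notation leb := (@lebesgue_measure R).
Local Notation index := {ffun 'I_d -> int}.

Definition box (a b : 'I_d -> R) : set V := [set x | forall j, `[a j, b j]%classic (x ord0 j)].

(** Restricting the supports to [K] allows a locally integrable [G] to be replaced by its
    restriction to a box, which is integrable. *)
Definition weak_formula_on (i : 'I_d) (K : set V) (g G : V -> R) :=
  forall phi, test_function [set: V] phi -> closure [set x | phi x != 0] `<=` K ->
  (\int[mu]_x (g x * partial i phi x)%:E = - \int[mu]_x (G x * phi x)%:E)%E.

(** Test the weak formula on [w], the integral of [Phi = prodfun f] over backward shifts up to
    [tau]. Its derivative is [Phi] minus its shift by [tau]; translating the shift onto [g] produces
    the increment, and [integral_dir_integral] turns the right-hand side into the segment
    integral. *)
Lemma increment_test_zero (i : 'I_d) (tau : R) (g G : V -> R) (f : 'I_d -> R -> R) (a b : 'I_d -> R) :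
  0 < tau -> mu.-integrable setT (EFin \o g) -> mu.-integrable setT (EFin \o G) ->
  (forall j, smooth1 (f j)) -> (forall j x, 0 <= f j x <= 1) ->
  (forall j x, ~~ (a j <= x <= b j) -> f j x = 0) ->
  weak_formula_on i (box a (fun j => b j + tau)) g G ->
  (\int[mu]_x (prodfun f x * (g (x + tau *: basis_vec i) - g x - dir_integral i tau G x)%R)%:E = 0)%E.
Proof.
move=> t0 ig iG sf f01 f0 W.
have mg : measurable_fun setT g by move/integrableP : ig => [/measurable_EFinP].
pose e : V := basis_vec i.
have [X dX] : exists X, forall x : R, is_derive x 1 X (f i x).
  apply: (@smooth1_primitive R (f i) (a i - 1)) => // x xa.
  by rewrite f0// negb_and -ltNge; apply/orP; left; lra.
have sX : smooth1 X by apply: smooth1_antiderivative dX.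
(* Only the factor in direction [i] is averaged, so [w] is again a product; a primitive gives both
   its smoothness and its derivative. *)
pose v s := X s - X (s - tau).
have vE s : (v s)%:E = (\int[leb]_(r in `[0%R, tau]) (f i (s - r)%R)%:E)%E.
  have dF r : is_derive r (1 : R) (fun r => - X (s - r)) (f i (s - r)).
    have ds : is_derive r (1 : R) (fun r => s - r) (-1).
      have := @is_deriveB R R R (cst s) id r 1 0 1 (is_derive_cst _ _ _) (is_derive_id _ _).
      by rewrite sub0r.
    have := @is_derive1_comp R X (fun r => s - r) r _ _ (dX (s - r)) ds => dc.
    have := @is_deriveN R R R (fun r => X (s - r)) r 1 _ dc.
    by rewrite mulrN1 opprK.
  have cF r : {for r, continuous (fun r => - X (s - r))}.
    by have [df _] := dF r; apply: differentiable_continuous; apply/derivable1_diffP.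
  rewrite (@continuous_FTC2 R (fun r => f i (s - r)) (fun r => - X (s - r)) 0 tau t0).
  - by rewrite subr0 -EFinB opprK addrC.
  - apply: continuous_subspaceT => r.
    apply: (@continuous_comp _ _ _ (fun r => s - r) (f i)).
      by apply: continuousB; [exact: cst_continuous|exact: id].
    exact: smooth1_continuous.
  - split.
    + by move=> r _; have [] := dF r.
    + by apply: cvg_at_right_filter; exact: cF.
    + by apply: cvg_at_left_filter; exact: cF.
  - by move=> r _; rewrite derive1E; have [_ ->] := dF r.
have sv : smooth1 v.
  move=> m; rewrite (_ : v = X \+ (fun s => -1 * X (1 * s + - tau))).
    apply: ndiffD; first exact: sX.
    by apply: ndiffZ; apply: (@ndiff_affine R m 1 (- tau) X); exact: sX.
  by apply/funext => s; rewrite /v /= mul1r mulN1r.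
have v0 s : ~~ (a i <= s <= b i + tau) -> v s = 0.
  move=> h; apply: EFin_inj; rewrite vE integral0_eq// => r /=; rewrite in_itv /= => /andP[r0 rt].
  rewrite f0//; apply: contra h => /andP[h1 h2]; apply/andP; split; lra.
have dv s : is_derive s (1 : R) v (f i s - f i (s - tau)).
  have ds : is_derive s (1 : R) (fun r => r - tau) 1.
    have := @is_deriveB R R R id (cst tau) s 1 1 0 (is_derive_id _ _) (is_derive_cst _ _ _).
    by rewrite subr0.
  have := @is_derive1_comp R X (fun r => r - tau) s _ _ (dX (s - tau)) ds => dc.
  have := @is_deriveB R R R X (fun r => X (r - tau)) s 1 _ _ (dX s) dc.
  by rewrite mulr1.
pose w := prodfun (upd f i v).
pose Phi := prodfun f.
have shiftE z r : Phi (z - r *: e) = f i (z ord0 i - r) * \prod_(j | j != i) f j (z ord0 j).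
  rewrite /Phi (prodfunD1 f i) !mxE !eqxx /= mulr1; congr (_ * _).
  apply: eq_bigr => j ji; rewrite !mxE eqxx /= (negbTE ji).
  by rewrite mulr0 subr0.
have Phi01 x : 0 <= Phi x <= 1.
  rewrite /Phi /prodfun; elim/big_ind : _ => [|u1 u2|j _]; rewrite ?ler01 ?lexx//.
  by move=> /andP[? ?] /andP[? ?]; rewrite mulr_ge0// mulr_ile1.
have PhiM x : `|Phi x| <= 1 by have /andP[h1 h2] := Phi01 x; rewrite ger0_norm.
have mPhi : measurable_fun setT Phi.
  rewrite /Phi /prodfun; under eq_fun do rewrite -big_enum /=.
  apply: measurable_prod => j _.
  have := continuous_measurable_fun (smooth1_continuous (sf j)) => mfj.
  exact: (measurableT_comp mfj (measurable_rV_coord j)).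
have mtr := measurable_fun_addr (tau *: e : V).
have igt : mu.-integrable setT (fun x => (g (x + tau *: e))%:E).
  apply/integrableP; split.
    by apply/measurable_EFinP; exact: (measurableT_comp mg mtr).
  have mn : measurable_fun setT (fun x => `|(g x)%:E|%E) by apply/measurableT_comp/measurable_EFinP.
  by have := integral_translation (tau *: e) mn => ->; case/integrableP : ig.
have iJ := integrable_dir_integral i (ltW t0) iG.
have i1 : mu.-integrable setT (fun x => (Phi x * g (x + tau *: e))%:E).
  exact: (integrable_bounded_mul (M := 1)).
have i2 : mu.-integrable setT (fun x => (Phi x * g x)%:E).
  exact: (integrable_bounded_mul (M := 1)).
have i3 : mu.-integrable setT (fun x => (Phi x * dir_integral i tau G x)%:E).
  exact: (integrable_bounded_mul (M := 1)).
have wE z : (w z)%:E = (\int[leb]_(r in `[0%R, tau]) (Phi (z - r *: e)%R)%:E)%E.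
  have -> : w z = \prod_(j | j != i) f j (z ord0 j) * v (z ord0 i) by rewrite /w prodfun_upd mulrC.
  rewrite EFinM vE -integralZl//.
    by apply: eq_integral => r _; rewrite shiftE mulrC EFinM.
  apply: continuous_compact_integrable; first exact: segment_compact.
  apply: continuous_subspaceT => r.
  apply: (@continuous_comp _ _ _ (fun r => z ord0 i - r) (f i)).
    by apply: continuousB; [exact: cst_continuous|exact: id].
  exact: smooth1_continuous.
have EJ := integral_dir_integral (ltW t0) iG mPhi PhiM wE.
have pw z : partial i w z = Phi z - Phi (z - tau *: e).
  have dw : is_derive z (basis_vec i) w (prodfun (upd (upd f i v) i (fun s => f i s - f i (s - tau))) z).
    by apply: is_derive_prodfun => x; rewrite /upd eqxx.
  rewrite /partial; have [_ ->] := dw.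
  rewrite prodfun_upd shiftE /Phi (prodfunD1 f i) -mulrBl; congr (_ * _).
  by apply: eq_bigr => j ji; rewrite /upd (negbTE ji).
have [tw cw] : test_function [set: V] w /\
    closure [set z | w z != 0] `<=` box a (fun j => b j + tau).
  apply: prodfun_test => [j|j x h]; rewrite /upd; case: eqP => [ji|_] //; first by rewrite v0 -?ji.
  by rewrite f0//; apply: contra h => /andP[h1 h2]; apply/andP; split => //; lra.
have := W w tw cw; rewrite -EJ.
have -> : (\int[mu]_x (g x * partial i w x)%:E = \int[mu]_x (Phi x * g x)%:E - \int[mu]_x (Phi x * g (x + tau *: e)%R)%:E)%E.
  have mgP : measurable_fun setT (fun x : V => (Phi (x - tau *: e) * g x)%:E).
    apply/measurable_EFinP/measurable_funM => //.
    exact: (measurableT_comp mPhi (measurable_fun_addr (- (tau *: e) : V))).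
  have E1 : (\int[mu]_x (Phi x * g (x + tau *: e)%R)%:E = \int[mu]_x (Phi (x - tau *: e)%R * g x)%:E)%E.
    rewrite -(integral_translation (tau *: e) mgP); apply: eq_integral => x _.
    by rewrite addrK.
  rewrite E1 -integralB_EFin//.
    apply: eq_integral => x _; rewrite pw -EFinB; congr EFin; ring.
  apply: (integrable_bounded_mul (M := 1)) => //.
  exact: (measurableT_comp mPhi (measurable_fun_addr (- (tau *: e) : V))).
have E : (\int[mu]_x (Phi x * (g (x + tau *: e)%R - g x - dir_integral i tau G x)%R)%:E =
   \int[mu]_x (Phi x * g (x + tau *: e)%R)%:E - \int[mu]_x (Phi x * g x)%:E -
   \int[mu]_x (Phi x * dir_integral i tau G x)%:E)%E.
  rewrite -integralB_EFin// -integralB_EFin//.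
    by apply: eq_integral => x _; rewrite -!EFinB; congr EFin; ring.
  rewrite (_ : _ \o _ = (fun x => (Phi x * g (x + tau *: e))%:E - (Phi x * g x)%:E)%E)//.
  exact: integrableB.
rewrite E.
have := integrable_fin_num measurableT i1; have := integrable_fin_num measurableT i2.
have := integrable_fin_num measurableT i3.
case: (integral _ _ _) => [r3| |] // _; case: (integral _ _ _) => [r2| |] // _; case: (integral _ _ _) => [r1| |] // _.
rewrite -!EFinB => -[h]; congr EFin; lra.
Qed.

End weak_directional_derivative.

(** * From test functions to increments at almost every point *)

Section vanishing.
Context {R : realType} {d : nat}.
Hypothesis hd : (0 < d)%N.
Local Notation V := 'rV[R]_d.
Local Notation mu := (@lebesgue_rV R d).
Local Notation index := {ffun 'I_d -> int}.

Definition cell_lo (n : int) (z : index) (j : 'I_d) : R := (z j)%:~R * 2 ^ (- dexp n j).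
Definition cell_hi (n : int) (z : index) (j : 'I_d) : R := (z j + 1)%:~R * 2 ^ (- dexp n j).
Definition cell_bump (n : int) (z : index) (m : nat) (j : 'I_d) := bump (cell_lo n z j) (cell_hi n z j) m.

Lemma cell_bump_cvg n z x :
  prodfun (cell_bump n z m) x @[m --> \oo] --> (\1_(cell n z) x : R).
Proof.
have -> : \1_(cell n z) x = \prod_j (cell_lo n z j <= x ord0 j < cell_hi n z j)%R%:R :> R.
  rewrite indicE; case: (boolP (x \in cell n z)) => [/set_mem/cellP xz|/negP xz].
    by rewrite big1// => j _; rewrite xz.
  have [j jx] : exists j, ~~ (cell_lo n z j <= x ord0 j < cell_hi n z j).
    apply: contrapT => /forallNP H; apply: xz; apply/mem_set/cellP => j.
    by have /negP/negPn := H j.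
  by rewrite (bigD1 j) //= (negbTE jx) mul0r.
rewrite /prodfun.
have : forall s : seq 'I_d, \prod_(j <- s) cell_bump n z m j (x ord0 j) @[m --> \oo] -->
   (\prod_(j <- s) (cell_lo n z j <= x ord0 j < cell_hi n z j)%R%:R : R).
  elim=> [|j s IH].
    rewrite big_nil (_ : (fun _ => _) = cst 1); first exact: cvg_cst.
    by apply/funext => m; rewrite big_nil.
  rewrite big_cons (_ : (fun _ => _) = (fun m => cell_bump n z m j (x ord0 j) * \prod_(j <- s) cell_bump n z m j (x ord0 j))).
    by apply: cvgM; [exact: bump_cvg|exact: IH].
  by apply/funext => m; rewrite big_cons.
by apply.
Qed.

Lemma cell_bump01 n z m j x : 0 <= cell_bump n z m j x <= 1.
Proof. by rewrite bump_ge0 bump_le1. Qed.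

Lemma prodfun_bump01 n z m x : 0 <= prodfun (cell_bump n z m) x <= 1.
Proof.
rewrite /prodfun; elim/big_ind : _ => [|u1 u2|j _]; rewrite ?ler01 ?lexx ?cell_bump01//.
by move=> /andP[? ?] /andP[? ?]; rewrite mulr_ge0// mulr_ile1.
Qed.

Lemma measurable_prodfun (f : 'I_d -> R -> R) : (forall j, smooth1 (f j)) ->
  measurable_fun setT (prodfun f).
Proof.
move=> sf; rewrite /prodfun; under eq_fun do rewrite -big_enum /=.
apply: measurable_prod => j _.
have := continuous_measurable_fun (smooth1_continuous (sf j)) => mfj.
exact: (measurableT_comp mfj (measurable_rV_coord j)).
Qed.

Lemma integral_cell_eq0 n z (u : V -> R) : mu.-integrable setT (EFin \o u) ->
  (forall m, \int[mu]_x (prodfun (cell_bump n z m) x * u x)%:E = 0)%E ->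
  (\int[mu]_(x in cell n z) (u x)%:E = 0)%E.
Proof.
move=> iu H; have mu_ : measurable_fun setT u by move/integrableP : iu => [/measurable_EFinP].
have mB m : measurable_fun setT (prodfun (cell_bump n z m)).
  by apply: measurable_prodfun => j; exact: smooth_bump.
have -> : (\int[mu]_(x in cell n z) (u x)%:E = \int[mu]_x (\1_(cell n z) x * u x)%:E)%E.
  rewrite integral_mkcond; apply: eq_integral => x _; rewrite patchE indicE.
  by case: ifPn => _; rewrite ?mul1r ?mul0r.
have [|||||_ _ cv] := @dominated_convergence _ _ _ mu setT measurableT
   (fun m x => (prodfun (cell_bump n z m) x * u x)%:E) (fun x => (\1_(cell n z) x * u x)%:E) (fun x => `|(u x)%:E|)%E.
- by move=> m; apply/measurable_EFinP/measurable_funM.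
- by apply/measurable_EFinP/measurable_funM => //; exact: measurable_indic.
- apply: aeW => x _; apply: cvg_EFin; first by near=> m.
  by apply: cvgMl; exact: cell_bump_cvg.
- exact: integrable_abse.
- apply: aeW => x m _; rewrite lee_fin normrM.
  have /andP[h1 h2] := prodfun_bump01 n z m x.
  by rewrite ger0_norm// ler_piMl.
have cv0 : ([sequence \int[mu]_x (prodfun (cell_bump n z m) x * u x)%:E]_m @ \oo --> 0)%E.
  by rewrite (_ : [sequence _]_m = cst 0%E)%E; [exact: cvg_cst|apply/funext => m; exact: H].
exact: (cvg_unique _ cv cv0).
Unshelve. all: by end_near. Qed.

(** The positive and negative parts, cut to the cell, are densities of two measures that agree on
    cells, hence on all measurable sets; so [u] has zero integral on every measurable part of the
    cell. *)
Lemma ae_eq0_of_cells (z0 : index) (u : V -> R) : mu.-integrable setT (EFin \o u) ->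
  (forall (k : nat) z, cell k%:Z z `<=` (cell 0 z0 : set V) ->
     (\int[mu]_(x in cell k%:Z z) (u x)%:E = 0)%E) ->
  {ae mu, forall x, cell 0 z0 x -> u x = 0}.
Proof.
move=> iu H; have meu := measurable_int _ iu.
have mC : measurable (cell 0 z0 : set V) by [].
pose fp : V -> \bar R := ((EFin \o u)^\+ \_ (cell 0 z0))%E.
pose fn : V -> \bar R := ((EFin \o u)^\- \_ (cell 0 z0))%E.
have mfp : measurable_fun setT fp.
  by apply/(measurable_restrictT _ mC)/measurable_funTS; exact: measurable_funepos.
have mfn : measurable_fun setT fn.
  by apply/(measurable_restrictT _ mC)/measurable_funTS; exact: measurable_funeneg.
have fp0 x : (0 <= fp x)%E by rewrite /fp patchE; case: ifP.
have fn0 x : (0 <= fn x)%E by rewrite /fn patchE; case: ifP.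
have pE (A : set V) : (\int[mu]_(x in A) fp x = \int[mu]_(x in A `&` cell 0 z0) (EFin \o u)^\+ x)%E by rewrite integral_mkcondr.
have nE (A : set V) : (\int[mu]_(x in A) fn x = \int[mu]_(x in A `&` cell 0 z0) (EFin \o u)^\- x)%E by rewrite integral_mkcondr.
pose m1 := [the {measure set V -> \bar R} of density_measure mu mfp fp0].
pose m2 := [the {measure set V -> \bar R} of density_measure mu mfn fn0].
have ip A : measurable A -> (\int[mu]_(x in A) (EFin \o u)^\+ x)%E \is a fin_num.
  move=> mA; apply: integrable_fin_num => //.
  apply: (@integrableS _ _ _ mu setT) => //; exact: integrable_funepos.
have in_ A : measurable A -> (\int[mu]_(x in A) (EFin \o u)^\- x)%E \is a fin_num.
  move=> mA; apply: integrable_fin_num => //.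
  apply: (@integrableS _ _ _ mu setT) => //; exact: integrable_funeneg.
have cellE (k : nat) z : m1 (cell k%:Z z) = m2 (cell k%:Z z).
  change (\int[mu]_(x in cell k%:Z z) fp x = \int[mu]_(x in cell k%:Z z) fn x)%E.
  rewrite pE nE.
  have [->|/set0P[x [xw xz]]] := eqVneq (cell k%:Z z `&` cell 0 z0) (set0 : set V).
    by rewrite !integral_set0.
  have sub : cell k%:Z z `<=` (cell 0 z0 : set V).
    move=> y yw; rewrite /cell /= -(xz : cell_index _ _ = _).
    apply: (@cell_index_coarse _ _ _ k).
    by rewrite add0r (yw : cell_index _ _ = _) (xw : cell_index _ _ = _).
  rewrite (setIidl sub); have := H k z sub; rewrite integralE.
  have := ip (cell k%:Z z) (measurable_cell _ _); have := in_ (cell k%:Z z) (measurable_cell _ _).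
  case: (integral _ _ _) => [r1| |] // _; case: (integral _ _ _) => [r2| |] // _.
  by rewrite -EFinB => -[h]; congr EFin; lra.
have fin1 z : (m1 (cell 0 z) < +oo)%E.
  change (\int[mu]_(x in cell 0 z) fp x < +oo)%E.
  by rewrite pE -ge0_fin_numE ?ip//; [exact: measurableI|exact: integral_ge0].
have m12 A : measurable A -> m1 A = m2 A.
  move=> mA; apply/eqP; rewrite eq_le; apply/andP; split.
  - by apply: le_measure_of_cells => // [z|k z]; [rewrite -(cellE 0%N)|rewrite cellE].
  - by apply: le_measure_of_cells => // k z; rewrite cellE.
have iu0 : mu.-integrable (cell 0 z0) (EFin \o u) by exact: integrableS iu.
have m0 : measurable_fun (cell 0 z0 : set V) (fun _ => 0 : \bar R)%E by exact: measurable_cst.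
have H0 : ae_eq mu (cell 0 z0) (EFin \o u) (fun _ => 0%E).
  apply: (integral_ae_eq mC iu0 m0) => A AC mA.
  rewrite integral0 integralE.
  have := m12 A mA.
  change (\int[mu]_(x in A) fp x = \int[mu]_(x in A) fn x ->
    \int[mu]_(x in A) (EFin \o u)^\+ x - \int[mu]_(x in A) (EFin \o u)^\- x = 0)%E.
  by rewrite pE nE (setIidl AC) => ->; rewrite subee// in_.
apply: filterS H0 => x ux xC; apply: EFin_inj.
exact: ux xC.
Qed.

Lemma ae_of_ae_cells (P : V -> Prop) :
  (forall z0 : index, {ae mu, forall x, cell 0 z0 x -> P x}) -> {ae mu, forall x, P x}.
Proof.
move=> H.
have : {ae mu, forall x, forall n : nat, match unpickle n with
   | Some z0 => cell 0 z0 x -> P x | None => True end}.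
  apply: ae_foralln => n; case: (unpickle n) => [z0|]; first exact: H.
  by apply: aeW.
apply: filterS => x /(_ (pickle (cell_index 0 x))).
by rewrite pickleK; apply.
Qed.

Lemma compact_box (a b : 'I_d -> R) : compact (box a b).
Proof. by apply: (@rV_compact R d (fun j => `[a j, b j]%classic)) => j; exact: segment_compact. Qed.

Lemma measurable_box (a b : 'I_d -> R) : measurable (box a b).
Proof.
rewrite (_ : box a b = \bigcap_(j in [set: 'I_d]) (rV_coord j @^-1` `[a j, b j]%classic)).
  apply: fin_bigcap_measurable => // j _.
  rewrite -[X in measurable X]setTI.
  by apply: measurable_rV_coord => //; exact: measurable_itv.
by apply/seteqP; split => [x xj j _|x xj j]; [exact: xj|exact: (xj j I)].
Qed.

Lemma loc_integrable_measurable (G : V -> R) : loc_integrable [set: V] G ->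
  measurable_fun setT G.
Proof.
move=> lG.
have -> : [set: V] = \bigcup_(m : nat) box (fun _ => - m%:R) (fun _ => m%:R).
  apply/seteqP; split => // x _.
  have [m xm] : exists m : nat, forall j, `|x ord0 j| <= m%:R.
    exists (Num.truncn `|x|).+1 => j; apply: ltW; apply: le_lt_trans (truncnS_gt _).
    by have := @mx_normE; rewrite /Num.norm /= mx_normrE => _; apply/bigmax_geP; right; exists (ord0, j).
  by exists m => // j; rewrite /= in_itv /= -ler_norml.
apply/measurable_fun_bigcup; first by move=> m; exact: measurable_box.
move=> m; have := lG _ (@compact_box (fun _ => - m%:R) (fun _ => m%:R)) (@subsetT _ _).
by move=> /measurable_int/measurable_EFinP.
Qed.

(** Bumps converge to indicators of cells, so the defect of the identity has zero integral over
    every small cell. The exceptional null set depends on [tau]. *)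
Lemma ae_increment (i : 'I_d) (tau : R) (g G : V -> R) : 0 < tau ->
  mu.-integrable setT (EFin \o g) -> loc_integrable [set: V] G ->
  weak_formula_on i setT g G ->
  {ae mu, forall x, g (x + tau *: basis_vec i) = g x + dir_integral i tau G x}.
Proof.
move=> t0 ig lG W; apply: ae_of_ae_cells => z0.
have mg : measurable_fun setT g by move/integrableP : ig => [/measurable_EFinP].
(* This box contains the bumps of all cells inside [z0] after sweeping by [tau], as well as every
   segment of length [tau] in direction [i] starting in [z0]. *)
pose a j := cell_lo 0 z0 j - 1; pose b j := cell_hi 0 z0 j + tau.
pose K := box a b.
pose GK := G \_ K.
have mK : measurable K by exact: measurable_box.
have iGK : mu.-integrable setT (EFin \o GK).
  have := lG K (@compact_box _ _) (@subsetT _ _).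
  move=> /(integrable_mkcond _ mK); congr (integrable _ _ _).
  by apply/funext => x; rewrite /GK /= !patchE; case: ifP.
have WK : weak_formula_on i K g GK.
  move=> phi tphi phiK; rewrite (W phi tphi (@subsetT _ _)); congr (- _)%E.
  apply: eq_integral => x _; congr EFin; rewrite /GK patchE; case: ifPn => // /negP xK.
  have -> : phi x = 0; last by rewrite !mulr0.
  apply: contrapT => /eqP nz; apply: xK; apply/mem_set/phiK.
  exact: subset_closure.
pose u x := g (x + tau *: basis_vec i) - g x - dir_integral i tau GK x.
have igt : mu.-integrable setT (fun x => (g (x + tau *: basis_vec i))%:E).
  apply/integrableP; split.
    by apply/measurable_EFinP; exact: (measurableT_comp mg (measurable_fun_addr _)).
  have mn : measurable_fun setT (fun x => `|(g x)%:E|%E) by apply/measurableT_comp/measurable_EFinP.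
  by have := integral_translation (tau *: basis_vec i) mn => ->; case/integrableP : ig.
have iJ := integrable_dir_integral i (ltW t0) iGK.
have iu : mu.-integrable setT (EFin \o u).
  rewrite (_ : _ \o _ = (fun x => (g (x + tau *: basis_vec i))%:E - (g x)%:E - (dir_integral i tau GK x)%:E)%E)//.
  by apply: integrableB => //; exact: integrableB.
have cellK (k : nat) z : cell k%:Z z `<=` (cell 0 z0 : set V) -> forall j,
    cell_lo 0 z0 j <= cell_lo k%:Z z j :> R /\ cell_hi k%:Z z j <= cell_hi 0 z0 j :> R.
  move=> sub j.
  pose pt (y : R) : V := \row_l (if l == j then y else cell_lo k%:Z z l).
  have lohi l : cell_lo k%:Z z l < cell_hi k%:Z z l :> R.
    by rewrite /cell_lo /cell_hi ltr_pM2r ?exp2z_gt0// ltr_int ltrDl.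
  have ptin y : cell_lo k%:Z z j <= y < cell_hi k%:Z z j -> cell_lo 0 z0 j <= y < cell_hi 0 z0 j.
    move=> yj; have : cell k%:Z z (pt y).
      apply/cellP => l; rewrite -/(cell_lo _ _ _) -/(cell_hi _ _ _) mxE.
      by case: eqP => [->//|_]; rewrite lexx lohi.
    by move=> /sub /cellP/(_ j); rewrite -/(cell_lo _ _ _) -/(cell_hi _ _ _) mxE eqxx.
  have := ptin (cell_lo k%:Z z j); rewrite lexx lohi => /(_ isT)/andP[h1 h2]; split=> //.
  rewrite leNgt; apply/negP => h3.
  by have := ptin (cell_hi 0 z0 j); rewrite (ltW h2) h3 ltxx andbF => /(_ isT).
have u0 := @ae_eq0_of_cells z0 u iu _.
apply: filterS (u0 _) => [x ux xz|k z sub]; last first.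
  apply: integral_cell_eq0 => // m.
  apply: (@increment_test_zero R d i tau g GK (cell_bump k%:Z z m)
    (fun j => cell_lo k%:Z z j - 1) (fun j => cell_hi k%:Z z j)) => //.
  - by move=> j; exact: smooth_bump.
  - by move=> j x; exact: cell_bump01.
  - move=> j x h; apply: bump_eq0; move: h; rewrite negb_and -!ltNge => /orP[h|h].
      by rewrite (ltW h).
    by rewrite (ltW h) orbT.
  - move=> phi tphi phiK; apply: WK => //; apply: subset_trans phiK _ => x xb j.
    have := xb j; rewrite /= !in_itv /= => /andP[h1 h2]; have [l1 l2] := cellK k z sub j.
    by apply/andP; split; [apply: le_trans h1; rewrite lerD2r|apply: (le_trans h2); rewrite lerD2r].
have -> : dir_integral i tau G x = dir_integral i tau GK x.
  rewrite /dir_integral; congr fine; apply: eq_integral => r _; congr EFin.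
  rewrite /swept /= indicE; case: (boolP (r \in _)) => [/set_mem|_]; last by rewrite !mulr0.
  rewrite /= in_itv /= => /andP[r0 rt]; congr (_ * _).
  rewrite /GK patchE mem_set// => j; rewrite /= in_itv /= !mxE.
  have /cellP/(_ j) := xz; rewrite -/(cell_lo _ _ _) -/(cell_hi _ _ _) => /andP[h1 h2].
  rewrite /a /b; move: h1 h2; move: (cell_lo _ _ _) (cell_hi _ _ _) => lo hi h1 h2.
  by rewrite eqxx /=; case: (j == i) => /=; rewrite ?mulr1n ?mulr0n ?mulr1 ?mulr0; apply/andP; split; lra.
by have := ux xz; rewrite /u; lra.
Qed.

End vanishing.

(** * The gradient seminorm *)

Section band_crossing.
Context {R : realType}.
Implicit Types (A : R -> R) (u v alpha beta t c : R).

Lemma last_below A u v alpha : u <= v -> (forall r, u <= r <= v -> {for r, continuous A}) ->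
  A u <= alpha ->
  exists r1, [/\ u <= r1 <= v, A r1 <= alpha & forall r, r1 < r <= v -> alpha < A r].
Proof.
move=> uv cA Au.
pose S := [set r | u <= r <= v /\ A r <= alpha].
have Su : S u by split; rewrite ?lexx.
have ubS : ubound S v by move=> r [/andP[]].
have hS : has_sup S by split; [exists u|exists v].
have Sub r : S r -> r <= sup S by apply: sup_upper_bound.
have uS : u <= sup S by exact: Sub.
have Sv : sup S <= v by apply: ge_sup => //; exists u.
exists (sup S); split; first by rewrite uS.
  rewrite leNgt; apply/negP => h.
  have /nbhs_ballP[e /= e0 H] : \forall r \near sup S, alpha < A r.
    by apply: (cA (sup S) _ _ (open_nbhs_nbhs (conj (@open_gt R alpha) h))); rewrite uS.
  have [r Sr re] := sup_adherent e0 hS.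
  have := Sub _ Sr => rS; case: Sr => _; rewrite leNgt => /negP; apply; apply: H.
  by rewrite /ball /= ger0_norm; lra.
move=> r /andP[r1 r2]; rewrite ltNge; apply/negP => Ar.
have : S r by split => //; rewrite r2 andbT; lra.
by move=> /Sub; lra.
Qed.

(** Take [r1] as the last time [A] is at most [alpha]; then the first later time [A] reaches [beta]
    is a last time for the reflected function [- A (- r)]. *)
Lemma upward_crossing A u v alpha beta : u <= v ->
  (forall r, u <= r <= v -> {for r, continuous A}) ->
  A u <= alpha -> alpha < beta -> beta <= A v ->
  exists r1 r2, [/\ u <= r1, r1 <= r2, r2 <= v, beta - alpha <= A r2 - A r1 &
    forall r, r1 < r < r2 -> alpha < A r < beta].
Proof.
move=> uv cA Au ab Av.
have [r1 [/andP[ur1 r1v] A1 H1]] := last_below uv cA Au.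
have [|r ||s [/andP[s1 s2] A2 H2]] := @last_below (fun r => - A (- r)) (- v) (- r1) (- beta).
- lra.
- move=> /andP[h1 h2]; apply: continuousN.
  apply: (@continuous_comp _ _ _ (fun r : R => - r) A r); first exact: opp_continuous.
  by apply: cA; apply/andP; split; lra.
- by rewrite opprK; lra.
exists r1, (- s); split; [lra|lra|lra|lra|].
move=> r /andP[h1 h2]; rewrite H1 ?h1 /=; last lra.
by have := H2 (- r); rewrite opprK ltrN2; apply; apply/andP; split; lra.
Qed.

Lemma band_crossing A u v alpha beta : u <= v ->
  (forall r, u <= r <= v -> {for r, continuous A}) ->
  Num.min (A u) (A v) <= alpha -> alpha < beta -> beta <= Num.max (A u) (A v) ->
  exists r1 r2, [/\ u <= r1, r1 <= r2, r2 <= v, beta - alpha <= `|A r2 - A r1| &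
    forall r, r1 < r < r2 -> alpha < A r < beta].
Proof.
move=> uv cA; have [Auv|/ltW Avu] := leP (A u) (A v).
  move=> h1 h2 h3; have [r1 [r2 [? ? ? h ?]]] := upward_crossing uv cA h1 h2 h3.
  by exists r1, r2; split => //; apply: le_trans h (ler_norm _).
move=> h1 h2 h3; have [|r ||||r1 [r2 [? ? ? h H]]] :=
  @upward_crossing (fun r => A (- r)) (- v) (- u) alpha beta; rewrite ?opprK //; first lra.
  move=> /andP[? ?]; apply: (@continuous_comp _ _ _ (fun r : R => - r) A r); first exact: opp_continuous.
  by apply: cA; apply/andP; split; lra.
exists (- r2), (- r1); split; [lra|lra|lra| |].
  by rewrite distrC; apply: le_trans h (ler_norm _).
move=> r /andP[k1 k2]; have /H : r1 < - r < r2 by apply/andP; split; lra.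
by rewrite opprK.
Qed.

(** The right-hand side is the length of the part of [[t, 2 * t]] lying between [a] and [b]. *)
Lemma norm_truncB_le t a b : 0 <= t ->
  `|trunc t a - trunc t b| <=
  Num.max 0 (Num.min (Num.max a b) (2 * t) - Num.max (Num.min a b) t).
Proof.
move=> t0; wlog ab : a b / a <= b.
  move=> H; have [ab|ba] := orP (le_total a b); first exact: H.
  by rewrite distrC (maxC a) (minC a); exact: H.
rewrite distrC ger0_norm ?subr_ge0 ?le_trunc// /trunc.
rewrite (max_idPr ab) (min_idPl ab).
case: (leP a t) => h1; case: (leP b (2 * t)) => h2.
- rewrite (min_idPl (_ : a <= 2 * t)); last lra.
  by rewrite le_max; case: (leP b t) => h3; apply/orP; [left|right]; lra.
- rewrite (min_idPl (_ : a <= 2 * t)) ?(min_idPr (_ : t <= b)); [|lra|lra].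
  by rewrite le_max; apply/orP; right; lra.
- rewrite (min_idPl (_ : a <= 2 * t)) ?(min_idPr (_ : t <= b)); [|lra|lra].
  by rewrite le_max; apply/orP; right; lra.
- rewrite (min_idPr (_ : t <= b)); last lra.
  by rewrite le_max; case: (leP a (2 * t)) => h3; apply/orP; [right|left]; lra.
Qed.

(** This replaces the chain rule: the values of [|A|] between its end values and inside the band are
    crossed on one subinterval, where [A] itself varies by at least as much as the truncation. *)
Lemma trunc_increment_crossing A u v t : 0 <= t -> u <= v ->
  (forall r, u <= r <= v -> {for r, continuous A}) ->
  exists r1 r2, [/\ u <= r1, r1 <= r2, r2 <= v,
    `|trunc t `|A v| - trunc t `|A u| | <= `|A r2 - A r1| &
    forall r, r1 < r < r2 -> t < `|A r| < 2 * t].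
Proof.
move=> t0 uv cA; pose B r := `|A r|.
have cB r : u <= r <= v -> {for r, continuous B}.
  by move=> h; apply: continuous_comp; [exact: cA|exact: norm_continuous].
pose alpha := Num.max (Num.min (B u) (B v)) t.
pose beta := Num.min (Num.max (B u) (B v)) (2 * t).
have [ab|ba] := ltP alpha beta; last first.
  (* No part of the band lies strictly between the end values, so the truncation does not change and
     the subinterval may be degenerate. *)
  exists u, u; split => //.
    apply: le_trans (norm_truncB_le _ _ t0) _; rewrite subrr normr0 ge_max lexx /=.
    by rewrite subr_le0 (maxC `|A v|) (minC `|A v|).
  by move=> r /andP[h /(lt_trans h)]; rewrite ltxx.
have [||r1 [r2 [h1 h2 h3 h4 H]]] := band_crossing uv cB _ ab _.
- by rewrite /alpha le_max lexx.
- by rewrite /beta ge_min lexx.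
exists r1, r2; split => //.
  apply: le_trans (le_trans h4 (ler_dist_dist _ _)).
  apply: le_trans (norm_truncB_le _ _ t0) _.
  by rewrite ge_max subr_ge0 (ltW ab) /= (maxC `|A v|) (minC `|A v|).
move=> r /H /andP[k1 k2]; apply/andP; split.
  by apply: le_lt_trans k1; rewrite /alpha le_max lexx orbT.
by apply: lt_le_trans k2 _; rewrite /beta ge_min lexx orbT.
Qed.

End band_crossing.

Section band_increment.
Context {R : realType}.
Local Notation leb := (@lebesgue_measure R).

Definition band (t a : R) : R := (t < `|a| < 2 * t)%R%:R.

Lemma measurable_band t : measurable_fun setT (band t).
Proof.
have -> : band t = \1_(`]t, (2 * t)%R[%classic) \o (fun a : R => `|a|).
  apply/funext => a; rewrite /band /= indicE; congr (_%:R); congr nat_of_bool; apply/esym.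
  by apply/idP/idP => [/set_mem|h]; [rewrite /= in_itv|apply/mem_set; rewrite /= in_itv].
by apply: (measurableT_comp (measurable_indic _)); [exact: measurable_itv|exact: normr_measurable].
Qed.

Lemma trunc_increment_le (A phi : R -> R) (a c u v t : R) : 0 <= t -> a < u -> u <= v ->
  leb.-integrable setT (EFin \o phi) ->
  (forall r, A r = c + \int[leb]_(s in `[a, r]) phi s) ->
  (`|trunc t `|A v| - trunc t `|A u| |%:E <=
   \int[leb]_(r in `[u, v]) (`|phi r| * band t (A r))%:E)%E.
Proof.
move=> t0 au uv iphi AE.
have {}AE : A = (fun r => c + \int[leb]_(s in `[a, r]) phi s) by apply/funext.
have iS (I : interval R) : leb.-integrable [set` I] (EFin \o phi).
  by apply: integrableS iphi => //; exact: measurable_itv.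
(* The primitive is continuous on [[a, v + 1]], which has [u] and [v] in its interior; hence
   two-sided continuity on [[u, v]]. *)
have av : a <= v + 1 by lra.
have cW := parameterized_integral_continuous av (iS _).
have cA r : u <= r <= v -> {for r, continuous A}.
  rewrite AE => /andP[h1 h2]; apply: cvgD; first exact: cvg_cst.
  have [|cin _ _] := (continuous_within_itvP (parameterized_integral leb a ^~ phi) (_ : a < v + 1)).1 cW; first lra.
  by apply: cin; rewrite in_itv /=; apply/andP; split; lra.
have mA : measurable_fun `[u, v] A.
  apply: (@measurable_funS _ _ _ _ `[a, v + 1]) => //.
    by apply: subset_itv; rewrite bnd_simp; lra.
  rewrite AE; apply: measurable_funD => //.
  exact: subspace_continuous_measurable_fun (measurable_itv _) cW.
have [r1 [r2 [h1 h2 h3 h4 H]]] := trunc_increment_crossing t0 uv cA.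
apply: (@le_trans _ _ (`|A r2 - A r1|)%:E); first by rewrite lee_fin.
have -> : A r2 - A r1 = \int[leb]_(s in `]r1, r2]) phi s.
  by rewrite -(@Rintegral_itvB R phi (BLeft a) (BRight r2) r1) ?bnd_simp//; [rewrite AE; ring|lra].
have mphi : measurable_fun setT phi by move/integrableP : iphi => [/measurable_EFinP].
have mn : measurable_fun setT (fun s => `|phi s|) by exact: measurableT_comp.
apply: (@le_trans _ _ (\int[leb]_(s in `]r1, r2]) (`|phi s|)%:E)%E).
  rewrite -[leRHS]fineK; last first.
    by apply: integrable_fin_num => //; apply: (integrable_abse (iS _)).
  rewrite lee_fin.
  have := le_normr_Rintegral (mu := leb) (measurable_itv `]r1, r2]) (iS `]r1, r2]).
  by rewrite /Rintegral.
rewrite -[leLHS]integral_itv_bndo_bndc; last first.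
  by apply/measurable_EFinP; exact: measurable_funTS mn.
have mind : measurable_fun `[u, v] (fun r => band t (A r)).
  exact: measurableT_comp (measurable_band t) mA.
have mf : measurable_fun `[u, v] (fun r => (`|phi r| * band t (A r))%:E).
  by apply/measurable_EFinP/measurable_funM; [exact: measurable_funTS mn|exact: mind].
have sub : `]r1, r2[%classic `<=` `[u, v]%classic by apply: subset_itv; rewrite bnd_simp.
apply: (@le_trans _ _ (\int[leb]_(r in `]r1, r2[) (`|phi r| * band t (A r))%:E)%E).
  apply: ge0_le_integral => //.
  - by apply/measurable_EFinP; exact: measurable_funTS mn.
  - exact: measurable_funS mf.
  - by move=> r; rewrite /= in_itv /= => /H h; rewrite /band h mulr1.
apply: ge0_subset_integral => //.
by move=> r _; rewrite lee_fin mulr_ge0.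
Qed.

End band_increment.

Section swept_measurability.
Context {R : realType} {d : nat}.
Local Notation V := 'rV[R]_d.
Local Notation mu := (@lebesgue_rV R d).
Local Notation leb := (@lebesgue_measure R).
Variable i : 'I_d.

Lemma indic_itvcc (a b r : R) : \1_(`[a, b]%classic) r = (a <= r <= b)%R%:R :> R.
Proof.
rewrite indicE; congr (_%:R); congr nat_of_bool.
by apply/idP/idP => [/set_mem|h]; [rewrite /= in_itv|apply/mem_set; rewrite /= in_itv].
Qed.

Lemma indic_itvc_infty (a r : R) : \1_(`[a, +oo[%classic) r = (a <= r)%R%:R :> R.
Proof.
rewrite indicE; congr (_%:R); congr nat_of_bool.
by apply/idP/idP => [/set_mem|h]; [rewrite /= in_itv /= andbT|apply/mem_set; rewrite /= in_itv /= andbT].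
Qed.

(** The length is now a variable too: the condition [0 <= s <= r] becomes a product of two half-line
    indicators, jointly measurable in [s] and [r], and Tonelli applies to the positive and negative
    parts. *)
Lemma measurable_dir_integral (G : V -> R) : measurable_fun setT G ->
  measurable_fun setT (fun xr : V * measurableTypeR R => dir_integral i xr.2 G xr.1).
Proof.
move=> mG.
pose H (yr : (V * measurableTypeR R) * measurableTypeR R) : R :=
  G (yr.1.1 + yr.2 *: basis_vec i) * (\1_(`[0, +oo[) yr.2 * \1_(`[0, +oo[) (yr.1.2 - yr.2)).
have m0 : measurable_fun setT (\1_(`[0%R, +oo[%classic) : R -> R) by exact: measurable_indic.
have mH : measurable_fun setT H.
  apply: measurable_funM; last apply: measurable_funM.
  - have m1 : measurable_fun setT (fun yr : (V * measurableTypeR R) * measurableTypeR R => (yr.1.1, yr.2)).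
      apply/measurable_fun_pairP; split; last exact: measurable_snd.
      exact: (measurableT_comp measurable_fst measurable_fst).
    exact: (measurableT_comp mG (measurableT_comp (measurable_move i) m1)).
  - by apply: (measurableT_comp m0).
  - apply: (measurableT_comp m0); apply: measurable_funB; last exact: measurable_snd.
    exact: (measurableT_comp measurable_snd measurable_fst).
have mP := measurable_fun_fubini_tonelli_F (m2 := leb) _
  (measurable_funepos (proj2 (measurable_EFinP _ _) mH)) (fun x => funepos_ge0 _ x).
have mN := measurable_fun_fubini_tonelli_F (m2 := leb) _
  (measurable_funeneg (proj2 (measurable_EFinP _ _) mH)) (fun x => funeneg_ge0 _ x).
have := measurableT_comp (fine_measurable measurableT) (emeasurable_funB mP mN).
congr (measurable_fun _ _); apply/funext => -[x r] /=.
rewrite /dir_integral integralE /fubini_F; congr fine; congr (_ - _)%E.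
- apply: eq_integral => s _; rewrite /= !funeposE /H /swept /= !indic_itvcc !indic_itvc_infty subr_ge0.
  by case: (0 <= s) => /=; rewrite ?mul1r ?mul0r.
- apply: eq_integral => s _; rewrite /= !funenegE /H /swept /= !indic_itvcc !indic_itvc_infty subr_ge0.
  by case: (0 <= s) => /=; rewrite ?mul1r ?mul0r.
Qed.

Lemma trunc_swept_le (G : V -> R) (c t tau : R) (x : V) : 0 <= t -> 0 < tau ->
  leb.-integrable setT (fun r => (swept i tau G (x, r))%:E) ->
  (`|trunc t `|c + dir_integral i tau G x| - trunc t `|c| |%:E <=
   \int[leb]_(r in `[0%R, tau])
     (`|G (x + r *: basis_vec i)| * band t (c + dir_integral i r G x))%R%:E)%E.
Proof.
move=> t0 tau0 iphi.
(* [swept] vanishes before [0]; starting at [-1] changes no value and puts [0] in the interior. *)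
pose A (r : R) : R := c + \int[leb]_(s in `[-1, r]) swept i tau G (x, s).
have AE r : 0 <= r <= tau -> A r = c + dir_integral i r G x.
  move=> /andP[r0 rt]; congr (_ + _); rewrite /Rintegral /dir_integral; congr fine.
  rewrite integral_mkcond; apply: eq_integral => s _.
  rewrite patchE /swept /= !indic_itvcc.
  case: ifPn => [/set_mem|/negP h].
    rewrite /= in_itv /= => /andP[s1 sr]; rewrite sr (le_trans sr rt).
    by case: (0 <= s).
  case: (boolP (0 <= s <= r)) => [/andP[s0 sr]|_]; last by rewrite mulr0.
  by exfalso; apply: h; apply/mem_set; rewrite /= in_itv /= sr andbT; lra.
have E0 : dir_integral i 0 G x = 0.
  have Er : (\int[leb]_r (swept i 0 G (x, r))%:E = 0)%E.
    rewrite -[RHS](@integral_set1 R (fun r => (G (x + r *: basis_vec i))%:E) 0) [RHS]integral_mkcond.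
    apply: eq_integral => s _; rewrite /swept patchE /= indicE set_itv1.
    by case: ifP => _; rewrite ?mulr1 ?mulr0.
  by rewrite /dir_integral Er.
have := @trunc_increment_le R A (fun r => swept i tau G (x, r)) (-1) c 0 tau t t0 _ (ltW tau0) iphi _.
rewrite !AE ?lexx ?(ltW tau0)// E0 addr0 => /(_ _ (fun=> erefl)) H.
apply: le_trans (H _) _; first lra.
rewrite le_eqVlt; apply/orP; left; apply/eqP; apply: eq_integral => r /set_mem.
rewrite /= in_itv /= => r0; congr (_%:E); rewrite -AE//; congr (_ * _).
by rewrite /swept /= indic_itvcc r0 mulr1.
Qed.

End swept_measurability.

(** * Increments of the truncation across a cell *)

Section gradient_oscillation.
Context {R : realType} {d : nat}.
Hypothesis hd : (0 < d)%N.
Local Notation V := 'rV[R]_d.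
Local Notation mu := (@lebesgue_rV R d).
Local Notation leb := (@lebesgue_measure R).
Local Notation index := {ffun 'I_d -> int}.
Implicit Types (n : int) (z : index) (x y : V).

Section one_cell.
Variables (n : int) (z : index) (i : 'I_d).
Hypothesis splitE : forall j, split_dir n j = (j == i).
Let tau : R := 2 ^ (- dexp (n + 1) i).
Let e : V := basis_vec i.

Let dexp_i : (2 : R) ^ (- dexp n i) = 2 * tau.
Proof.
have dE : dexp (n + 1) i = dexp n i + 1 by rewrite dexpS splitE eqxx.
by rewrite /tau dE opprD expfzDr// exprN1 mulrCA mulfV ?mulr1// pnatr_eq0.
Qed.

Let dexp_j j : j != i -> dexp (n + 1) j = dexp n j.
Proof. by move=> ji; rewrite dexpS splitE (negbTE ji) addr0. Qed.

Lemma side_gt0 : 0 < tau.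
Proof. exact: exp2z_gt0. Qed.

Lemma cell_translate x :
  cell (n + 1) (child n z true) (x + tau *: e) <-> cell (n + 1) (child n z false) x.
Proof.
split=> /cellP H; apply/cellP => j; have := H j; rewrite !ffunE !splitE !mxE eqxx /=;
  have [->|ji] := eqVneq j i; rewrite ?mulr1n ?mulr0n ?mulr1 ?mulr0 ?addr0 //= -/tau;
  rewrite !intrD !intrM /=; have := side_gt0; move: tau => T T0 /andP[h1 h2]; apply/andP; split; nra.
Qed.

Lemma cell_segment x r : cell (n + 1) (child n z false) x -> 0 <= r <= tau ->
  cell n z (x + r *: e).
Proof.
move=> /cellP H /andP[r0 rt]; apply/cellP => j; have := H j; rewrite !ffunE !splitE !mxE eqxx /=.
have [->|ji] := eqVneq j i; rewrite ?mulr1n ?mulr0n ?mulr1 ?mulr0 ?addr0 //= -?/tau ?dexp_j//.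
rewrite dexp_i !intrD !intrM /=; have := side_gt0; move: tau rt => T rt T0 /andP[h1 h2].
apply/andP; split; nra.
Qed.

(** [x] and [x + tau e] lie in the same cell of level [n], so [cell_side] applies to them. *)
Lemma side_le_rad : tau <= 2 * rad d n.
Proof.
pose x : V := \row_j ((child n z false j)%:~R * 2 ^ (- dexp (n + 1) j)).
have xL : cell (n + 1) (child n z false) x.
  apply/cellP => j; rewrite mxE /= lexx /= ltr_pM2r ?exp2z_gt0// ltr_int ltrDl//.
have h0 : 0 <= (0 : R) <= tau by rewrite lexx ltW ?side_gt0.
have h1 : 0 <= tau <= tau by rewrite lexx ltW ?side_gt0.
have := cell_side hd i (cell_segment xL h1) (cell_segment xL h0).
rewrite scale0r addr0 addrAC subrr add0r !mxE !eqxx mulr1.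
by rewrite ger0_norm// ltW// side_gt0.
Qed.

(* [F (x, r)], the value at [x + r e] of [g] rebuilt by integrating [G] from
   [x], is continuous in [r] and, for each [r], equal to [g (x + r e)] for almost
   every [x]. *)
Lemma segment_band_integral (t : R) (g G : V -> R) : 0 < t ->
  mu.-integrable setT (EFin \o g) -> loc_integrable [set: V] G ->
  weak_formula_on i setT g G ->
  (\int[mu]_(x in cell (n + 1) (child n z false))
     (`|trunc t `|g (x + tau *: e)%R| - trunc t `|g x| |)%:E <=
   tau%:E * \int[mu]_(x in cell n z) (`|G x| * band t (g x))%:E)%E.
Proof.
move=> t0 ig lG W; have tau0 := side_gt0.
have mg : measurable_fun setT g by move/integrableP : ig => [/measurable_EFinP].
have mG := loc_integrable_measurable lG.
pose Q := cell n z : set V; pose L := cell (n + 1) (child n z false) : set V.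
have mQ : measurable Q by exact: measurable_cell.
have mL : measurable L by exact: measurable_cell.
(* Segments of length at most [tau] starting in the left child stay in [Q], so only [G] on [Q]
   matters, and there it is integrable. *)
pose GQ := G \_ Q.
have mGQ : measurable_fun setT GQ by apply/(measurable_restrictT _ mQ)/measurable_funTS.
have iGQ : mu.-integrable setT (EFin \o GQ).
  pose K := box (cell_lo n z) (cell_hi n z) : set V.
  have iK := lG K (@compact_box _ _ _ _) (@subsetT _ _).
  have QK : Q `<=` K.
    move=> x /cellP xQ j; have /andP[h1 h2] := xQ j.
    by rewrite /= in_itv /= h1 ltW.
  have iQ := integrableS (measurable_box _ _) mQ QK iK.
  have := (integrable_mkcond _ mQ).1 iQ; congr (integrable _ _ _).
  by apply/funext => x; rewrite /GQ /= !patchE; case: ifP.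
have dirE x r : L x -> 0 <= r <= tau -> dir_integral i r G x = dir_integral i r GQ x.
  move=> xL /andP[r0 rt]; rewrite /dir_integral; congr fine; apply: eq_integral => s _; congr EFin.
  rewrite /swept /= indic_itvcc; case: (boolP (0 <= s <= r)) => [/andP[s0 sr]|_]; last by rewrite !mulr0.
  rewrite /GQ patchE mem_set//; apply: cell_segment => //.
  by rewrite s0 (le_trans sr rt).
pose F (xr : V * measurableTypeR R) : R := g xr.1 + dir_integral i xr.2 GQ xr.1.
have mF : measurable_fun setT F.
  apply: measurable_funD; last exact: measurable_dir_integral.
  exact: (measurableT_comp mg measurable_fst).
pose H (xr : V * measurableTypeR R) : R :=
  `|GQ (xr.1 + xr.2 *: e)| * band t (F xr) * (\1_L xr.1 * \1_(`[0%R, tau]%classic) xr.2).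
have H0 xr : (0 <= (H xr)%:E)%E by rewrite lee_fin !mulr_ge0// /band.
have mH : measurable_fun setT (EFin \o H).
  apply/measurable_EFinP/measurable_funM; apply: measurable_funM.
  - apply: measurableT_comp => //; exact: (measurableT_comp mGQ (measurable_move i)).
  - exact: (measurableT_comp (measurable_band t) mF).
  - exact: (measurableT_comp (measurable_indic mL) measurable_fst).
  - exact: (measurableT_comp (measurable_indic (measurable_itv _)) measurable_snd).
have mT : measurable_fun setT (fun x => trunc t `|g x|).
  by apply: measurableT_comp; [exact: measurable_trunc|exact: measurableT_comp].
have mTs : measurable_fun setT (fun x => trunc t `|g (x + tau *: e)|).
  exact: (measurableT_comp mT (measurable_fun_addr (tau *: e))).
pose k x : \bar R := (`|G x| * band t (g x))%:E.
have k0 x : (0 <= k x)%E by rewrite lee_fin mulr_ge0.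
have mk : measurable_fun setT k.
  apply/measurable_EFinP/measurable_funM; first exact: measurableT_comp.
  exact: (measurableT_comp (measurable_band t) mg).
apply: (@le_trans _ _ (\int[mu]_x \int[leb]_r (H (x, r))%:E)%E).
  rewrite integral_mkcond; apply: ae_ge0_le_integral => //.
  - by move=> x _; rewrite patchE; case: ifP.
  - apply/(measurable_restrictT _ mL)/measurable_funTS/measurable_EFinP.
    by apply: measurableT_comp => //; apply: measurable_funB.
  - by move=> x _; apply: integral_ge0.
  - exact: (measurable_fun_fubini_tonelli_F _ mH).
  apply: filterS2 (ae_increment tau0 ig lG W) (ae_integrable1 (integrable_swept i (ltW tau0) iGQ)).
  move=> x gx isw _; rewrite patchE; case: ifPn => [/set_mem xL|_]; last exact: integral_ge0.
  rewrite gx (dirE _ _ xL) ?lexx ?(ltW tau0)//.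
  apply: le_trans (trunc_swept_le _ (ltW t0) tau0 isw) _.
  rewrite [leLHS]integral_mkcond le_eqVlt; apply/orP; left; apply/eqP.
  apply: eq_integral => r _; rewrite patchE /H /= [\1_L x]indicE (mem_set xL) /= mul1r indic_itvcc.
  case: (boolP (r \in _)) => [/set_mem|/negP h].
    by rewrite /= in_itv /= => ->; rewrite mulr1.
  case: (boolP (0 <= r <= tau)) => [h'|_]; last by rewrite mulr0.
  by exfalso; apply: h; apply/mem_set; rewrite /= in_itv.
(* For fixed [r], translation by [r e] carries the left child into [Q], so each inner integral is at
   most the integral over [Q]; integrating over [r] gives the factor [tau]. *)
rewrite (fubini_tonelli (m1 := mu) (m2 := leb) _ mH H0).
pose kQ := (\int[mu]_(x in Q) k x)%E.
have -> : (tau%:E * kQ = \int[leb]_(r in `[0%R, tau]) (cst kQ r))%E.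
  rewrite integral_cst; last exact: measurable_itv.
  by rewrite /= lebesgue_measure_itv /= lte_fin tau0 sube0 muleC.
rewrite [leRHS]integral_mkcond; apply: ge0_le_integral => //.
- by move=> r _; apply: integral_ge0 => x _; exact: H0.
- exact: (measurable_fun_fubini_tonelli_G (m1 := mu) _ mH H0).
- by apply/(measurable_restrictT _ (measurable_itv _)); exact: measurable_cst.
move=> r _; rewrite patchE; case: ifPn => [/set_mem|/negP h]; last first.
  rewrite (_ : (fun x => _) = cst 0%E) ?integral0//; apply/funext => x.
  rewrite /H /= indic_itvcc; case: (boolP (0 <= r <= tau)) => [h'|_]; last by rewrite !mulr0.
  by exfalso; apply: h; apply/mem_set; rewrite /= in_itv.
rewrite /= in_itv /= => /andP[r0 rt].
have mkQ : measurable_fun setT (k \_ Q) by apply/(measurable_restrictT _ mQ)/measurable_funTS.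
rewrite [leRHS]integral_mkcond -(integral_translation (r *: e) mkQ).
apply: ae_ge0_le_integral => //.
- exact: (measurable_fun_pair1 r mH).
- by move=> x _; rewrite patchE; case: ifP.
- exact: (measurableT_comp mkQ (measurable_fun_addr (r *: e))).
have gr : {ae mu, forall x, L x -> F (x, r) = g (x + r *: e)}.
  move: r0; rewrite le_eqVlt => /orP[/eqP r0|r0].
    apply: aeW => x xL; rewrite /F /= -r0 scale0r addr0 /dir_integral.
    rewrite -[RHS]addr0; congr (_ + _).
    have -> : (\int[leb]_s (swept i 0 GQ (x, s))%:E = 0)%E; last by [].
    rewrite -[RHS](@integral_set1 R (fun s => (GQ (x + s *: basis_vec i))%:E) 0) [RHS]integral_mkcond.
    apply: eq_integral => s _; rewrite /swept patchE /= indicE set_itv1.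
    by case: ifP => _; rewrite ?mulr1 ?mulr0.
  apply: filterS (ae_increment r0 ig lG W) => x gx xL.
  by rewrite /F /= gx (dirE _ _ xL)// (ltW r0).
apply: filterS gr => x gr _; rewrite /H /= indicE; case: (boolP (x \in L)) => [/set_mem xL|_]; last first.
  by rewrite mul0r mulr0 patchE; case: ifP.
have xQ : Q (x + r *: e) by apply: cell_segment => //; rewrite r0.
rewrite (gr xL) indic_itvcc r0 rt !mulr1 patchE (mem_set xQ) lee_fin.
by rewrite /GQ patchE (mem_set xQ).
Qed.

End one_cell.

End gradient_oscillation.

Section gradient.
Context {R : realType} {d : nat}.
Hypothesis hd : (0 < d)%N.
Local Notation V := 'rV[R]_d.
Local Notation mu := (@lebesgue_rV R d).
Local Notation index := {ffun 'I_d -> int}.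
Implicit Types (n : int) (z : index) (x y : V).

Lemma norm_coord_le_enorm x i : `|x ord0 i| <= enorm x.
Proof.
rewrite /enorm -sqrtr_sqr ler_wsqrtr// (bigD1 i) //= lerDl.
by apply: sumr_ge0 => j _; exact: sqr_ge0.
Qed.

Definition gradient_density (p t : R) (g : V -> R) (G : V -> V) x : \bar R :=
  (enorm (G x) `^ p * band t (g x))%:E.

Lemma gradient_density_ge0 p t g G x : (0 <= gradient_density p t g G x)%E.
Proof. by rewrite lee_fin mulr_ge0 ?powR_ge0. Qed.

Variables (g : V -> R) (G : V -> V).
Hypotheses (ig : mu.-integrable setT (EFin \o g)) (wG : is_weak_gradient [set: V] g G).

Let mg : measurable_fun setT g.
Proof. by move/integrableP : ig => [/measurable_EFinP]. Qed.

Lemma measurable_weak_gradient : measurable_fun setT G.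
Proof.
case: wG => _ lG _; apply: measurable_fun_rVP => i.
exact: loc_integrable_measurable (lG i).
Qed.

Lemma measurable_enorm_powR p : measurable_fun setT (fun x => enorm (G x) `^ p).
Proof.
apply: (measurableT_comp (measurable_powR _)).
exact: (measurableT_comp measurable_enorm measurable_weak_gradient).
Qed.

Lemma measurable_gradient_density p t : measurable_fun setT (gradient_density p t g G).
Proof.
apply/measurable_EFinP/measurable_funM; first exact: measurable_enorm_powR.
exact: (measurableT_comp (measurable_band t) mg).
Qed.

(** The right child is the left one translated by [tau e], so the difference of the means is a mean
    of increments. The segment bound and Jensen's inequality follow, and [4] comes from
    [2 * tau <= 4 * rad d n]. *)
Lemma gradient_oscillation p t : 1 <= p -> 0 < t ->
  oscillation_bound (4 `^ p) 1 p (fun x => trunc t `|g x|) (gradient_density p t g G).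
Proof.
move=> p1 t0 n z; have p0 : 0 < p by lra.
have [i splitE] := split_dir_ord hd n.
set L := child n z false; set Rr := child n z true.
pose tau : R := 2 ^ (- dexp (n + 1) i).
have tau0 : 0 < tau := side_gt0 n i.
pose h x := trunc t `|g x|.
have mh : measurable_fun setT h.
  by apply: measurableT_comp; [exact: measurable_trunc|exact: measurableT_comp].
have h0 x : 0 <= h x by apply: trunc_ge0; exact: ltW.
have ht x : h x <= t by apply: trunc_le; exact: ltW.
set delta := `|mean h (n + 1) L - mean h (n + 1) Rr|.
pose h' x := h (x + tau *: basis_vec i).
have mh' : measurable_fun setT h' := measurableT_comp mh (measurable_fun_addr (tau *: basis_vec i)).
have h'0 x : 0 <= h' x by exact: h0.
have mL : measurable (cell (n + 1) L : set V) by [].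
have EL := meanK hd mh h0 ht (n + 1) L.
have ER : (mean h (n + 1) Rr * vol (n + 1))%:E = (\int[mu]_(x in cell (n + 1) L) (h' x)%:E)%E.
  rewrite (meanK hd mh h0 ht) -(ge0_integral_translation (tau *: basis_vec i)) //; last first.
    exact/measurable_EFinP.
  congr (integral mu _ _); apply/seteqP; split => x /=.
    by move/(cell_translate (n := n) z splitE).
  by move=> /(cell_translate (n := n) z splitE).
have mD : measurable_fun setT (fun x => (`|h' x - h x|)%:E).
  by apply/measurable_EFinP; apply: measurableT_comp => //; apply: measurable_funB.
have step1 : ((delta * vol (n + 1))%:E <= \int[mu]_(x in cell (n + 1) L) (`|h' x - h x|)%:E)%E.
  have le1 (u w : V -> R) : measurable_fun setT u -> measurable_fun setT w ->
      (forall x, 0 <= u x) -> (forall x, 0 <= w x) ->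
      (forall x, u x <= `|h' x - h x| + w x) ->
      (\int[mu]_(x in cell (n + 1) L) (u x)%:E <=
       \int[mu]_(x in cell (n + 1) L) (`|h' x - h x|)%:E + \int[mu]_(x in cell (n + 1) L) (w x)%:E)%E.
    move=> mu_ mw u0 w0 uw; rewrite -ge0_integralD//; last 3 first.
    - exact: measurable_funTS.
    - by move=> x _; rewrite lee_fin.
    - exact/measurable_funTS/measurable_EFinP.
    apply: ge0_le_integral => //.
    - by move=> x _; rewrite lee_fin.
    - exact/measurable_funTS/measurable_EFinP.
    - apply: emeasurable_funD; first exact: measurable_funTS.
      exact/measurable_funTS/measurable_EFinP.
    - by move=> x _; rewrite -EFinD lee_fin.
  have k1 x : h x <= `|h' x - h x| + h' x.
    by have := ler_norm (h x - h' x); rewrite distrC; lra.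
  have k2 x : h' x <= `|h' x - h x| + h x.
    by have := ler_norm (h' x - h x); lra.
  have := le1 h' h mh' mh h'0 h0 k2; have := le1 h h' mh mh' h0 h'0 k1; rewrite -EL -ER.
  have D0 : (0 <= \int[mu]_(x in cell (n + 1) L) (`|h' x - h x|)%:E)%E by exact: integral_ge0.
  have v0 := vol_gt0 (R := R) (n + 1).
  move: D0; case: (integral _ _ _) => [r| |] //; last by move=> *; rewrite leey.
  rewrite -!EFinD !lee_fin /delta -[X in `|_| * X](gtr0_norm v0) -normrM mulrBl => r0 l1 l2.
  by rewrite ler_norml; apply/andP; split; lra.
pose f x := `|G x ord0 i| * band t (g x).
have f0 x : 0 <= f x by rewrite mulr_ge0.
have mf : measurable_fun setT f.
  apply: measurable_funM.
    apply: measurableT_comp => //.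
    exact: (measurableT_comp (measurable_rV_coord i) measurable_weak_gradient).
  exact: (measurableT_comp (measurable_band t) mg).
(* The [2] in [2 * tau] passes from the volume of the child to that of the parent. *)
have step2 : ((delta / (2 * tau) * vol n)%:E <= \int[mu]_(x in cell n z) (f x)%:E)%E.
  have [_ lG W] := wG.
  have := le_trans step1 (segment_band_integral z splitE t0 ig (lG i) (fun phi tphi _ => W i phi tphi)).
  have t1 : (0 <= (tau^-1)%:E)%E by rewrite lee_fin invr_ge0 ltW.
  move=> /(lee_wpmul2l t1); rewrite muleA -!EFinM mulVf ?gt_eqF// mul1e.
  by rewrite (volS n) (_ : delta / (2 * tau) * (2 * vol (n + 1)) = tau^-1 * (delta * vol (n + 1)))//; field; rewrite gt_eqF.
have d0 : 0 <= delta by exact: normr_ge0.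
have t2 : 0 < 2 * tau by rewrite mulr_gt0.
have c0 : 0 <= delta / (2 * tau) by rewrite divr_ge0// ltW.
have := jensen_powR p1 c0 (ltW (vol_gt0 n)) (measurable_cell _ _) (cell_volume hd n z)
  (measurable_funTS mf) f0 step2 => step3.
have step4 : (\int[mu]_(x in cell n z) (f x `^ p)%:E <=
    \int[mu]_(x in cell n z) gradient_density p t g G x)%E.
  apply: ge0_le_integral => //.
  - by move=> x _; rewrite lee_fin powR_ge0.
  - by apply/measurable_EFinP; apply: (measurableT_comp (measurable_powR _)); exact: measurable_funTS.
  - by apply: measurable_funTS; exact: measurable_gradient_density.
  move=> x _; rewrite lee_fin /f /band; case: (t < `|g x| < 2 * t) => /=; last first.
    by rewrite !mulr0 powR0// gt_eqF.
  rewrite !mulr1 ge0_ler_powR ?nnegrE ?enorm_ge0 ?(ltW p0)//.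
  exact: norm_coord_le_enorm.
have tp : 0 <= (2 * tau) `^ p by exact: powR_ge0.
have tp' : (2 * tau) `^ p <= 4 `^ p * rad d n `^ (1 * p).
  have rn := rad_gt0 (R := R) (d := d) n.
  rewrite mul1r -powRM ?(ltW rn)// ge0_ler_powR ?nnegrE ?(ltW p0) ?mulr_ge0 ?(ltW tau0) ?(ltW rn)//.
  have st : tau <= 2 * rad d n := side_le_rad hd z splitE.
  rewrite (_ : 4 * rad d n = 2 * (2 * rad d n)) ?ler_pM2l//; ring.
have -> : delta `^ p * vol n = (2 * tau) `^ p * ((delta / (2 * tau)) `^ p * vol n).
  by rewrite mulrA -powRM ?(ltW t2)// (mulrC (2 * tau) (delta / _)) divfK// gt_eqF.
rewrite EFinM; apply: (@le_trans _ _ (((2 * tau) `^ p)%:E *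
    \int[mu]_(x in cell n z) gradient_density p t g G x)%E).
  by apply: lee_wpmul2l; rewrite ?lee_fin//; exact: le_trans step3 step4.
apply: lee_wpmul2r; last by rewrite lee_fin.
by apply: integral_ge0 => x _; exact: gradient_density_ge0.
Qed.

(** The bands of different levels are disjoint. The induction keeps the sharper fact that the first
    [n] bands lie below [level M n]. *)
Lemma sum_band_le (M n : nat) (a : R) : \sum_(k < n) band (level M k) a <= 1.
Proof.
suff : \sum_(k < n) band (level M k) a <= (`|a| < level M n)%R%:R.
  by move=> /le_trans; apply; case: (_ < _).
elim: n => [|n IH]; first by rewrite big_ord0.
rewrite big_ord_recr /= levelS [band (level M n) a]/band.
have := level_gt0 (R := R) M n; move: IH.
move: (level M n) (\sum_(k < n) _) `|a| => u S b; case: (ltP b u) => h1; case: (ltP u b) => h2;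
  case: (ltP b (2 * u)) => h3 /=; rewrite ?mulr1n ?mulr0n => k1 k2; lra.
Qed.

Lemma sum_gradient_density (p : R) (M n : nat) :
  (\sum_(k < n) \int[mu]_x gradient_density p (level M k) g G x <=
   \int[mu]_x (enorm (G x) `^ p)%:E)%E.
Proof.
rewrite -ge0_integral_sum//; last 2 first.
- by move=> k; exact: measurable_gradient_density.
- by move=> k x _; exact: gradient_density_ge0.
apply: ge0_le_integral => //.
- by move=> x _; apply: sume_ge0 => k _; exact: gradient_density_ge0.
- by apply: emeasurable_sum => k; exact: measurable_gradient_density.
- by apply/measurable_EFinP; exact: measurable_enorm_powR.
move=> x _; rewrite sumEFin lee_fin -mulr_sumr ler_piMr ?powR_ge0//.
exact: sum_band_le.
Qed.

End gradient.

Theorem theorem1p1 (R : realType) (d : nat)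
    (s gamma p q alpha beta1 beta2 : R)
    (hd : (1 <= d)%N) (hs : 0 <= s <= 1) (hgamma : 1 < gamma)
    (hp : 1 <= p) (hq : 1 <= q) (halpha : 0 < alpha < d%:R)
    (hbeta1 : 0 < beta1) (hbeta2 : 0 < beta2)
    (hscale1 : beta1 * p + 2 * beta2 * q = 1)
    (hscale2 : (d%:R - s * p) * beta1 + (d%:R + alpha) * beta2 = d%:R / gamma)
    (hge1 : 1 <= beta1 * gamma + beta2 * gamma) :
  exists C : R, 0 < C /\
    forall g : 'rV[R]_d -> R,
      (lebesgue_rV d).-integrable [set: 'rV[R]_d] (EFin \o g) ->
      compact (ess_supp g) ->
      ('N[lebesgue_rV d]_(gamma%:E)[EFin \o g] <=
       C%:E * (sobolev_seminorm [set: 'rV[R]_d] s p g `^ (beta1 * p)%R *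
               coulomb_energy alpha q g `^ beta2))%E.
Proof.
have gamma0 : 0 < gamma by lra.
have p0 : 0 < p by lra.
have /andP[alpha0 _] := halpha.
have d0 : (0 : R) < d%:R by rewrite ltr0n.
(* For [s = 0] the second scaling relation times [gamma] says that [d] equals [d (beta1 + beta2)
   gamma + alpha beta2 gamma], which is larger than [d] by [hge1]. *)
have s0 : s != 0.
  apply/eqP => s0; move: hscale2; rewrite s0 mul0r subr0 => H.
  have : d%:R = (d%:R * beta1 + (d%:R + alpha) * beta2) * gamma by rewrite H divfK// gt_eqF.
  have : 0 < alpha * beta2 * gamma by rewrite !mulr_gt0.
  have : d%:R <= d%:R * (beta1 * gamma + beta2 * gamma) by rewrite ler_peMr// ltW.
  lra.
have [s1|s1] := eqVneq s 1.
  have K0 : 0 < (4 : R) `^ p by rewrite powR_gt0.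
  have [C C0 H] := coulomb_sobolev_of_levels hd gamma0 hp hq halpha hbeta1 hbeta2 hscale1 hscale2 hge1 K0.
  exists C; split => // g ig _; rewrite /sobolev_seminorm (negbTE s0) s1 eqxx.
  have mg : measurable_fun setT g by move/integrableP : (ig) => [/measurable_EFinP].
  case: asboolP => [wg|_].
    have wG : is_weak_gradient setT g (weak_gradient setT g) := getPex wg.
    apply: (H g (fun t => gradient_density p t g (weak_gradient setT g))) => //.
    - by move=> t t0; exact: measurable_gradient_density.
    - by move=> t x; exact: gradient_density_ge0.
    - by move=> t t0; rewrite s1; exact: gradient_oscillation.
    - by move=> M n; exact: sum_gradient_density.
  (* Without a weak gradient the seminorm is [+oo], and so may be the density. *)
  rewrite -(poweRyr (_ : p^-1 != 0)); last by rewrite invr_eq0 gt_eqF.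
  apply: (H g (fun _ _ => +oo%E)) => //; last by move=> M n; rewrite leey.
  move=> t t0 n z.
  have -> : (\int[lebesgue_rV d]_(x in cell n z) +oo = +oo :> \bar R)%E.
    rewrite (integral_cst _ (measurable_cell n z)).
    change (+oo * lebesgue_rV d (cell n z) = +oo :> \bar R)%E.
    by rewrite cell_volume// gt0_mulye// lte_fin vol_gt0.
  by rewrite gt0_muley ?leey// lte_fin mulr_gt0// powR_gt0// rad_gt0.
have s01 : 0 <= s by case/andP : hs.
have K0 : 0 < 4 * (2 * d%:R : R) `^ (d%:R + s * p) by rewrite mulr_gt0// powR_gt0// mulr_gt0.
have [C C0 H] := coulomb_sobolev_of_levels hd gamma0 hp hq halpha hbeta1 hbeta2 hscale1 hscale2 hge1 K0.
exists C; split => // g ig _; rewrite /sobolev_seminorm (negbTE s0) (negbTE s1).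
have mg : measurable_fun setT g by move/integrableP : (ig) => [/measurable_EFinP].
have mT (t : R) : measurable_fun setT (fun x => trunc t `|g x|).
  by apply: measurableT_comp; [exact: measurable_trunc|exact: measurableT_comp].
apply: (H g (fun t => gagliardo_density s p (fun x => trunc t `|g x|))) => //.
- by move=> t t0; exact: measurable_gagliardo_density.
- by move=> t x; exact: gagliardo_density_ge0.
- move=> t t0; apply: (gagliardo_oscillation hd hp s01 (t := t)) => // x.
    by apply: trunc_ge0; exact: ltW.
  by apply: trunc_le; exact: ltW.
- by move=> M n; exact: sum_gagliardo_trunc.
Qed.
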